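(* Assume that $\mu$ is invariant for $(P_t)_{t\ge0}$, but not necessarily symmetric, and that $\mu$ satisfies a Poincaré inequality with constant $C_P$, i.e. $\mathrm{Var}_\mu(f)\le C_P\int\Gamma(f,f)\,d\mu$ for all smooth $f$. Then for every $1<p<+\infty$ there exist constants $\lambda_p>0$ and $K_p<+\infty$ such that for all $f\in L^p(\mu)$ and all $t\ge0$, $$N_p(P_tf)\le K_p\,e^{-\lambda_p t}\,N_p(f).$$ Moreover, for $p\ge2$ one may choose $K_p=1$ (for some $\lambda_p>0$), and the following bounds are available: (i) for $p>2$, the inequality holds with $K_p=1$ and some $\lambda_p>0$ satisfying $\lambda_p\ge \frac{2^{k+6}}{2^{7\times2^{k+1}}C_P}$ if $2^{k+1}\ge p>2^k$ for some integer $k>1$; (ii) for $p>2$, the inequality holds with $\lambda_p=\frac1{p\,C_P}$ and $K_p=4^{1-\frac1p}$, and if $p=2^k$ with $k\ge1$ an integer it holds with $\lambda_p=\frac{2}{2^k\,C_P}$ and $K_p=4^{1-\frac2p}$; (iii) for $p\ge2$, the inequality holds with $\lambda_p=\frac{4(p-1)}{9\,p^2\,(1\vee2^{p-3})\,2^p\,C_P}$ and $K_p^p=1+\frac{\frac{9p^2}{4}(p-1)\,2^{(3p-2)/2}\,(1\vee2^{p-3})}{\frac{9p^2}{4}(1\vee2^{p-3})\,2^{p-1}-p+1}$.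
   Context: Setting. $(X_t)$ is a Markov process with infinitesimal generator $L$, semi-group $(P_t)_{t\ge0}$ and Polish state space $E$. The extended domain of $L$ contains a nice core $\mathcal D$ of uniformly continuous functions, which contains the constants and is an algebra; functions in $\mathcal D$ are called smooth. The carré du champ operator is $\Gamma(f,g)=\frac12\left(L(fg)-f\,Lg-g\,Lf\right)$. The probability measure $\mu$ on $E$ is invariant (stationary) for $(P_t)$, so that $(P_t)$ is a contraction semi-group on $L^p(\mu)$ for all $1\le p\le+\infty$ and, for smooth $f$, $-\int f\,Lf\,d\mu=\int\Gamma(f,f)\,d\mu$; $L$ is not assumed to be $\mu$-symmetric. The process is a diffusion: $\Gamma$ comes from a derivation, $\Gamma(fg,h)=f\,\Gamma(g,h)+g\,\Gamma(f,h)$, and the chain rule $L(\varphi(f))=\varphi'(f)\,Lf+\varphi''(f)\,\Gamma(f,f)$ holds for $\varphi$ of class $C^2$. Notation. $\|f\|_p^p=\int|f|^p\,d\mu$, $N_p(f)=\|f-\int f\,d\mu\|_p$, $\mathrm{Var}_\mu(f)=\int f^2\,d\mu-\left(\int f\,d\mu\right)^2$, and $a\vee b=\max(a,b)$. *)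

(* Defs.v *)
From HB Require Import structures.
From mathcomp Require Export all_boot all_order all_algebra.
From mathcomp Require Export all_classical all_reals all_analysis measurable_realfun.

Set Implicit Arguments.
Unset Strict Implicit.
Unset Printing Implicit Defensive.

Export Order.TTheory GRing.Theory Num.Theory.
Export numFieldNormedType.Exports.

Local Open Scope classical_set_scope.
Local Open Scope ring_scope.

(* A Polish space, with the complete metric to which uniform continuity refers
   fixed by the pseudometric structure of E. *)
Definition polish (R : realType) (E : completePseudoMetricType R) : Prop :=
  hausdorff_space E /\ @second_countable E.

Notation borel E := (g_sigma_algebraType (@open E)).

Section Semigroup.
Variables (R : realType) (E : completePseudoMetricType R).
Variables (P : R -> R.-pker borel E ~> borel E) (mu : probability (borel E) R).

(* (P_t) is given by the transition kernels P t x A = Pr_x (X_t \in A), for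
   t >= 0; the values at negative t are irrelevant. *)
Definition semigroup (t : R) (f : borel E -> R) : borel E -> R :=
  fun x => \int[P t x]_y f y.

(* Joint measurability in (t, x) is what gives a meaning to the time integral
   in the extended generator below; it holds for every Markov process with
   right-continuous paths. *)
Record markov_semigroup : Prop := {
  markov0 : forall (x : borel E) (A : set (borel E)), measurable A ->
    P 0 x A = \d_x A;
  markovD : forall (s t : R) (x : borel E) (A : set (borel E)),
    0 <= s -> 0 <= t -> measurable A ->
    P (s + t) x A = (\int[P s x]_y P t y A)%E;
  markov_measurable : forall A : set (borel E), measurable A ->
    measurable_fun [set tx : measurableTypeR R * borel E | 0 <= tx.1]
      (fun tx => P tx.1 tx.2 A) }.

Definition invariant : Prop :=
  forall (t : R) (A : set (borel E)), 0 <= t -> measurable A ->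
    (\int[mu]_x P t x A)%E = mu A.

Definition Lpnorm (p : R) (f : borel E -> R) : \bar R :=
  'N[mu]_p%:E[EFin \o f]%E.
Arguments Lpnorm p%_R f%_R.

Definition strongly_continuous_L2 : Prop :=
  forall f, f \in Lfun mu 2%:E ->
    Lpnorm 2 (fun x => semigroup h f x - f x) @[h --> 0^'+] --> 0%E.

(* By the Markov property and the invariance of mu, for mu-integrable f and g,
   this says exactly that f(X_t) - f(X_0) - \int_0^t g(X_s) ds is a martingale
   for the process X with initial law mu. *)
Definition extended_generator (f g : borel E -> R) : Prop :=
  [/\ f \in Lfun mu 1%:E, g \in Lfun mu 1%:E &
      forall t : R, 0 <= t -> {ae mu, forall x,
        semigroup t f x - f x =
        \int[lebesgue_measure]_(s in `[0, t]) semigroup s g x}].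

Definition extended_domain (f : borel E -> R) : Prop :=
  exists g, extended_generator f g.

Definition L2_generator (f g : borel E -> R) : Prop :=
  [/\ f \in Lfun mu 2%:E, g \in Lfun mu 2%:E &
      Lpnorm 2 (fun x => h^-1 * (semigroup h f x - f x) - g x) @[h --> 0^'+]
        --> 0%E].

Variables (L : (borel E -> R) -> (borel E -> R)) (D : set (borel E -> R)).

Definition carre_du_champ (f g : borel E -> R) : borel E -> R :=
  fun x => 2^-1 * (L (f \* g) x - f x * L g x - g x * L f x).

(* D is dense in the domain of the L^2(mu)-generator for the graph norm. *)
Definition L2_core : Prop :=
  (forall f, D f -> f \in Lfun mu 2%:E /\ L f \in Lfun mu 2%:E) /\
  forall f g, L2_generator f g -> forall e : R, 0 < e ->
    exists2 h, D h &
      (Lpnorm 2 (h \- f) < e%:E)%E /\ (Lpnorm 2 (L h \- g) < e%:E)%E.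

Definition C2_bounded_derivatives (phi : R -> R) : Prop :=
  [/\ forall x : R, derivable phi x 1,
      forall x : R, derivable (derive1 phi) x 1,
      continuous (derive1n 2 phi : R -> R) &
      exists M : R, forall x, `|derive1 phi x| <= M /\ `|derive1n 2 phi x| <= M].

(* L is only determined up to mu-negligible sets, and is irrelevant outside of
   the extended domain.  The chain rule is required only when phi has bounded
   derivatives, in which case both sides are automatically mu-integrable.  The
   contractivity of (P_t) on L^p(mu) and the identity
   - \int f L f dmu = \int Gamma(f, f) dmu on D are consequences of these
   conditions and of the invariance of mu. *)
Record diffusion : Prop := {
  diffusion_markov : markov_semigroup;
  diffusion_continuous : strongly_continuous_L2;
  diffusion_generator : forall f,
    extended_domain f -> extended_generator f (L f);
  diffusion_domain : forall f, D f -> extended_domain f;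
  diffusion_core : L2_core;
  diffusion_unif_continuous : forall f, D f ->
    unif_continuous (f : E -> R);
  diffusion_cst : forall a : R, D (cst a);
  diffusion_add : forall f g, D f -> D g -> D (f \+ g);
  diffusion_mul : forall f g, D f -> D g -> D (f \* g);
  diffusion_derivation : forall f g h, D f -> D g -> D h ->
    {ae mu, forall x, carre_du_champ (f \* g) h x =
      f x * carre_du_champ g h x + g x * carre_du_champ f h x};
  diffusion_chain_rule : forall (f : borel E -> R) (phi : R -> R),
    D f -> C2_bounded_derivatives phi ->
    extended_domain (phi \o f) /\
    {ae mu, forall x, L (phi \o f) x =
      derive1 phi (f x) * L f x + derive1n 2 phi (f x) * carre_du_champ f f x} }.

Definition variance (f : borel E -> R) : R :=
  \int[mu]_x (f x ^+ 2) - (\int[mu]_x f x) ^+ 2.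

Definition poincare (CP : R) : Prop :=
  forall f, D f -> variance f <= CP * \int[mu]_x carre_du_champ f f x.

Definition centered_norm (p : R) (f : borel E -> R) : \bar R :=
  Lpnorm p (fun x => f x - \int[mu]_y f y).

Definition exponential_decay (p lambda K : R) : Prop :=
  forall f, f \in Lfun mu p%:E -> forall t : R, 0 <= t ->
    (centered_norm p (semigroup t f) <=
      (K * expR (- lambda * t))%:E * centered_norm p f)%E.

End Semigroup.

(* Main.v *)
From HB Require Import structures.
Require Import Defs.
From mathcomp Require Import ring lra zify.
Set Implicit Arguments.
Unset Strict Implicit.
Unset Printing Implicit Defensive.
Local Open Scope classical_set_scope.
Local Open Scope ring_scope.

(** The whole statement follows from the decay of the variance,
    [Var (P_t f) <= exp (- 2 t / CP) Var f], and from the fact that each [P_t]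
    is given by Markov kernels that preserve [mu].

    Variance decay ([diffusion_variance_decay]).  For bounded [f] the time
    average [F] of [P_u f] over [[0, s]] is in the domain of the generator of
    the semigroup on square integrable functions, because the increments of [F]
    are boundary terms ([average_increment]).  The Poincaré inequality
    [Var F <= - CP * \int F G dmu], where [G] is the image of [F] under the
    generator, holds on the core since [L (f ^ 2)] has mean zero
    ([poincare_core]), and passes to [(F, G)] by density in the graph norm
    ([poincare_generator]).  As the remainder of the first-order expansion of
    [P_h F] does not increase along the semigroup, a step of size [h]
    multiplies the variance by [1 - 2 h / CP] up to [o(h)], uniformly in time
    ([variance_step]); iterating and letting [h] tend to [0] gives the decay for
    [F].  Such [F] are dense, whence the general case.

    Prefactor [1], for every [p > 1] ([strict_contraction]).  Let [f] be
    centered, [f+] and [f-] its positive and negative parts, and [g+], [g-]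
    their powers [p / 2].  A Jensen inequality for the kernel bounds
    [|P_t f| ^ p] by means of [P_t (|f| ^ p)] and of the squares of [P_t g+] and
    [P_t g-] ([ae_powR_kop_le]); integrated, with the variance decay for [g+]
    and [g-], it shows that the moment [\int |f| ^ p dmu] decreases at least by
    a multiple of [Var g+ + Var g-] ([powR_kop_half_variance]).  If this sum is
    small then [f] is close to a constant, hence to [0], so that the sum
    controls the moment itself ([centered_powR_le_half_variance]).  Iterated
    over short times, this strict contraction gives an exponential rate.

    Explicit bounds.  Truncating a centered [f] at level [s], the bounded part
    contributes at most [2 s] to [P_t f], so that
    [\int (|P_t f| - 2 s)_+ ^ 2 dmu <= exp (- 2 t / CP) \int (|f| - s)_+ ^ 2 dmu].
    Integrating this over all levels with a suitable weight gives
    [\int |P_t f| ^ p dmu <= 2 ^ (p - 2) exp (- 2 t / CP) \int |f| ^ p dmu]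
    for [p > 2] ([powR_kop_interpolation]), which is the interpolation of the
    quadratic and the uniform estimates with its sharp constant and implies the
    bounds with prefactors [4 ^ (1 - 1 / p)] and [4 ^ (1 - 2 / p)].  The last
    bound is a geometric mean of this one with the contraction property of [P_t]
    ([exponential_decay_geometric]). *)

(** * Integrable real functions *)

(** Integrability of a real-valued function on the whole space, as a constant
    of its own so that the closure lemmas below apply by plain unification. *)
Definition itg d (T : measurableType d) (R : realType)
    (mu : {measure set T -> \bar R}) (f : T -> R) : Prop :=
  mu.-integrable setT (EFin \o f).

(** Measurable functions with an integrable square. *)
Definition sqi d (T : measurableType d) (R : realType)
    (mu : {measure set T -> \bar R}) (f : T -> R) : Prop :=
  measurable_fun setT f /\ itg mu (fun x => f x ^+ 2).

Section Integrable.
Context d (T : measurableType d) (R : realType).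
Variable mu : {measure set T -> \bar R}.
Implicit Types f g : T -> R.

Lemma itg_meas f : itg mu f -> measurable_fun setT f.
Proof. by move=> /measurable_int /measurable_EFinP. Qed.

Lemma itg_le f g : measurable_fun setT f -> (forall x, `|f x| <= g x) ->
  itg mu g -> itg mu f.
Proof.
move=> mf fg ig; apply: le_integrable ig => //; first exact/measurable_EFinP.
move=> x _ /=; rewrite lee_fin; apply: le_trans (fg x) _; exact: ler_norm.
Qed.

Lemma itgD f g : itg mu f -> itg mu g -> itg mu (fun x => f x + g x).
Proof. by move=> hf hg; exact: (integrableD measurableT hf hg). Qed.

Lemma itgB f g : itg mu f -> itg mu g -> itg mu (fun x => f x - g x).
Proof. by move=> hf hg; exact: (integrableB measurableT hf hg). Qed.

Lemma itgN f : itg mu f -> itg mu (fun x => - f x).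
Proof. by move=> hf; exact: (integrableN hf). Qed.

Lemma itgZ k f : itg mu f -> itg mu (fun x => k * f x).
Proof. by move=> hf; exact: (integrableZl measurableT k hf). Qed.

Lemma itg_norm f : itg mu f -> itg mu (fun x => `|f x|).
Proof. by move=> hf; exact: (integrable_norm hf). Qed.

Lemma EFin_Rint f : itg mu f ->
  (\int[mu]_x f x)%:E = (\int[mu]_x (f x)%:E)%E.
Proof. by move=> hf; rewrite /Rintegral fineK//; exact: integrable_fin_num. Qed.

Lemma RintD f g : itg mu f -> itg mu g ->
  \int[mu]_x (f x + g x) = \int[mu]_x f x + \int[mu]_x g x.
Proof. by move=> hf hg; rewrite RintegralD. Qed.

Lemma RintB f g : itg mu f -> itg mu g ->
  \int[mu]_x (f x - g x) = \int[mu]_x f x - \int[mu]_x g x.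
Proof. by move=> hf hg; rewrite RintegralB. Qed.

Lemma RintZ k f : itg mu f -> \int[mu]_x (k * f x) = k * \int[mu]_x f x.
Proof. by move=> hf; rewrite RintegralZl. Qed.

Lemma le_Rint f g : itg mu f -> itg mu g -> (forall x, f x <= g x) ->
  \int[mu]_x f x <= \int[mu]_x g x.
Proof. by move=> hf hg fg; apply: le_Rintegral. Qed.

Lemma ae_le_Rint f g : itg mu f -> itg mu g ->
  {ae mu, forall x, f x <= g x} -> \int[mu]_x f x <= \int[mu]_x g x.
Proof.
move=> hf hg fg; rewrite -subr_ge0 -RintB//.
have -> : \int[mu]_x (g x - f x) = \int[mu]_x (Num.max 0 (g x - f x)).
  rewrite /Rintegral; congr fine; apply: ae_eq_integral => //.
  - exact/measurable_EFinP/itg_meas/itgB.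
  - apply/measurable_EFinP/measurable_maxr => //.
    exact: itg_meas (itgB hg hf).
  - by apply: filterS fg => x fgx _; rewrite max_r// subr_ge0.
by apply: Rintegral_ge0 => x _; rewrite le_max lexx.
Qed.

Lemma ae_eq_Rint f g : measurable_fun setT f -> measurable_fun setT g ->
  {ae mu, forall x, f x = g x} -> \int[mu]_x f x = \int[mu]_x g x.
Proof.
move=> mf mg fg; rewrite /Rintegral; congr fine; apply: ae_eq_integral => //.
- exact/measurable_EFinP.
- exact/measurable_EFinP.
- by apply: filterS fg => x fgx _; rewrite fgx.
Qed.

Lemma ae_itg_le f g : measurable_fun setT f ->
  {ae mu, forall x, `|f x| <= g x} -> itg mu g -> itg mu f.
Proof.
move=> mf fg ig; have mg := itg_meas ig.
apply/integrableP; split; first exact/measurable_EFinP.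
have /integrableP[_] := ig; apply: le_lt_trans.
apply: ae_ge0_le_integral => //.
- by apply: measurableT_comp => //; exact/measurable_EFinP.
- by apply: measurableT_comp => //; exact/measurable_EFinP.
- apply: filterS fg => x fgx _ /=; rewrite lee_fin.
  exact: le_trans fgx (ler_norm _).
Qed.

Lemma sqi_mul f g : sqi mu f -> sqi mu g -> itg mu (fun x => f x * g x).
Proof.
move=> [mf hf] [mg hg]; apply: itg_le (itgD hf hg).
  exact: measurable_funM.
move=> x; rewrite normrM -(real_normK (num_real (f x))).
rewrite -(real_normK (num_real (g x))).
have := sqr_ge0 (`|f x| - `|g x|).
have := normr_ge0 (f x); have := normr_ge0 (g x); nra.
Qed.

Lemma sqiD f g : sqi mu f -> sqi mu g -> sqi mu (fun x => f x + g x).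
Proof.
move=> hf hg; split; first exact: measurable_funD hf.1 hg.1.
rewrite (_ : (fun x => _) =
    (fun x => f x ^+ 2 + g x ^+ 2 + 2 * (f x * g x))).
  by apply: itgD (itgD hf.2 hg.2) (itgZ 2 (sqi_mul hf hg)).
by apply/funext => x; ring.
Qed.

Lemma sqiZ k f : sqi mu f -> sqi mu (fun x => k * f x).
Proof.
move=> [mf hf]; split; first exact: measurable_funM.
rewrite (_ : (fun x => _) = (fun x => k ^+ 2 * f x ^+ 2)); first exact: itgZ.
by apply/funext => x; ring.
Qed.

Lemma sqiN f : sqi mu f -> sqi mu (fun x => - f x).
Proof.
move=> hf; rewrite (_ : (fun x => _) = (fun x => -1 * f x)); first exact: sqiZ.
by apply/funext => x; ring.
Qed.

Lemma sqiB f g : sqi mu f -> sqi mu g -> sqi mu (fun x => f x - g x).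
Proof. by move=> hf hg; apply: sqiD => //; exact: sqiN. Qed.

Lemma sqi_le f g : measurable_fun setT f -> (forall x, `|f x| <= g x) ->
  sqi mu g -> sqi mu f.
Proof.
move=> mf fg [mg hg]; split => //; apply: itg_le hg => [|x].
  exact: measurable_funX.
rewrite normrX lerXn2r// nnegrE//; exact: le_trans (fg x).
Qed.

Lemma sqi_sqr f : sqi mu f -> itg mu (fun x => f x ^+ 2).
Proof. by case. Qed.

Hypothesis mu1 : mu setT = 1%E.

Lemma itg_cst k : itg mu (fun=> k).
Proof.
apply/integrableP; split; first by apply/measurable_EFinP; exact: measurable_cst.
rewrite (eq_integral (cst `|k|%:E))//.
by rewrite integral_cst// mu1 mule1 ltry.
Qed.

Lemma Rint_cst k : \int[mu]_x k = k.
Proof. by rewrite Rintegral_cst// mu1 mulr1. Qed.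

Lemma sqi_cst k : sqi mu (fun=> k).
Proof. by split => //; exact: itg_cst. Qed.

Lemma sqi_itg f : sqi mu f -> itg mu f.
Proof.
move=> hf; have := sqi_mul hf (sqi_cst 1).
by congr itg; apply/funext => x; rewrite mulr1.
Qed.

End Integrable.

Section CauchySchwarz.
Context d (T : measurableType d) (R : realType).
Variable mu : {measure set T -> \bar R}.
Implicit Types f g : T -> R.

(** The Cauchy-Schwarz inequality. *)
Lemma Rint_CS f g : sqi mu f -> sqi mu g ->
  (\int[mu]_x (f x * g x)) ^+ 2 <=
  \int[mu]_x (f x ^+ 2) * \int[mu]_x (g x ^+ 2).
Proof.
move=> hf hg.
set a := \int[mu]_x (f x ^+ 2); set b := \int[mu]_x (g x ^+ 2).
set c := \int[mu]_x (f x * g x).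
have a0 : 0 <= a by apply: Rintegral_ge0 => x _; exact: sqr_ge0.
have H (s t : R) : 0 <= s ^+ 2 * a + 2 * s * t * c + t ^+ 2 * b.
  suff <- : \int[mu]_x ((s * f x + t * g x) ^+ 2) =
      s ^+ 2 * a + 2 * s * t * c + t ^+ 2 * b.
    by apply: Rintegral_ge0 => x _; exact: sqr_ge0.
  rewrite (_ : (fun x => _) = (fun x =>
      s ^+ 2 * f x ^+ 2 + 2 * s * t * (f x * g x) + t ^+ 2 * g x ^+ 2)).
    have ifg := sqi_mul hf hg; have i1 := itgZ (s ^+ 2) hf.2.
    have i2 := itgZ (2 * s * t) ifg; have i3 := itgZ (t ^+ 2) hg.2.
    rewrite (RintD (itgD i1 i2) i3) (RintD i1 i2).
    by rewrite (RintZ _ hf.2) (RintZ _ ifg) (RintZ _ hg.2).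
  by apply/funext => x; ring.
have [a00|aN0] := eqVneq a 0.
  suff -> : c = 0 by rewrite a00 expr0n mul0r.
  have b0 : 0 <= b by apply: Rintegral_ge0 => x _; exact: sqr_ge0.
  have := H (b + 1) (- c); rewrite a00 => h.
  have : (b + 2) * c ^+ 2 <= 0 by nra.
  rewrite pmulr_rle0 ?ltr_wpDl// => c0.
  by apply/eqP; rewrite -sqrf_eq0 eq_le c0 sqr_ge0.
have ap : 0 < a by rewrite lt_neqAle eq_sym aN0.
have := H (- c) a.
rewrite (_ : _ + _ = a * (a * b - c ^+ 2)); last by ring.
by rewrite pmulr_rge0// subr_ge0.
Qed.

Lemma Rint_sqr_le f : mu setT = 1%E -> sqi mu f ->
  (\int[mu]_x f x) ^+ 2 <= \int[mu]_x (f x ^+ 2).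
Proof.
move=> mu1 hf; have := Rint_CS hf (sqi_cst mu1 1).
under eq_Rintegral do rewrite mulr1.
by rewrite expr1n Rint_cst// mulr1.
Qed.

Lemma Rint_CS_le f g (a b : R) : sqi mu f -> sqi mu g -> 0 <= a -> 0 <= b ->
  \int[mu]_x (f x ^+ 2) <= a ^+ 2 -> \int[mu]_x (g x ^+ 2) <= b ^+ 2 ->
  `|\int[mu]_x (f x * g x)| <= a * b.
Proof.
move=> sf sg a0 b0 hf hg; rewrite -(@ler_pXn2r _ 2) ?nnegrE ?mulr_ge0//.
rewrite real_normK ?num_real//; apply: le_trans (Rint_CS sf sg) _.
by rewrite exprMn; apply: ler_pM => //; apply: Rintegral_ge0 => x _; exact: sqr_ge0.
Qed.

Lemma Rint_mean_le f (a : R) : mu setT = 1%E -> sqi mu f -> 0 <= a ->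
  \int[mu]_x (f x ^+ 2) <= a ^+ 2 -> `|\int[mu]_x f x| <= a.
Proof.
move=> mu1 sf a0 hf; rewrite -(@ler_pXn2r _ 2) ?nnegrE//.
by rewrite real_normK ?num_real//; apply: le_trans (Rint_sqr_le mu1 sf) _.
Qed.

End CauchySchwarz.

(** * Integration against kernels *)

Section Mixture.
Context d d' (X : measurableType d) (Y : measurableType d') (R : realType).
Variable k : X -> {measure set Y -> \bar R}.
Hypothesis mk : forall A, measurable A -> measurable_fun setT (k ^~ A).

Import HBNNSimple.

(** If the measure [m] is the mixture of the measures [k x] under [nu], then so
    are the integrals of nonnegative functions. *)
Lemma integral_mixture (nu : {measure set X -> \bar R}) (D : set X)
    (m : {measure set Y -> \bar R}) (g : Y -> \bar R) :
  measurable D ->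
  (forall A, measurable A -> (\int[nu]_(x in D) k x A)%E = m A) ->
  measurable_fun setT g -> (forall y, (0 <= g y)%E) ->
  (\int[nu]_(x in D) \int[k x]_y g y = \int[m]_y g y)%E.
Proof.
move=> mD H mg g0; pose g_ := nnsfun_approx measurableT mg.
have g_E y : (g y = limn (fun n => (g_ n y)%:E))%E.
  by apply/esym/cvg_lim => //=; exact: cvg_nnsfun_approx.
have Hs (h : {nnsfun Y >-> R}) :
    (\int[nu]_(x in D) \int[k x]_y (h y)%:E = \int[m]_y (h y)%:E)%E.
  under eq_integral do rewrite integralT_nnsfun sintegralE.
  rewrite ge0_integral_fsum//; last 2 first.
  - move=> r; apply: measurable_funeM; apply: measurable_funS (mk _) => //.
  - by move=> r x _; exact: nnsfun_mulemu_ge0.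
  rewrite integralT_nnsfun sintegralE; apply: eq_fsbigr => r _.
  have mA : measurable (h @^-1` [set r]) by [].
  rewrite -H//; have [r0|r0] := leP 0 r.
    rewrite ge0_integralZl//; exact: measurable_funS (mk mA).
  rewrite integral0_eq ?(preimage_nnfun0 _ r0) => [|x _].
    by rewrite integral0_eq ?mule0// => x _; rewrite measure0.
  by rewrite measure0 mule0.
transitivity (\int[nu]_(x in D) limn (fun n => \int[k x]_y (g_ n y)%:E))%E.
  apply: eq_integral => x _.
  rewrite -monotone_convergence//.
  - by apply: eq_integral => y _.
  - by move=> n; exact/measurable_EFinP.
  - by move=> n y _; rewrite lee_fin.
  - by move=> y _ a b ab; rewrite lee_fin; exact/lefP/nd_nnsfun_approx.
rewrite monotone_convergence//.
- under eq_fun do rewrite Hs.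
  rewrite -monotone_convergence//.
  + by apply: eq_integral => y _.
  + by move=> n; exact/measurable_EFinP.
  + by move=> n y _; rewrite lee_fin.
  + by move=> y _ a b ab; rewrite lee_fin; exact/lefP/nd_nnsfun_approx.
- move=> n; apply: measurable_funTS.
  apply: measurable_fun_integral_kernel => //.
    by move=> y; rewrite lee_fin.
  exact/measurable_EFinP.
- by move=> n x _; apply: integral_ge0 => y _; rewrite lee_fin.
- move=> x _ a b ab; apply: ge0_le_integral => //.
  + by move=> y _; rewrite lee_fin.
  + exact/measurable_EFinP.
  + exact/measurable_EFinP.
  + by move=> y _; rewrite lee_fin; exact/lefP/nd_nnsfun_approx.
Qed.

Lemma measurable_fine_fun d1 (T : measurableType d1) (f : T -> \bar R) :
  measurable_fun setT f -> measurable_fun setT (fine \o f).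
Proof. by move=> mf; apply: measurableT_comp. Qed.

Lemma measurable_Rintegral (f : Y -> R) : measurable_fun setT f ->
  measurable_fun setT (fun x => \int[k x]_y f y).
Proof.
move=> mf; have mF : measurable_fun setT (EFin \o f).
  exact/measurable_EFinP.
apply: (@measurable_fine_fun _ X (fun x => \int[k x]_y (f y)%:E)%E).
under eq_fun do rewrite integralE.
apply: emeasurable_funB; apply: measurable_fun_integral_kernel => //.
- exact: measurable_funepos.
- exact: measurable_funeneg.
Qed.

(** This bound needs no integrability: the real-valued integral is [0] whenever
    the extended one is infinite. *)
Lemma le_norm_Rintegral (m : {measure set Y -> \bar R}) (f : Y -> R) :
  measurable_fun setT f ->
  (`|\int[m]_y f y|%:E <= \int[m]_y `|f y|%:E)%E.
Proof.
move=> mf; have mF : measurable_fun setT (EFin \o f).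
  exact/measurable_EFinP.
have := le_abse_integral m measurableT mF.
apply: le_trans; rewrite /Rintegral.
case: (\int[m]_y (f y)%:E)%E => [r|//|//] /=; by rewrite ?normr0 ?leey.
Qed.

End Mixture.

(** * Pointwise inequalities between powers *)

Section Powers.
Context (R : realType).
Implicit Types a b x y m p q u v : R.

Lemma powR_sqr x p : (x `^ (p / 2)) ^+ 2 = x `^ p.
Proof.
by rewrite -powR_mulrn ?powR_ge0// -powRrM -mulrA mulVf ?mulr1.
Qed.

Lemma powR_le1D x a b : 0 <= x -> 0 <= a -> a <= b -> x `^ a <= 1 + x `^ b.
Proof.
move=> x0 a0 ab; have [x1|x1] := leP x 1.
  apply: (@le_trans _ _ 1); last by rewrite lerDl powR_ge0.
  by have := ge0_ler_powR a0 _ _ x1; rewrite powR1; apply; rewrite nnegrE.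
apply: (@le_trans _ _ (x `^ b)); last by rewrite lerDr.
by apply: ler_powR => //; exact: ltW.
Qed.

(** The graph of a convex power lies above its tangents. *)
Lemma powR_tangent q x m : 1 <= q -> 0 <= x -> 0 <= m ->
  m `^ q + q * m `^ (q - 1) * (x - m) <= x `^ q.
Proof.
move=> q1 x0 m0; have q0 : 0 < q by exact: lt_le_trans q1.
have [->|qN1] := eqVneq q 1.
  by rewrite subrr powRr0 !powRr1// mulr1 mul1r addrC subrK.
have {}q1 : 0 < q - 1 by rewrite subr_gt0 lt_neqAle eq_sym qN1.
have := conjugate_powR x0 (powR_ge0 m (q - 1)) q0 (divr_gt0 q0 q1).
have -> : q^-1 + (q / (q - 1))^-1 = 1 by field; rewrite !gt_eqF.
move=> /(_ erefl); rewrite -powRrM.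
have -> : (q - 1) * (q / (q - 1)) = q by field; rewrite gt_eqF.
rewrite -(ler_pM2l q0); have -> : q * (x `^ q / q + m `^ q / (q / (q - 1))) =
  x `^ q + (q - 1) * m `^ q by field; rewrite !gt_eqF.
have := mulr_powRB1 m0 q0.
set A := m `^ (q - 1) => e; nra.
Qed.

(** The weighted inequality between geometric and arithmetic means. *)
Lemma young_powR t a b : 0 < t -> t < 1 -> 0 <= a -> 0 <= b ->
  a `^ t * b `^ (1 - t) <= t * a + (1 - t) * b.
Proof.
move=> t0 t1 a0 b0; have s0 : 0 < 1 - t by rewrite subr_gt0.
have := @conjugate_powR _ (a `^ t) (b `^ (1 - t)) t^-1 (1 - t)^-1.
rewrite !invrK => /(_ (powR_ge0 _ _) (powR_ge0 _ _)).
rewrite !invr_gt0 => /(_ t0 s0 (subrKC _ _)).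
rewrite -(powRrM a) -(powRrM b) !divff ?gt_eqF// !powRr1//.
by rewrite (mulrC a) (mulrC b).
Qed.

(** The divergence of a power [p] between [1] and [2] controls the square of
    the increments of the power [p / 2]. *)
Lemma powR_bregman p x m : 1 < p -> p <= 2 -> 0 <= x -> 0 <= m ->
  (p - 1) * (x `^ (p / 2) - m `^ (p / 2)) ^+ 2 <=
  x `^ p - m `^ p - p * m `^ (p - 1) * (x - m).
Proof.
move=> p1 p2 x0 m0; have p0 : 0 < p by exact: lt_trans p1.
have pN0 : p != 0 by rewrite gt_eqF.
have {}p1 : 0 < p - 1 by rewrite subr_gt0.
have mE := mulr_powRB1 m0 p0.
rewrite -(powR_sqr x p) -(powR_sqr m p).
set u := x `^ (p / 2); set v := m `^ (p / 2).
suff H : p * m `^ (p - 1) * x <= (2 - p) * u ^+ 2 + 2 * (p - 1) * (u * v).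
  rewrite -(powR_sqr m p) -/v in mE; nra.
have u0 : 0 <= u by exact: powR_ge0.
have v0 : 0 <= v by exact: powR_ge0.
have [pE|pN2] := eqVneq p 2.
  rewrite /u /v pE divff// !powRr1// (_ : 2 - 1 = 1) ?powRr1//; last by ring.
  by rewrite le_eqVlt; apply/orP; left; apply/eqP; ring.
have {}p2 : 0 < 2 - p by rewrite subr_gt0 lt_neqAle pN2.
pose t := (2 - p) / p.
have t0 : 0 < t by exact: divr_gt0.
have t1 : t < 1 by rewrite ltr_pdivrMr//; lra.
have := young_powR t0 t1 (sqr_ge0 u) (mulr_ge0 u0 v0).
move=> /(ler_wpM2l (ltW p0)).
have -> : p * (t * u ^+ 2 + (1 - t) * (u * v)) =
  (2 - p) * u ^+ 2 + 2 * (p - 1) * (u * v) by rewrite /t; field.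
apply: le_trans; rewrite -mulrA; apply: ler_wpM2l; first exact: ltW.
rewrite le_eqVlt; apply/orP; left; apply/eqP; rewrite [LHS]mulrC.
rewrite (powRM _ u0 v0) mulrA -(powR_mulrn 2 u0) -(powRrM u) -powRD; last first.
  by apply/implyP => /eqP e; exfalso; move: e; lra.
rewrite -(powRrM x) -(powRrM m).
have -> : p / 2 * (2 * t + (1 - t)) = 1 by rewrite /t; field.
have -> : p / 2 * (1 - t) = p - 1 by rewrite /t; field.
by rewrite powRr1.
Qed.

Lemma powR_superadditive q x y : 1 <= q -> 0 <= x -> 0 <= y ->
  x `^ q + y `^ q <= (x + y) `^ q.
Proof.
move=> q1 x0 y0; have q0 : 0 < q by exact: lt_le_trans q1.
have H z w : 0 <= z -> 0 <= w -> z `^ q <= z * (z + w) `^ (q - 1).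
  move=> z0 w0; rewrite -(mulr_powRB1 z0 q0) ler_wpM2l// ge0_ler_powR//.
  - by rewrite subr_ge0.
  - by rewrite nnegrE addr_ge0.
  - by rewrite lerDl.
rewrite -[leRHS](mulr_powRB1 _ q0) ?addr_ge0// mulrDl; apply: lerD; first exact: H.
by rewrite (addrC x); exact: H.
Qed.

Lemma powR_half_lipschitz_ge2 p x y : 2 <= p -> 0 <= x -> 0 <= y ->
  `|x - y| `^ p <= (x `^ (p / 2) - y `^ (p / 2)) ^+ 2.
Proof.
move=> p2; have q1 : 1 <= p / 2 by rewrite ler_pdivlMr// mul1r.
wlog yx : x y / y <= x.
  move=> H x0 y0; have [yx|xy] := leP y x; first exact: H.
  by rewrite distrC -sqrrN opprB H// ltW.
move=> x0 y0; rewrite ger0_norm ?subr_ge0// -powR_sqr.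
rewrite lerXn2r ?nnegrE ?powR_ge0//.
  rewrite subr_ge0 ge0_ler_powR// ?nnegrE//; exact: le_trans q1.
rewrite lerBrDr; have := @powR_superadditive (p / 2) (x - y) y q1.
by rewrite subrK; apply => //; rewrite subr_ge0.
Qed.

(** A geometric mean of [u ^ 2] and [w ^ 2], with [w <= u], is split by
    comparing [w] with [e / 4 * u]. *)
Lemma powR_interpolate p (e : R) u w : 1 < p -> p <= 2 ->
  0 < e -> e <= 1 -> 0 <= w -> w <= u ->
  u `^ (2 - p) * w `^ p <= e / 4 * u ^+ 2 + 16 / e ^+ 2 * w ^+ 2.
Proof.
move=> p1 p2 e0 e1 w0 wu; have u0 : 0 <= u by exact: le_trans wu.
have p0 : 0 < p by exact: lt_trans p1.
have e40 : 0 < e / 4 by rewrite divr_gt0.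
have e41 : e / 4 <= 1 by lra.
have E1 : 0 <= 16 / e ^+ 2 by rewrite divr_ge0 ?sqr_ge0.
have uE : u `^ (2 - p) * u `^ p = u ^+ 2.
  rewrite -powRD; first by rewrite subrK powR_mulrn.
  by rewrite subrK pnatr_eq0.
have [uw|/ltW wu'] := leP (e / 4 * u) w.
  apply: (@le_trans _ _ (16 / e ^+ 2 * w ^+ 2)); last first.
    by rewrite lerDr mulr_ge0 ?sqr_ge0// ltW.
  apply: (@le_trans _ _ (u ^+ 2)).
    by rewrite -uE ler_wpM2l ?powR_ge0// ge0_ler_powR ?nnegrE// ltW.
  have -> : 16 / e ^+ 2 * w ^+ 2 = (w / (e / 4)) ^+ 2.
    by field; rewrite gt_eqF.
  rewrite lerXn2r ?nnegrE ?divr_ge0 ?(ltW e0)//.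
  by rewrite ler_pdivlMr// mulrC.
apply: (@le_trans _ _ (e / 4 * u ^+ 2)); last first.
  by rewrite lerDl mulr_ge0 ?sqr_ge0.
rewrite -uE mulrCA; apply: ler_wpM2l; first exact: powR_ge0.
apply: (@le_trans _ _ ((e / 4 * u) `^ p)).
  by rewrite ge0_ler_powR ?nnegrE ?mulr_ge0 ?(ltW p0) ?(ltW e40)// ltW.
rewrite (powRM _ (ltW e40) u0); apply: ler_wpM2r; first exact: powR_ge0.
by apply: ge1r_powR; rewrite ?e40 ?(ltW p1).
Qed.

(** For [p < 2] the power [p / 2] is not expanding; the defect is absorbed by
    an arbitrarily small multiple of the powers themselves. *)
Lemma powR_half_lipschitz_le2 p (e : R) x y : 1 < p -> p <= 2 ->
  0 < e -> e <= 1 -> 0 <= x -> 0 <= y ->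
  `|x - y| `^ p <= e * (x `^ p + y `^ p) +
     64 / e ^+ 2 * (x `^ (p / 2) - y `^ (p / 2)) ^+ 2.
Proof.
move=> p1 p2 e0 e1; have p0 : 0 < p by exact: lt_trans p1.
wlog yx : x y / y <= x.
  move=> H x0 y0; have [yx|xy] := leP y x; first exact: H.
  by rewrite distrC (addrC (x `^ p)) -(sqrrN (x `^ _ - _)) opprB H// ltW.
move=> x0 y0; rewrite ger0_norm ?subr_ge0//.
apply: (@le_trans _ _ (e * x `^ p +
     64 / e ^+ 2 * (x `^ (p / 2) - y `^ (p / 2)) ^+ 2)); last first.
  by rewrite lerD2r ler_wpM2l ?(ltW e0)// lerDl powR_ge0.
rewrite -(powR_sqr x p).
set u := x `^ (p / 2); set v := y `^ (p / 2).
have u0 : 0 <= u by exact: powR_ge0.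
have v0 : 0 <= v by exact: powR_ge0.
have vu : v <= u by rewrite ge0_ler_powR ?nnegrE// divr_ge0// ltW.
pose r := 2 / p.
have r1 : 1 <= r by rewrite ler_pdivlMr// mul1r.
have r2 : r <= 2 by rewrite ler_pdivrMr//; lra.
have pr : p / 2 * r = 1 by rewrite /r; field; rewrite gt_eqF.
have ux : u `^ r = x by rewrite -powRrM pr powRr1.
have vy : v `^ r = y by rewrite -powRrM pr powRr1.
have xy : x - y <= 2 * (u `^ (r - 1) * (u - v)).
  have := powR_tangent r1 v0 u0; rewrite ux vy => h.
  apply: (@le_trans _ _ (r * (u `^ (r - 1) * (u - v)))).
    by rewrite lerBlDr -lerBlDl (le_trans _ h)// lerD2l -mulrA -mulrN -mulrN opprB.
  by rewrite ler_wpM2r// mulr_ge0 ?powR_ge0// subr_ge0.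
have w0 : 0 <= u - v by rewrite subr_ge0.
apply: (@le_trans _ _ (4 * (u `^ (2 - p) * (u - v) `^ p))).
  have h2 : (x - y) `^ p <= (2 * (u `^ (r - 1) * (u - v))) `^ p.
    by rewrite ge0_ler_powR ?nnegrE ?(ltW p0) ?subr_ge0// !mulr_ge0 ?powR_ge0.
  apply: le_trans h2 _.
  have A0 : 0 <= u `^ (r - 1) by exact: powR_ge0.
  rewrite (powRM _ _ (mulr_ge0 A0 w0))// (powRM _ A0 w0).
  rewrite -powRrM (_ : (r - 1) * p = 2 - p); last first.
    by rewrite /r; field; rewrite gt_eqF.
  apply: ler_wpM2r; first by apply: mulr_ge0; exact: powR_ge0.
  have -> : 4 = 2 `^ 2 :> R by rewrite powR_mulrn//; ring.
  by apply: ler_powR => //; rewrite ler1n.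
have wu : u - v <= u by rewrite gerBl.
have H := powR_interpolate p1 p2 e0 e1 w0 wu.
apply: (@le_trans _ _ (4 * (e / 4 * u ^+ 2 + 16 / e ^+ 2 * (u - v) ^+ 2))).
  by apply: ler_wpM2l.
rewrite le_eqVlt; apply/orP; left; apply/eqP; field.
by rewrite gt_eqF.
Qed.

Lemma powR_normD p x y : 1 <= p ->
  `|x + y| `^ p <= 2 `^ (p - 1) * (`|x| `^ p + `|y| `^ p).
Proof.
move=> p1; have p0 : 0 < p by exact: lt_le_trans p1.
pose m := (`|x| + `|y|) / 2.
have m0 : 0 <= m by rewrite divr_ge0// addr_ge0.
have h1 := powR_tangent p1 (normr_ge0 x) m0.
have h2 := powR_tangent p1 (normr_ge0 y) m0.
have h : 2 * m `^ p <= `|x| `^ p + `|y| `^ p.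
  have : `|x| - m = - (`|y| - m) by rewrite /m; field.
  move=> e; rewrite e mulrN in h1; lra.
apply: (@le_trans _ _ (2 `^ (p - 1) * (2 * m `^ p))); last first.
  by rewrite ler_wpM2l ?powR_ge0.
rewrite mulrA (mulrC _ 2) mulr_powRB1// -powRM//.
rewrite ge0_ler_powR ?nnegrE ?(ltW p0) ?mulr_ge0//.
rewrite /m mulrC divfK//; exact: ler_normD.
Qed.

Lemma powR_normB p x y : 1 <= p ->
  `|x - y| `^ p <= 2 `^ (p - 1) * (`|x| `^ p + `|y| `^ p).
Proof. by move=> p1; rewrite -(normrN y); exact: powR_normD. Qed.

End Powers.

(** * Jensen inequalities for probability measures *)

(** Measurable functions whose absolute [p]-th power is integrable. *)
Definition lpi d (T : measurableType d) (R : realType)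
    (mu : {measure set T -> \bar R}) (p : R) (f : T -> R) : Prop :=
  measurable_fun setT f /\ itg mu (fun x => `|f x| `^ p).

Section Jensen.
Context d (T : measurableType d) (R : realType).
Variable mu : {measure set T -> \bar R}.
Hypothesis mu1 : mu setT = 1%E.
Implicit Types (f X : T -> R) (p q : R).

Lemma measurable_powR_fun p f : measurable_fun setT f ->
  measurable_fun setT (fun x => f x `^ p).
Proof. exact: (measurableT_comp (measurable_powR p)). Qed.

Lemma measurable_norm_powR p f : measurable_fun setT f ->
  measurable_fun setT (fun x => `|f x| `^ p).
Proof. by move=> mf; apply: measurable_powR_fun; exact: measurableT_comp. Qed.

Lemma lpi_le p f X : 0 <= p -> measurable_fun setT f ->
  (forall x, `|f x| <= `|X x|) -> lpi mu p X -> lpi mu p f.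
Proof.
move=> p0 mf fX [mX iX]; split => //; apply: itg_le iX.
  exact: measurable_norm_powR.
by move=> x; rewrite ger0_norm ?powR_ge0// ge0_ler_powR ?nnegrE.
Qed.

Lemma lpi_itg_powR p q X : measurable_fun setT X -> (forall x, 0 <= X x) ->
  0 <= q -> q <= p -> itg mu (fun x => X x `^ p) ->
  itg mu (fun x => X x `^ q).
Proof.
move=> mX X0 q0 qp iX; apply: itg_le (itgD (itg_cst mu1 1) iX).
  exact: measurable_powR_fun.
by move=> x; rewrite ger0_norm ?powR_ge0//; exact: powR_le1D.
Qed.

Lemma lpi_itg p f : 1 <= p -> lpi mu p f -> itg mu f.
Proof.
move=> p1 [mf iX]; apply: itg_le (itgD (itg_cst mu1 1) iX) => //.
by move=> x; rewrite -[leLHS]powRr1//; exact: powR_le1D.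
Qed.

Lemma lpi2 f : lpi mu 2 f <-> sqi mu f.
Proof.
have E : (fun x => `|f x| `^ 2) = (fun x => f x ^+ 2).
  by apply/funext => x; rewrite powR_mulrn// real_normK ?num_real.
by rewrite /lpi /sqi E.
Qed.

Lemma lpiB p f X : 1 <= p -> lpi mu p f -> lpi mu p X ->
  lpi mu p (fun x => f x - X x).
Proof.
move=> p1 [mf hf] [mX hX]; split; first exact: measurable_funB.
apply: itg_le (itgZ (2 `^ (p - 1)) (itgD hf hX)).
  by apply: measurable_norm_powR; exact: measurable_funB.
by move=> x; rewrite ger0_norm ?powR_ge0//; exact: powR_normB.
Qed.

Lemma lpi_cst p k : lpi mu p (fun=> k).
Proof. by split => //; exact: itg_cst. Qed.

(** Jensen's inequality: the tangent at the mean, integrated. *)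
Lemma powR_Rint_le q X : 1 <= q -> (forall x, 0 <= X x) ->
  itg mu X -> itg mu (fun x => X x `^ q) ->
  (\int[mu]_x X x) `^ q <= \int[mu]_x (X x `^ q).
Proof.
move=> q1 X0 iX iXq; set m := \int[mu]_x X x.
have m0 : 0 <= m by apply: Rintegral_ge0.
have : \int[mu]_x (m `^ q + q * m `^ (q - 1) * (X x - m)) <=
    \int[mu]_x (X x `^ q).
  apply: le_Rint => //; last by move=> x; exact: powR_tangent.
  apply: itgD; first exact: itg_cst.
  by apply: itgZ; apply: itgB => //; exact: itg_cst.
have iXm : itg mu (fun x => X x - m) by apply: itgB => //; exact: itg_cst.
rewrite (RintD (itg_cst mu1 _) (itgZ _ iXm)) (RintZ _ iXm).
rewrite (RintB iX (itg_cst mu1 m)) !Rint_cst//.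
by rewrite subrr mulr0 addr0.
Qed.

(** The two regimes of the next inequality: for [p >= 2] the weight is [1], and
    the inequality is Jensen's inequality squared. *)
Definition jensen_weight p : R := Num.min 1 (p - 1).

Lemma jensen_weight_gt0 p : 1 < p -> 0 < jensen_weight p.
Proof. by move=> p1; rewrite lt_min ltr01 subr_gt0. Qed.

Lemma jensen_weight_le1 p : jensen_weight p <= 1.
Proof. by rewrite ge_min lexx. Qed.

(** An improvement of Jensen's inequality, in which part of the [p]-th moment is
    replaced by the smaller square of the moment of order [p / 2].  For [p < 2]
    it is [powR_bregman] at the mean, integrated. *)
Lemma powR_Rint_le_half p X : 1 < p -> measurable_fun setT X ->
  (forall x, 0 <= X x) -> itg mu (fun x => X x `^ p) ->
  (\int[mu]_x X x) `^ p <=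
    (1 - jensen_weight p) * \int[mu]_x (X x `^ p) +
    jensen_weight p * (\int[mu]_x (X x `^ (p / 2))) ^+ 2.
Proof.
move=> p1 mX X0 iXp; have p0 : 0 < p by exact: lt_trans p1.
have iX : itg mu X.
  have := lpi_itg_powR mX X0 ler01 (ltW p1) iXp.
  by congr itg; apply/funext => x; exact: powRr1.
have iG : itg mu (fun x => X x `^ (p / 2)).
  by apply: lpi_itg_powR iXp => //; rewrite ?divr_ge0 ?ltW// ltr_pdivrMr; lra.
have m0 : 0 <= \int[mu]_x X x by apply: Rintegral_ge0.
have [p2|p2] := leP 2 p.
  have -> : jensen_weight p = 1 by apply/min_idPl; lra.
  rewrite subrr mul0r add0r mul1r -powR_sqr lerXn2r ?nnegrE ?powR_ge0//.
    by apply: Rintegral_ge0 => x _; exact: powR_ge0.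
  by apply: powR_Rint_le => //; rewrite ler_pdivlMr// mul1r.
have -> : jensen_weight p = p - 1 by apply/min_idPr; lra.
set m := \int[mu]_x X x in m0 *; set v := m `^ (p / 2).
set g := \int[mu]_x (X x `^ (p / 2)); set M := \int[mu]_x (X x `^ p).
have iXm : itg mu (fun x => X x - m) by apply: itgB => //; exact: itg_cst.
have : \int[mu]_x ((p - 1) * (X x `^ p - 2 * v * X x `^ (p / 2) + v ^+ 2)) <=
    \int[mu]_x (X x `^ p - m `^ p - p * m `^ (p - 1) * (X x - m)).
  have ic := itg_cst mu1.
  apply: le_Rint.
  - by apply: itgZ; apply: itgD => //; apply: itgB => //; exact: itgZ.
  - by apply: itgB; [exact: itgB|exact: itgZ].
  - move=> x; apply: le_trans (powR_bregman p1 (ltW p2) (X0 x) m0).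
    rewrite le_eqVlt; apply/orP; left; apply/eqP.
    by rewrite -(powR_sqr (X x) p) /v; ring.
have i1 : itg mu (fun x => X x `^ p - 2 * v * X x `^ (p / 2)).
  by apply: itgB => //; exact: itgZ.
rewrite (RintZ _ (itgD i1 (itg_cst mu1 _))) (RintD i1 (itg_cst mu1 _)).
rewrite (RintB iXp (itgZ _ iG)) (RintZ _ iG).
rewrite (RintB (itgB iXp (itg_cst mu1 _)) (itgZ _ iXm)) (RintZ _ iXm).
rewrite (RintB iXp (itg_cst mu1 _)) (RintB iX (itg_cst mu1 _)).
rewrite !Rint_cst// -/m -/g -/M subrr mulr0 subr0.
move: (m `^ p) i1 => mp _; clearbody v M g.
have := sqr_ge0 (g - v); nra.
Qed.

End Jensen.

(** * Markov kernels acting on functions *)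

(** The action of a kernel on functions. *)
Definition kop d d' (X : measurableType d) (Y : measurableType d')
    (R : realType) (k : X -> {measure set Y -> \bar R}) (f : Y -> R) : X -> R :=
  fun x => \int[k x]_y f y.

(** The positive part of a real function; the negative part of [f] is the
    positive part of [- f]. *)
Definition ppart (T : Type) (R : realType) (f : T -> R) : T -> R :=
  fun x => Num.max (f x) 0.

Section PositivePart.
Context d (T : measurableType d) (R : realType).
Variable mu : {measure set T -> \bar R}.
Implicit Types f : T -> R.

Lemma ppart_ge0 f x : 0 <= ppart f x.
Proof. by rewrite le_max lexx orbT. Qed.

Lemma ppart_le_norm f x : ppart f x <= `|f x|.
Proof. by rewrite ge_max ler_norm normr_ge0. Qed.

Lemma ppartB f x : f x = ppart f x - ppart (fun y => - f y) x.
Proof.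
rewrite /ppart; have /orP[h|h] := le_total 0 (f x).
  by rewrite (max_l h) (@max_r _ _ (- f x)) ?oppr_le0// subr0.
by rewrite (max_r h) (@max_l _ _ (- f x)) ?oppr_ge0// sub0r opprK.
Qed.

Lemma measurable_ppart f : measurable_fun setT f ->
  measurable_fun setT (ppart f).
Proof. by move=> mf; apply: measurable_maxr. Qed.

Lemma ppart_powR f p x : p != 0 ->
  ppart f x `^ p + ppart (fun y => - f y) x `^ p = `|f x| `^ p.
Proof.
move=> p0; rewrite /ppart; have /orP[h|h] := le_total 0 (f x).
  by rewrite (max_l h) (@max_r _ _ (- f x)) ?oppr_le0// powR0// addr0 ger0_norm.
by rewrite (max_r h) (@max_l _ _ (- f x)) ?oppr_ge0// powR0// add0r ler0_norm.
Qed.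

Lemma itg_ppart_powR f p : measurable_fun setT f -> 0 < p ->
  itg mu (fun x => `|f x| `^ p) -> itg mu (fun x => ppart f x `^ p).
Proof.
move=> mf p0; apply: itg_le.
  by apply: measurable_powR_fun; exact: measurable_ppart.
move=> x; rewrite ger0_norm ?powR_ge0// ge0_ler_powR ?nnegrE ?ppart_ge0 ?(ltW p0)//.
exact: ppart_le_norm.
Qed.

Lemma sqi_ppart_powR f p : measurable_fun setT f -> 0 < p ->
  itg mu (fun x => `|f x| `^ p) -> sqi mu (fun x => ppart f x `^ (p / 2)).
Proof.
move=> mf p0 hf; split.
  by apply: measurable_powR_fun; exact: measurable_ppart.
have := itg_ppart_powR mf p0 hf.
by congr itg; apply/funext => x; rewrite powR_sqr.
Qed.

End PositivePart.

(** The measure [m] is the image of [nu] under the Markov kernel [K]; the case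
    [nu = m] is that of an invariant measure. *)
Section MarkovKernel.
Context d (T : measurableType d) (R : realType).
Variables (nu m : {measure set T -> \bar R}) (K : R.-pker T ~> T).
Hypothesis Kmix : forall A, measurable A -> (\int[nu]_x K x A)%E = m A.
Implicit Types f g : T -> R.

Lemma pker_setT x : K x setT = 1%E.
Proof. exact: prob_kernel. Qed.

Lemma measurable_pker A : measurable A -> measurable_fun setT (K ^~ A).
Proof. exact: measurable_kernel. Qed.

Lemma measurable_kop f : measurable_fun setT f ->
  measurable_fun setT (kop K f).
Proof. exact: (measurable_Rintegral measurable_pker). Qed.

Lemma ge0_integral_pker (g : T -> \bar R) :
  measurable_fun setT g -> (forall y, (0 <= g y)%E) ->
  (\int[nu]_x \int[K x]_y g y = \int[m]_y g y)%E.
Proof. exact: (integral_mixture measurable_pker measurableT Kmix). Qed.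

Lemma measurable_integral_pker (g : T -> \bar R) :
  measurable_fun setT g -> (forall y, (0 <= g y)%E) ->
  measurable_fun setT (fun x => \int[K x]_y g y)%E.
Proof.
by move=> mg g0; apply: measurable_fun_integral_kernel => //; exact: measurable_pker.
Qed.

(** For almost every starting point [f] is integrable under the kernel; at the
    other points [kop K f] has no meaning and is never used. *)
Lemma ae_itg_pker f : itg m f -> {ae nu, forall x, itg (K x) f}.
Proof.
move=> hf; have mf := itg_meas hf.
have mF : measurable_fun setT (fun x => `|f x|%:E).
  by apply/measurable_EFinP; exact: measurableT_comp.
have h : nu.-integrable setT (fun x => \int[K x]_y `|f y|%:E)%E.
  apply/integrableP; split; first exact: measurable_integral_pker.
  under eq_integral => x _ do rewrite gee0_abs ?integral_ge0//.
  rewrite ge0_integral_pker//; have /integrableP[_] := hf.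
  by apply: le_lt_trans; apply: ge0_le_integral.
have := integrable_ae measurableT h; apply: filterS => x /(_ I).
rewrite ge0_fin_numE ?integral_ge0// => hx.
by apply/integrableP; split => //; exact/measurable_EFinP.
Qed.

Lemma itg_kop f : itg m f -> itg nu (kop K f).
Proof.
move=> hf; have mf := itg_meas hf.
have mF : measurable_fun setT (fun x => `|f x|%:E).
  by apply/measurable_EFinP; exact: measurableT_comp.
apply/integrableP; split; first by apply/measurable_EFinP; exact: measurable_kop.
have /integrableP[_] := hf; apply: le_lt_trans.
rewrite -[leRHS]ge0_integral_pker//; apply: ge0_le_integral => //.
- apply/measurable_EFinP; apply: measurableT_comp => //; exact: measurable_kop.
- exact: measurable_integral_pker.
- by move=> x _; exact: le_norm_Rintegral.
Qed.

Lemma ge0_Rint_kop f : itg m f -> (forall x, 0 <= f x) ->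
  \int[nu]_x kop K f x = \int[m]_x f x.
Proof.
move=> hf f0; have mf := itg_meas hf.
have mF : measurable_fun setT (EFin \o f) by exact/measurable_EFinP.
have F0 x : (0 <= (EFin \o f) x)%E by rewrite lee_fin.
apply: EFin_inj; rewrite (EFin_Rint hf) -(ge0_integral_pker mF F0).
rewrite (EFin_Rint (itg_kop hf)); apply: ge0_ae_eq_integral => //.
- by apply/measurable_EFinP; exact: measurable_kop.
- exact: measurable_integral_pker.
- by move=> x _; rewrite lee_fin; apply: Rintegral_ge0.
- by move=> x _; apply: integral_ge0 => y _; rewrite lee_fin.
- by have := ae_itg_pker hf; apply: filterS => x /EFin_Rint h _.
Qed.

Lemma kopD f g x : itg (K x) f -> itg (K x) g ->
  kop K (fun y => f y + g y) x = kop K f x + kop K g x.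
Proof. exact: RintD. Qed.

Lemma kopB f g x : itg (K x) f -> itg (K x) g ->
  kop K (fun y => f y - g y) x = kop K f x - kop K g x.
Proof. exact: RintB. Qed.

Lemma kopZ c f x : itg (K x) f -> kop K (fun y => c * f y) x = c * kop K f x.
Proof. exact: RintZ. Qed.

Lemma kop_cst c x : kop K (fun=> c) x = c.
Proof. exact: Rint_cst (pker_setT x) c. Qed.

Lemma kop_ge0 f x : (forall y, 0 <= f y) -> 0 <= kop K f x.
Proof. by move=> f0; apply: Rintegral_ge0. Qed.

Lemma le_norm_kop f x : itg (K x) f -> `|kop K f x| <= kop K (fun y => `|f y|) x.
Proof. by move=> hf; apply: le_normr_Rintegral. Qed.

Lemma le_kop f g x : itg (K x) f -> itg (K x) g -> (forall y, f y <= g y) ->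
  kop K f x <= kop K g x.
Proof. exact: le_Rint. Qed.

Lemma itg_ppart (mu : {measure set T -> \bar R}) f :
  itg mu f -> itg mu (ppart f).
Proof.
move=> hf; apply: itg_le (itg_norm hf).
  exact: measurable_ppart (itg_meas hf).
by move=> x; rewrite ger0_norm ?ppart_ge0 ?ppart_le_norm.
Qed.

Lemma Rint_kop f : itg m f -> \int[nu]_x kop K f x = \int[m]_x f x.
Proof.
move=> hf; have hp := itg_ppart hf; have hn := itg_ppart (itgN hf).
transitivity (\int[nu]_x (kop K (ppart f) x - kop K (ppart (fun y => - f y)) x)).
  apply: ae_eq_Rint.
  - exact: measurable_kop (itg_meas hf).
  - by apply: measurable_funB; apply: measurable_kop; apply: measurable_ppart;
      [exact: itg_meas hf|exact: itg_meas (itgN hf)].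
  - have := ae_itg_pker hf; apply: filterS => x hx.
    rewrite -kopB; [|exact: itg_ppart|exact: itg_ppart (itgN hx)].
    by apply: eq_Rintegral => y _; exact: ppartB.
rewrite (RintB (itg_kop hp) (itg_kop hn)).
rewrite (ge0_Rint_kop hp (ppart_ge0 _)).
rewrite (ge0_Rint_kop hn (ppart_ge0 _)).
by rewrite -(RintB hp hn); apply: eq_Rintegral => y _; rewrite -ppartB.
Qed.

(** Contractivity of Markov kernels on moments of order [p >= 1]. *)
Lemma lpi_kop p f : 1 <= p -> lpi m p f -> lpi nu p (kop K f) /\
  \int[nu]_x (`|kop K f x| `^ p) <= \int[m]_x (`|f x| `^ p).
Proof.
move=> p1 hf; have [mf hfp] := hf; have p0 : 0 <= p by exact: le_trans p1.
have hA : {ae nu, forall x,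
    `| `|kop K f x| `^ p | <= kop K (fun y => `|f y| `^ p) x}.
  have := ae_itg_pker hfp; apply: filterS => x hx.
  have fx : itg (K x) f by apply: (lpi_itg (pker_setT x) p1).
  rewrite ger0_norm ?powR_ge0//.
  apply: (@le_trans _ _ ((kop K (fun y => `|f y|) x) `^ p)).
    by rewrite ge0_ler_powR ?nnegrE ?kop_ge0// le_norm_kop.
  by apply: (powR_Rint_le (pker_setT x) p1) => //; exact: itg_norm.
have mK : measurable_fun setT (fun x => `|kop K f x| `^ p).
  by apply: measurable_norm_powR; exact: measurable_kop.
have hK : itg nu (fun x => `|kop K f x| `^ p).
  exact: ae_itg_le mK hA (itg_kop hfp).
split; first by split => //; exact: measurable_kop.
rewrite -(Rint_kop hfp); apply: ae_le_Rint => //; first exact: itg_kop.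
by apply: filterS hA => x; rewrite ger0_norm ?powR_ge0.
Qed.

Lemma sqi_kop f : sqi m f -> sqi nu (kop K f).
Proof. by move=> /lpi2 /lpi_kop[]; rewrite ?ler1n// => /lpi2. Qed.

Lemma Rint_sqr_kop_le f : sqi m f ->
  \int[nu]_x (kop K f x ^+ 2) <= \int[m]_x (f x ^+ 2).
Proof.
move=> hf; have [_] := lpi_kop (ler1n _ 2) ((lpi2 m f).2 hf).
have E g : (fun x => `|g x| `^ 2) = (fun x => g x ^+ 2).
  by apply/funext => x; rewrite powR_mulrn// real_normK ?num_real.
by rewrite !E.
Qed.

End MarkovKernel.

(** * Strict contraction on centered functions *)

(** The algebra that concludes the estimates of this part, with the integrals
    as variables. *)
Section Arithmetic.
Context (R : realType).
Implicit Types a b c e q w x y : R.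

Lemma le_mix w a b c x1 x2 q1 q2 :
  a <= (1 - w) * x1 + w * q1 -> b <= (1 - w) * x2 + w * q2 -> c <= a + b ->
  c <= (1 - w) * (x1 + x2) + w * (q1 + q2).
Proof. lra. Qed.

Lemma subr_swap x y a b : x - y - (a - b) = x - a - (y - b).
Proof. ring. Qed.

Lemma powR_norm_subr_le p a b : 0 <= p -> 0 <= a -> 0 <= b ->
  `|a - b| `^ p <= a `^ p + b `^ p.
Proof.
move=> p0 a0 b0; have /orP[ab|ab] := le_total a b.
  apply: (@le_trans _ _ (b `^ p)); last by rewrite lerDr powR_ge0.
  rewrite ge0_ler_powR ?nnegrE//.
  by rewrite ler0_norm ?subr_le0// opprB gerBl.
apply: (@le_trans _ _ (a `^ p)); last by rewrite lerDl powR_ge0.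
rewrite ge0_ler_powR ?nnegrE//.
by rewrite ger0_norm ?subr_ge0// gerBl.
Qed.

Lemma half_variance_arith w rho M q1 q2 m1 m2 k1 k2 : 0 <= w ->
  M = q1 + q2 -> k1 <= rho * q1 + (1 - rho) * m1 ->
  k2 <= rho * q2 + (1 - rho) * m2 ->
  (1 - w) * M + w * (k1 + k2) <= M - w * (1 - rho) * (M - m1 - m2).
Proof. by move=> w0 -> h1 h2; have := ler_wpM2l w0 (lerD h1 h2); lra. Qed.

Lemma centered_arith t e C M M1 M2 m1 m2 G1 G2 F c : 0 <= t -> 0 <= e ->
  M1 + M2 = M -> m1 <= M1 -> m2 <= M2 ->
  G1 <= (e + C) * M1 + (e - C) * m1 -> G2 <= (e + C) * M2 + (e - C) * m2 ->
  F <= t * (G1 + G2) -> c <= F -> M <= t * (F + c) ->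
  M <= 2 * t ^+ 2 * (2 * e * M + C * (M - m1 - m2)).
Proof.
move=> t0 e0 <- v1 v2 h1 h2 s1 s2 s3.
have : M1 + M2 <= t * (2 * F) by apply: le_trans s3 _; apply: ler_wpM2l => //; lra.
move=> /le_trans; apply; have tt : 0 <= 2 * t by rewrite mulr_ge0.
have -> : t * (2 * F) = 2 * t * F by ring.
have -> : 2 * t ^+ 2 = 2 * t * t by ring.
rewrite -(mulrA (2 * t) t); apply: ler_wpM2l => //; apply: le_trans s1 _.
apply: ler_wpM2l => //; apply: le_trans (lerD h1 h2) _.
have := ler_wpM2l e0 (lerD v1 v2); lra.
Qed.

End Arithmetic.

Section Contraction.
Context d (T : measurableType d) (R : realType).
Variable mu : probability T R.
Implicit Types f g : T -> R.

Let mu1 : mu setT = 1%E := probability_setT mu.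

(** The kernel [K] contracts the variance by the factor [rho]: when [K]
    preserves [mu], the means of [kop K g] and [g] agree and the inequality
    compares their variances. *)
Definition variance_contraction (K : R.-pker T ~> T) (rho : R) : Prop :=
  forall g, sqi mu g -> \int[mu]_x (kop K g x ^+ 2) <=
    rho * \int[mu]_x (g x ^+ 2) + (1 - rho) * (\int[mu]_x g x) ^+ 2.

(** The sum of the variances of the powers [p / 2] of the positive and negative
    parts of [f], whose second moments add up to the [p]-th moment of [f]. *)
Definition half_variance (p : R) f : R :=
  \int[mu]_x (`|f x| `^ p) -
  (\int[mu]_x (ppart f x `^ (p / 2))) ^+ 2 -
  (\int[mu]_x (ppart (fun y => - f y) x `^ (p / 2))) ^+ 2.

Lemma measurable_opp f : measurable_fun setT f ->
  measurable_fun setT (fun x => - f x).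
Proof. by move=> mf; apply: measurableT_comp. Qed.

Lemma lpi_opp (m : {measure set T -> \bar R}) (p : R) f :
  lpi m p f -> lpi m p (fun x => - f x).
Proof.
move=> [mf hf]; split; first exact: measurable_opp.
by move: hf; congr itg; apply/funext => x; rewrite normrN.
Qed.

(** The pointwise inequality behind the strict contraction: the positive and
    negative parts of [f] are treated separately, because the variance of
    [|f| ^ (p / 2)] vanishes when [|f|] is constant. *)
Lemma ae_powR_kop_le (K : R.-pker T ~> T) (p : R) f :
  (forall A, measurable A -> (\int[mu]_x K x A)%E = mu A) ->
  1 < p -> lpi mu p f ->
  {ae mu, forall x, `|kop K f x| `^ p <=
    (1 - jensen_weight p) * kop K (fun y => `|f y| `^ p) x +
    jensen_weight p * (kop K (fun y => ppart f y `^ (p / 2)) x ^+ 2 +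
      kop K (fun y => ppart (fun z => - f z) y `^ (p / 2)) x ^+ 2)}.
Proof.
move=> Kinv p1 hf; have p0 : 0 < p by exact: lt_trans p1.
have := ae_itg_pker Kinv hf.2; apply: filterS => x hx.
have K1 := pker_setT K x.
have fx : lpi (K x) p f by split => //; exact: hf.1.
have nfx := lpi_opp fx.
have ip := itg_ppart_powR fx.1 p0 fx.2.
have iN := itg_ppart_powR nfx.1 p0 nfx.2.
have fi := lpi_itg K1 (ltW p1) fx.
have mp := measurable_ppart fx.1; have mn := measurable_ppart nfx.1.
have h1 := powR_Rint_le_half K1 p1 mp (ppart_ge0 _) ip.
have h2 := powR_Rint_le_half K1 p1 mn (ppart_ge0 _) iN.
rewrite -/(kop K _ x) -/(kop K _ x) -/(kop K _ x) in h1.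
rewrite -/(kop K _ x) -/(kop K _ x) -/(kop K _ x) in h2.
have -> : kop K (fun y => `|f y| `^ p) x =
    kop K (fun y => ppart f y `^ p) x +
    kop K (fun y => ppart (fun z => - f z) y `^ p) x.
  rewrite -kopD//; apply: eq_Rintegral => y _.
  by rewrite ppart_powR// gt_eqF.
have e : kop K f x = kop K (ppart f) x - kop K (ppart (fun z => - f z)) x.
  rewrite -kopB; [|exact: itg_ppart|exact: itg_ppart (itgN fi)].
  by apply: eq_Rintegral => y _; exact: ppartB.
have a0 : 0 <= kop K (ppart f) x by apply: kop_ge0; exact: ppart_ge0.
have b0 : 0 <= kop K (ppart (fun z => - f z)) x.
  by apply: kop_ge0; exact: ppart_ge0.
apply: (le_mix h1 h2); rewrite e.
exact: powR_norm_subr_le (ltW p0) a0 b0.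
Qed.

(** A kernel that contracts the variance decreases the [p]-th moment by a
    multiple of [half_variance]. *)
Lemma powR_kop_half_variance (K : R.-pker T ~> T) (p rho : R) f :
  (forall A, measurable A -> (\int[mu]_x K x A)%E = mu A) ->
  variance_contraction K rho -> 1 < p -> lpi mu p f ->
  \int[mu]_x (`|kop K f x| `^ p) <= \int[mu]_x (`|f x| `^ p) -
    jensen_weight p * (1 - rho) * half_variance p f.
Proof.
move=> Kinv Kvar p1 hf; have p0 : 0 < p by exact: lt_trans p1.
have nhf := lpi_opp hf.
have sp := sqi_ppart_powR hf.1 p0 hf.2.
have sn := sqi_ppart_powR nhf.1 p0 nhf.2.
have iK := itg_kop Kinv hf.2.
have ip := sqi_sqr (sqi_kop Kinv sp); have iN := sqi_sqr (sqi_kop Kinv sn).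
have h := ae_powR_kop_le Kinv p1 hf.
have [_ iKp] := (lpi_kop Kinv (ltW p1) hf).1.
have := ae_le_Rint iKp (itgD (itgZ _ iK) (itgZ _ (itgD ip iN))) h.
rewrite (RintD (itgZ _ iK) (itgZ _ (itgD ip iN))) (RintZ _ iK).
rewrite (RintZ _ (itgD ip iN)) (RintD ip iN) (Rint_kop Kinv hf.2).
move=> /le_trans; apply.
have h1 := Kvar _ sp; have h2 := Kvar _ sn.
apply: half_variance_arith h1 h2; first exact/ltW/jensen_weight_gt0.
rewrite -RintD; [|exact: sp.2|exact: sn.2].
by apply: eq_Rintegral => x _; rewrite !powR_sqr ppart_powR// gt_eqF.
Qed.

(** For a centered function, [half_variance] controls the [p]-th moment: if
    it is small then [f] is close to a constant, hence to [0]. *)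
Lemma centered_powR_le_half_variance (p e C : R) f : 1 < p -> 0 <= e ->
  (forall x y : R, 0 <= x -> 0 <= y -> `|x - y| `^ p <=
     e * (x `^ p + y `^ p) + C * (x `^ (p / 2) - y `^ (p / 2)) ^+ 2) ->
  lpi mu p f -> \int[mu]_x f x = 0 ->
  \int[mu]_x (`|f x| `^ p) <= 2 `^ (2 * p - 1) *
    (2 * e * \int[mu]_x (`|f x| `^ p) + C * half_variance p f).
Proof.
move=> p1 e0 H hf f0; have p0 : 0 < p by exact: lt_trans p1.
have pN0 : p != 0 by rewrite gt_eqF.
have fi := lpi_itg mu1 (ltW p1) hf.
(* [f] is compared with the constant [k f - k (- f)] *)
pose k g := (\int[mu]_x (ppart g x `^ (p / 2))) `^ (2 / p).
have k0 g : 0 <= k g by exact: powR_ge0.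
have part g : lpi mu p g ->
    exists h, [/\ forall x, h x = ppart g x - k g, lpi mu p h &
      \int[mu]_x (`|h x| `^ p) <= (e + C) * \int[mu]_x (ppart g x `^ p) +
        (e - C) * (\int[mu]_x (ppart g x `^ (p / 2))) ^+ 2].
  move=> hg; have sg := sqi_ppart_powR hg.1 p0 hg.2.
  have ig := sqi_itg mu1 sg.
  have igp := itg_ppart_powR hg.1 p0 hg.2.
  have lg : lpi mu p (fun x => ppart g x - k g).
    apply: (lpiB (ltW p1)); last exact: lpi_cst.
    apply: (lpi_le (ltW p0) _ _ hg); first exact: measurable_ppart hg.1.
    by move=> x; rewrite ger0_norm ?ppart_ge0 ?ppart_le_norm.
  exists (fun x => ppart g x - k g); split => //.
  set m := \int[mu]_x (ppart g x `^ (p / 2)).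
  have m0 : 0 <= m by apply: Rintegral_ge0 => x _; exact: powR_ge0.
  have kp : k g `^ (p / 2) = m.
    rewrite /k -/m -powRrM (_ : 2 / p * (p / 2) = 1) ?powRr1//.
    by field.
  have -> : (e + C) * \int[mu]_x (ppart g x `^ p) + (e - C) * m ^+ 2 =
      \int[mu]_x ((e + C) * (ppart g x `^ p) + (e + C) * m ^+ 2 -
        2 * C * m * ppart g x `^ (p / 2)).
    have i1 := itgZ (e + C) igp; have i2 := itg_cst mu1 ((e + C) * m ^+ 2).
    rewrite (RintB (itgD i1 i2) (itgZ _ ig)) (RintD i1 i2) (RintZ _ igp) (RintZ _ ig).
    by rewrite Rint_cst// -/m; ring.
  apply: le_Rint; first exact: lg.2.
    apply: itgB; last exact: itgZ.
    by apply: itgD; [exact: itgZ|exact: itg_cst].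
  move=> x; apply: le_trans (H _ _ (ppart_ge0 g x) (k0 g)) _.
  rewrite kp -(powR_sqr (k g)) kp -(powR_sqr (ppart g x)).
  by rewrite le_eqVlt; apply/orP; left; apply/eqP; ring.
have nhf := lpi_opp hf.
have [g1 [e1 l1 h1]] := part _ hf; have [g2 [e2 l2 h2]] := part _ nhf.
pose c := k f - k (fun y => - f y).
have fc x : f x - c = g1 x - g2 x by rewrite e1 e2 /c {1}(ppartB f x); exact: subr_swap.
have lfc : lpi mu p (fun x => f x - c).
  exact: (lpiB (ltW p1) hf (lpi_cst mu1 p c)).
clearbody c.
have s1 : \int[mu]_x (`|f x - c| `^ p) <= 2 `^ (p - 1) *
    (\int[mu]_x (`|g1 x| `^ p) + \int[mu]_x (`|g2 x| `^ p)).
  rewrite -RintD; [|exact: l1.2|exact: l2.2].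
  have il := itgD l1.2 l2.2.
  rewrite -(RintZ _ il); apply: le_Rint; [exact: lfc.2|exact: itgZ|].
  by move=> x; rewrite fc; exact: (powR_normB _ _ (ltW p1)).
have ifc := lpi_itg mu1 (ltW p1) lfc.
have s2 : `|c| `^ p <= \int[mu]_x (`|f x - c| `^ p).
  have := powR_Rint_le mu1 (ltW p1) _ (itg_norm ifc) lfc.2.
  move=> /(_ (fun x => normr_ge0 _)); apply: le_trans.
  rewrite ge0_ler_powR ?nnegrE ?(ltW p0)//; first by apply: Rintegral_ge0.
  apply: le_trans (le_normr_Rintegral measurableT ifc).
  by rewrite (RintB fi (itg_cst mu1 c)) f0 Rint_cst// sub0r normrN.
have s3 : \int[mu]_x (`|f x| `^ p) <= 2 `^ (p - 1) *
    (\int[mu]_x (`|f x - c| `^ p) + `|c| `^ p).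
  have ic := itg_cst mu1 (`|c| `^ p).
  rewrite -{1}(Rint_cst mu1 (`|c| `^ p)) -(RintD lfc.2 ic).
  rewrite -(RintZ _ (itgD lfc.2 ic)); apply: le_Rint; first exact: hf.2.
    by apply: itgZ; apply: itgD => //; exact: lfc.2.
  by move=> x; rewrite -{1}(subrK c (f x)); apply: powR_normD; exact: ltW.
have eM : \int[mu]_x (ppart f x `^ p) +
    \int[mu]_x (ppart (fun y => - f y) x `^ p) = \int[mu]_x (`|f x| `^ p).
  rewrite -RintD; [|exact: itg_ppart_powR hf.1 p0 hf.2|
    exact: itg_ppart_powR nhf.1 p0 nhf.2].
  by apply: eq_Rintegral => x _; rewrite ppart_powR.
have V0 g : lpi mu p g -> (\int[mu]_x (ppart g x `^ (p / 2))) ^+ 2 <=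
    \int[mu]_x (ppart g x `^ p).
  move=> hg; have sg := sqi_ppart_powR hg.1 p0 hg.2.
  apply: le_trans (Rint_sqr_le mu1 sg) _.
  by rewrite le_eqVlt; apply/orP; left; apply/eqP;
    apply: eq_Rintegral => x _; exact: powR_sqr.
have v1 := V0 _ hf; have v2 := V0 _ nhf.
have -> : 2 `^ (2 * p - 1) = 2 * (2 `^ (p - 1)) ^+ 2 :> R.
  transitivity (2 `^ 1 * 2 `^ ((p - 1) * 2) :> R).
    rewrite -powRD; last by rewrite pnatr_eq0 implybT.
    by congr (_ `^ _); ring.
  by rewrite powRr1// powRrM powR_mulrn// powR_ge0.
exact: (centered_arith (powR_ge0 _ _) e0 eM v1 v2 h1 h2 s1 s2 s3).
Qed.

(** For every [p > 1] the contraction of the variance yields a strict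
    contraction of the [p]-th moment of centered functions. *)
Lemma strict_contraction (p : R) : 1 < p -> exists kappa : R,
  [/\ 0 < kappa, kappa <= 1, 2 <= p -> kappa = 2 `^ (1 - 2 * p) &
    forall (K : R.-pker T ~> T) (rho : R) f,
      (forall A, measurable A -> (\int[mu]_x K x A)%E = mu A) ->
      variance_contraction K rho -> rho <= 1 ->
      lpi mu p f -> \int[mu]_x f x = 0 ->
      \int[mu]_x (`|kop K f x| `^ p) <=
        (1 - kappa * (1 - rho)) * \int[mu]_x (`|f x| `^ p)].
Proof.
move=> p1; have p0 : 0 < p by exact: lt_trans p1.
have [D [D1 D2 HD]] : exists D : R, [/\ 1 <= D,
    2 <= p -> D = 2 `^ (2 * p - 1) &
    forall f, lpi mu p f -> \int[mu]_x f x = 0 ->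
      \int[mu]_x (`|f x| `^ p) <= D * half_variance p f].
  have t1 : 1 <= 2 `^ (2 * p - 1) :> R.
    rewrite -[leLHS](powRr0 2); apply: ler_powR; [by rewrite ler1n|lra].
  have [p2|p2] := leP 2 p.
    exists (2 `^ (2 * p - 1)); split => // f hf f0.
    have := @centered_powR_le_half_variance p 0 1 f p1 (lexx _).
    rewrite mulr0 mul0r add0r mul1r; apply => // x y x0 y0.
    by rewrite mul0r add0r mul1r; exact: powR_half_lipschitz_ge2.
  set t := 2 `^ (2 * p - 1) in t1 *.
  have t0 : 0 < t by exact: lt_le_trans t1.
  (* with this choice the error term is half of the moment to be bounded *)
  pose e := (4 * t)^-1.
  have e0 : 0 < e by rewrite invr_gt0 mulr_gt0.
  have e1 : e <= 1 by rewrite invf_le1 ?mulr_gt0//; lra.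
  exists (2 * t * (64 / e ^+ 2)); split.
  - have : 1 <= 64 / e ^+ 2.
      rewrite ler_pdivlMr ?exprn_gt0// mul1r.
      have : e ^+ 2 <= 1 by rewrite exprn_ile1 ?(ltW e0).
      by lra.
    by move: (64 / e ^+ 2) => c c1; nra.
  - by [].
  move=> f hf f0; have := @centered_powR_le_half_variance p e _ f p1 (ltW e0)
    (fun x y => powR_half_lipschitz_le2 p1 (ltW p2) e0 e1) hf f0.
  move: (\int[mu]_x _) (half_variance _ _) (64 / _) => M V C.
  have -> : t * (2 * e * M + C * V) = M / 2 + t * (C * V).
    by rewrite /e; field; rewrite gt_eqF.
  rewrite -lerBlDl => h; have -> : M = 2 * (M - M / 2) by field.
  by rewrite -!mulrA; apply: ler_wpM2l.
have D0 : 0 < D by exact: lt_le_trans D1.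
have w0 := jensen_weight_gt0 p1; have w1 := jensen_weight_le1 p.
exists (jensen_weight p / D); split.
- exact: divr_gt0.
- by rewrite ler_pdivrMr// mul1r; exact: le_trans D1.
- move=> p2; rewrite D2// (_ : jensen_weight p = 1); last by apply/min_idPl; lra.
  by rewrite mul1r -powRN opprB.
- move=> K rho f Kinv Kvar r1 hf f0.
  apply: le_trans (powR_kop_half_variance Kinv Kvar p1 hf) _.
  have := HD _ hf f0.
  move: (\int[mu]_x _) (half_variance _ _) w0 => M V; clear -D0 r1.
  move: (jensen_weight p) => w w0 h.
  rewrite mulrBl mul1r lerD2l lerN2 -!mulrA; apply: ler_wpM2l; first exact: ltW.
  rewrite mulrCA; apply: ler_wpM2l; first by rewrite subr_ge0.
  by rewrite mulrC ler_pdivrMr// mulrC.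
Qed.

End Contraction.

(** * A layer-cake formula for powers *)

Section LayerCake.
Context (R : realType).
Notation leb := (@lebesgue_measure R).
Implicit Types a m y r Y : R.

Lemma within_continuous_powR a Y : 0 < a -> 0 < Y ->
  {within `[0, Y], continuous (fun r => r `^ a)}.
Proof.
move=> a0 Y0; apply/continuous_within_itvP => //.
have C r : 0 < r -> (fun r => r `^ a) @ r --> r `^ a.
  move=> r0; have : derivable (@powR R ^~ a) r 1.
    by apply: derivable_powR; rewrite in_itv/= r0.
  by move=> /derivable1_diffP/differentiable_continuous.
split.
- by move=> r; rewrite in_itv/= => /andP[r0 _]; exact: C.
- by rewrite powR0 ?gt_eqF//; exact: powR_cvg0.
- by apply: cvg_at_left_filter; exact: C.
Qed.

Lemma integral_powR a Y : 0 < a -> 0 < Y ->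
  (\int[leb]_(r in `[0%R, Y]) (r `^ a)%:E = (Y `^ (a + 1) / (a + 1))%:E)%E.
Proof.
move=> a0 Y0; have a10 : 0 < a + 1 by rewrite addr_gt0.
pose F r := (a + 1)^-1 * r `^ (a + 1).
rewrite (@continuous_FTC2 R (fun r => r `^ a) F 0 Y)//; last 3 first.
- exact: within_continuous_powR.
- split.
  + move=> r; rewrite in_itv/= => /andP[r0 _].
    apply: derivableM; first exact: derivable_cst.
    by apply: derivable_powR; rewrite in_itv/= r0.
  + have /continuous_within_itvP-/(_ Y0)[_ h _] := within_continuous_powR a10 Y0.
    by apply: cvgM; [exact: cvg_cst|exact: h].
  + have /continuous_within_itvP-/(_ Y0)[_ _ h] := within_continuous_powR a10 Y0.
    by apply: cvgM; [exact: cvg_cst|exact: h].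
- move=> r; rewrite in_itv/= => /andP[r0 _]; rewrite derive1E deriveM//=; last first.
    by apply: derivable_powR; rewrite in_itv/= r0.
  rewrite derive_cst scaler0 addr0.
  have [_ ->] := is_derive1_powR (a + 1) r0.
  by rewrite addrK /GRing.scale/= mulrA mulVf ?mul1r// gt_eqF.
by rewrite -EFinB /F powR0 ?gt_eqF// mulr0 subr0 mulrC.
Qed.

(** The squared excess of [y] over the level [r `^ m], for [r >= 0]. *)
Definition excess m y r : R := (0 <= r)%R%:R * Num.max (y - r `^ m) 0 ^+ 2.

Lemma excess_ge0 m y r : 0 <= excess m y r.
Proof. by rewrite mulr_ge0 ?sqr_ge0. Qed.

(** The integral of [excess m 1]. *)
Definition excess_cst m : R := 1 - 2 / (m + 1) + (2 * m + 1)^-1.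

Lemma excess_cst_gt0 m : 0 < m -> 0 < excess_cst m.
Proof.
move=> m0; rewrite /excess_cst.
have -> : 1 - 2 / (m + 1) + (2 * m + 1)^-1 =
    2 * m ^+ 2 / ((m + 1) * (2 * m + 1)).
  by field; apply/andP; split; rewrite gt_eqF//; lra.
by rewrite divr_gt0 ?mulr_gt0 ?exprn_gt0//; lra.
Qed.

(** With the levels parametrized by [r `^ m], the integral over all levels has
    no weight, and its integrand is bounded with bounded support. *)
Lemma integral_excess m y : 0 < m -> 0 <= y ->
  (\int[leb]_r (excess m y r)%:E = (excess_cst m * y `^ (2 + m^-1))%:E)%E.
Proof.
move=> m0; have mN0 : m != 0 by rewrite gt_eqF.
rewrite le_eqVlt => /predU1P[<-|y0].
  rewrite powR0 ?mulr0; last by rewrite gt_eqF// addr_gt0// invr_gt0.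
  apply: integral0_eq => r _; rewrite /excess sub0r.
  by rewrite max_r ?oppr_le0 ?powR_ge0// expr0n mulr0.
pose Y := y `^ m^-1; have Y0 : 0 < Y by exact: powR_gt0.
have Ym : Y `^ m = y by rewrite -powRrM mulVf// powRr1// ltW.
pose h r : R := y ^+ 2 - 2 * y * r `^ m + r `^ (2 * m).
transitivity (\int[leb]_(r in `[0%R, Y]) (h r)%:E)%E.
  rewrite [RHS]integral_mkcond; apply: eq_integral => r _.
  rewrite patchE mem_setE in_itv/= /excess.
  have [r0|r0] := leP 0 r; last by rewrite mul0r.
  rewrite mul1r; case: ifPn => [rY|]; last rewrite -ltNge => Yr.
    have ry : r `^ m <= y by rewrite -Ym ge0_ler_powR ?nnegrE ?(ltW m0) ?(ltW Y0).
    have e : r `^ (2 * m) = (r `^ m) ^+ 2.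
      by rewrite (mulrC 2) powRrM powR_mulrn// powR_ge0.
    rewrite max_l ?subr_ge0// /h e.
    by congr (_%:E); ring.
  have ry : y <= r `^ m.
    by rewrite -Ym ge0_ler_powR ?nnegrE ?(ltW m0) ?(ltW Y0) ?(ltW Yr).
  by rewrite max_r ?subr_le0// expr0n.
have ci a : 0 < a -> leb.-integrable `[0, Y] (fun r => (r `^ a)%:E).
  move=> a0; apply: continuous_compact_integrable; first exact: segment_compact.
  exact: within_continuous_powR.
have c0 : leb.-integrable `[0, Y] (fun r => (y ^+ 2)%:E).
  apply: continuous_compact_integrable; first exact: segment_compact.
  by apply: continuous_subspaceT => x; exact: cvg_cst.
have m20 : 0 < 2 * m by rewrite mulr_gt0.
have c1 : leb.-integrable `[0, Y] (fun r => (2 * y)%:E * (r `^ m)%:E)%E.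
  by apply: integrableZl => //; exact: ci.
under eq_integral do rewrite EFinD EFinB EFinM.
rewrite integralD//; [|exact: integrableB|exact: (ci _ m20)].
have z : (\int[leb]_(r in `[0%R, Y]) ((2 * y)%:E * (r `^ m)%:E) =
    (2 * y)%:E * \int[leb]_(r in `[0%R, Y]) (r `^ m)%:E)%E.
  by apply: integralZl => //; exact: ci.
rewrite integralB// z.
rewrite integral_cst//= lebesgue_measure_itv/= lte_fin Y0 sube0.
rewrite !integral_powR// -!EFinM -EFinN -!EFinD; congr (_%:E).
have e1 : y `^ (2 + m^-1) = y ^+ 2 * Y.
  rewrite powRD; last by rewrite (gt_eqF y0) implybT.
  by rewrite powR_mulrn// ltW.
have e2 : Y `^ (m + 1) = y * Y.
  rewrite powRD; last by rewrite (gt_eqF Y0) implybT.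
  by rewrite Ym powRr1// ltW.
have e3 : Y `^ (2 * m + 1) = y ^+ 2 * Y.
  rewrite powRD; last by rewrite (gt_eqF Y0) implybT.
  by rewrite (powRr1 (ltW Y0)) (mulrC 2) powRrM Ym powR_mulrn// ltW.
rewrite e1 e2 e3 /excess_cst; field.
by apply/andP; split; rewrite gt_eqF//; lra.
Qed.

End LayerCake.

(** * Interpolation between the quadratic and the uniform norm *)

Section Interpolation.
Context d (T : measurableType d) (R : realType).
Variables (mu : probability T R) (K : R.-pker T ~> T) (rho : R).
Hypothesis Kinv : forall A, measurable A -> (\int[mu]_x K x A)%E = mu A.
Hypothesis Kvar : variance_contraction mu K rho.
Hypothesis rho0 : 0 <= rho.
Implicit Types f : T -> R.

Let mu1 : mu setT = 1%E := probability_setT mu.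

(** Truncation at level [s]. *)
Definition trunc (s : R) (f : T -> R) (x : T) : R :=
  Num.max (- s) (Num.min s (f x)).

Lemma measurable_trunc s f : measurable_fun setT f ->
  measurable_fun setT (trunc s f).
Proof.
by move=> mf; apply: measurable_maxr => //; exact: measurable_minr.
Qed.

Lemma trunc_le s f x : 0 <= s -> `|trunc s f x| <= s.
Proof.
move=> s0; rewrite /trunc ler_norml le_max lexx/= ge_max ge_min lexx/= andbT.
by rewrite (le_trans _ s0)// oppr_le0.
Qed.

Lemma sub_trunc s f x : 0 <= s ->
  `|f x - trunc s f x| = Num.max (`|f x| - s) 0.
Proof.
move=> s0; rewrite /trunc; have [fs|sf] := leP (f x) s.
  have [sf|fs'] := leP (- s) (f x).
    by rewrite subrr normr0 max_r// subr_le0 ler_norml sf.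
  have f0 : f x <= 0 by rewrite (le_trans (ltW fs'))// oppr_le0.
  rewrite (ler0_norm f0) opprK ler0_norm; last by rewrite -lerBrDr sub0r ltW.
  by rewrite opprD max_l// subr_ge0 lerNr ltW.
have f0 : 0 <= f x by rewrite (le_trans s0)// ltW.
rewrite max_r; last by rewrite (le_trans _ s0)// oppr_le0.
by rewrite (ger0_norm f0) ger0_norm ?max_l ?subr_ge0// ltW.
Qed.

(** The part of [f] below the level [s] contributes at most [2 * s] to the
    centered image, uniformly. *)
Lemma excess_kop_le s f : 0 <= s -> sqi mu f -> \int[mu]_x f x = 0 ->
  \int[mu]_x (Num.max (`|kop K f x| - 2 * s) 0 ^+ 2) <=
  rho * \int[mu]_x (Num.max (`|f x| - s) 0 ^+ 2) /\
  itg mu (fun x => Num.max (`|kop K f x| - 2 * s) 0 ^+ 2) /\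
  itg mu (fun x => Num.max (`|f x| - s) 0 ^+ 2).
Proof.
move=> s0 hf f0; have mf := hf.1.
pose f1 := trunc s f; pose f2 x := f x - f1 x.
have m1 : measurable_fun setT f1 by exact: measurable_trunc.
have h1 : sqi mu f1.
  by apply: sqi_le m1 _ (sqi_cst mu1 s) => x; exact: trunc_le.
have h2 : sqi mu f2 by exact: sqiB.
have i1 := sqi_itg mu1 h1; have i2 := sqi_itg mu1 h2.
have e2 x : Num.max (`|f x| - s) 0 ^+ 2 = f2 x ^+ 2.
  by rewrite -sub_trunc// real_normK ?num_real.
pose c := \int[mu]_x f2 x.
have c1 : \int[mu]_x f1 x = - c.
  apply/eqP; rewrite -addr_eq0 /c -RintD//; apply/eqP.
  by rewrite -f0; apply: eq_Rintegral => x _; rewrite /f2 addrC subrK.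
have cs : `|c| <= s.
  rewrite -normrN -c1; apply: le_trans (le_normr_Rintegral measurableT i1) _.
  rewrite -[leRHS](Rint_cst mu1 s); apply: le_Rint => //.
  - exact: itg_norm.
  - exact: itg_cst.
  - by move=> x; exact: trunc_le.
have sK := sqi_kop Kinv h2; have iK := sqi_itg mu1 sK.
have sKf := sqi_kop Kinv hf.
have sc : sqi mu (fun x => kop K f2 x - c).
  by apply: sqiB => //; exact: sqi_cst.
have ae : {ae mu, forall x, Num.max (`|kop K f x| - 2 * s) 0 ^+ 2 <=
    (kop K f2 x - c) ^+ 2}.
  have := ae_itg_pker Kinv (sqi_itg mu1 hf); apply: filterS => x hx.
  have K1 := pker_setT K x.
  have j1 : itg (K x) f1.
    by apply: itg_le m1 _ (itg_cst K1 s) => y; exact: trunc_le.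
  have e : kop K f2 x = kop K f x - kop K f1 x by exact: kopB.
  have k1 : `|kop K f1 x| <= s.
    apply: le_trans (le_norm_kop j1) _.
    rewrite -[leRHS](kop_cst K s x); apply: le_kop.
    - exact: itg_norm.
    - exact: itg_cst.
    - by move=> y; exact: trunc_le.
  rewrite -(real_normK (num_real (kop K f2 x - c))).
  rewrite lerXn2r ?nnegrE ?le_max ?lexx ?orbT// ge_max normr_ge0 andbT e.
  move: k1 cs; clear; move: (kop K f x) (kop K f1 x) => a b hb hc.
  rewrite lerBlDr; have h := ler_normD (a - b - c) (b + c).
  have e : a - b - c + (b + c) = a by ring.
  rewrite e in h; apply: le_trans h _; rewrite lerD2l.
  apply: le_trans (ler_normD _ _) _; lra.
have mE : measurable_fun setT (fun x => Num.max (`|kop K f x| - 2 * s) 0 ^+ 2).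
  apply: measurable_funX; apply: measurable_maxr => //.
  by apply: measurable_funB => //; apply: measurableT_comp => //; exact: sKf.1.
have iE : itg mu (fun x => Num.max (`|kop K f x| - 2 * s) 0 ^+ 2).
  apply: ae_itg_le mE _ sc.2; apply: filterS ae => x.
  by rewrite (@ger0_norm _ (_ ^+ 2)) ?sqr_ge0.
have -> : (fun x => Num.max (`|f x| - s) 0 ^+ 2) = (fun x => f2 x ^+ 2).
  by apply/funext => x; exact: e2.
split; last by split => //; exact: h2.2.
apply: le_trans (ae_le_Rint iE sc.2 ae) _.
have -> : \int[mu]_x ((kop K f2 x - c) ^+ 2) =
    \int[mu]_x (kop K f2 x ^+ 2) - c ^+ 2.
  rewrite (_ : (fun x => (_ - c) ^+ 2) =
    (fun x => kop K f2 x ^+ 2 - 2 * c * kop K f2 x + c ^+ 2)); last first.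
    by apply/funext => x; ring.
  rewrite (RintD (itgB sK.2 (itgZ _ iK)) (itg_cst mu1 _)).
  rewrite (RintB sK.2 (itgZ _ iK)) (RintZ _ iK) (Rint_kop Kinv i2).
  by rewrite Rint_cst// -/c; ring.
have := Kvar h2; rewrite -/c.
move: (\int[mu]_x _) (\int[mu]_x _) => a b h.
by rewrite lerBlDr; apply: le_trans h _; rewrite lerD2l ler_piMl ?sqr_ge0 ?gerBl.
Qed.

(** The previous bound integrated over all levels [s = r ^ m]; the exponent
    [m = 1 / (p - 2)] is the one for which [integral_excess] yields the [p]-th
    power. *)
Lemma powR_kop_interpolation (p : R) f : 2 < p -> lpi mu p f ->
  \int[mu]_x f x = 0 ->
  \int[mu]_x (`|kop K f x| `^ p) <=
    2 `^ (p - 2) * rho * \int[mu]_x (`|f x| `^ p).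
Proof.
move=> p2 hf f0; have p1 : 1 <= p by lra.
have pB : 0 < p - 2 by rewrite subr_gt0.
pose m := (p - 2)^-1; have m0 : 0 < m by rewrite invr_gt0.
have pE : p = 2 + m^-1 by rewrite /m invrK addrC subrK.
have sf : sqi mu f.
  split; first exact: hf.1.
  have mn : measurable_fun setT (fun x => `|f x|).
    by apply: measurableT_comp => //; exact: hf.1.
  have := lpi_itg_powR mu1 mn (fun x => normr_ge0 (f x)) _ (ltW p2) hf.2.
  move=> /(_ (ler0n _ 2)); congr itg; apply/funext => x.
  by rewrite powR_mulrn// real_normK ?num_real.
have [[mK iK] _] := lpi_kop Kinv p1 hf.
pose C := excess_cst m; have C0 : 0 < C by exact: excess_cst_gt0.
have layer g : lpi mu p g ->
  measurable_fun setT (fun r => \int[mu]_x (excess m `|g x| r)%:E)%E /\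
  (\int[lebesgue_measure]_r \int[mu]_x (excess m `|g x| r)%:E =
   (C * \int[mu]_x (`|g x| `^ p))%:E)%E.
  move=> [mg ig].
  pose F (z : measurableTypeR R * T) : \bar R := (excess m `|g z.2| z.1)%:E.
  have mF : measurable_fun setT F.
    apply/measurable_EFinP; apply: measurable_funM.
      have -> : (fun z : measurableTypeR R * T => (0 <= z.1)%R%:R) =
          (\1_(`[0, +oo[%classic) : R -> R) \o fst.
        apply/funext => z /=; rewrite indicE.
        by rewrite mem_setE in_itv/= andbT.
      by apply: measurableT_comp => //; exact: measurable_indic.
    apply: measurable_funX; apply: measurable_maxr => //.
    apply: measurable_funB.
      apply: measurableT_comp => //; exact: (measurableT_comp mg).
    exact: (measurableT_comp (measurable_powR m)).
  have F0 z : (0 <= F z)%E by rewrite lee_fin excess_ge0.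
  split; first exact: (@measurable_fun_fubini_tonelli_F _ _ _ _ _ mu F).
  have := @fubini_tonelli _ _ _ _ R lebesgue_measure mu F mF F0.
  rewrite /F/= => ->.
  under eq_integral do rewrite integral_excess// -pE EFinM.
  rewrite ge0_integralZl//; last 2 first.
  - by apply/measurable_EFinP; exact: measurable_norm_powR.
  - by rewrite lee_fin ltW.
  by rewrite EFinM EFin_Rint.
have lK : lpi mu p (fun x => kop K f x / 2).
  split; first by apply: measurable_funM => //; exact: measurable_cst.
  have := itgZ (2^-1 `^ p) iK; congr itg; apply/funext => x.
  by rewrite normrM powRM// mulrC (@ger0_norm _ 2^-1).
have [n1 h1] := layer _ hf; have [n2 h2] := layer _ lK.
have key r : (\int[mu]_x (excess m `|kop K f x / 2| r)%:E <=
    (rho / 4)%:E * \int[mu]_x (excess m `|f x| r)%:E)%E.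
  have [r0|r0] := leP 0 r; last first.
    rewrite integral0_eq ?integral0_eq ?mule0// => x _;
      by rewrite /excess leNgt r0 mul0r.
  have [k1 [k2 k3]] := excess_kop_le (powR_ge0 r m) sf f0.
  have E1 : (fun x => excess m `|f x| r) =
      (fun x => Num.max (`|f x| - r `^ m) 0 ^+ 2).
    by apply/funext => x; rewrite /excess r0 mul1r.
  have E2 : (fun x => excess m `|kop K f x / 2| r) =
      (fun x => 4^-1 * Num.max (`|kop K f x| - 2 * r `^ m) 0 ^+ 2).
    apply/funext => x; rewrite /excess r0 mul1r normrM (@ger0_norm _ 2^-1)//.
    have -> : `|kop K f x| / 2 - r `^ m = 2^-1 * (`|kop K f x| - 2 * r `^ m).
      by field.
    rewrite -[X in Num.max _ X](mulr0 2^-1) -maxr_pMr// exprMn.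
    by congr (_ * _); field.
  have i1 : itg mu (fun x => excess m `|f x| r) by rewrite E1.
  have i2 : itg mu (fun x => excess m `|kop K f x / 2| r).
    by rewrite E2; exact: itgZ.
  rewrite -(EFin_Rint i1) -(EFin_Rint i2) -EFinM lee_fin E1 E2 (RintZ _ k2).
  by rewrite (mulrC rho) -mulrA ler_pM2l.
have : ((C * \int[mu]_x (`|kop K f x / 2| `^ p))%:E <=
    (rho / 4 * (C * \int[mu]_x (`|f x| `^ p)))%:E)%E.
  rewrite -h2 EFinM -h1 -ge0_integralZl//; last 2 first.
  - by move=> r _; apply: integral_ge0 => x _; rewrite lee_fin excess_ge0.
  - by rewrite lee_fin divr_ge0.
  apply: ge0_le_integral => //.
  - by move=> r _; apply: integral_ge0 => x _; rewrite lee_fin excess_ge0.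
  - by exact: measurable_funeM.
rewrite lee_fin mulrCA ler_pM2l//.
have -> : \int[mu]_x (`|kop K f x / 2| `^ p) =
    2 `^ (- p) * \int[mu]_x (`|kop K f x| `^ p).
  rewrite -(RintZ _ iK); apply: eq_Rintegral => x _.
  rewrite normrM powRM// (@ger0_norm _ 2^-1)// mulrC; congr (_ * _).
  by rewrite -(@powR_inv1 _ 2)// -powRrM mulN1r.
have e b : 2 `^ (p - 2) * rho * b = 2 `^ p * (rho / 4 * b).
  rewrite powRB; last by rewrite pnatr_eq0 implybT.
  by rewrite powR_mulrn//; field.
rewrite e powRN ler_pdivrMl ?powR_gt0//.
Qed.

End Interpolation.

(** * Integrals over time intervals *)

Section TimeIntegrals.
Context d (T : measurableType d) (R : realType).
Notation leb := (@lebesgue_measure R).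

Section Fubini.
Variables (nu : probability T R) (h B : R) (phi : measurableTypeR R * T -> R).
Hypothesis mphi : measurable_fun setT phi.
Hypothesis iphi : forall s, 0 <= s -> s <= h ->
  itg nu (fun x => phi (s, x)) /\ \int[nu]_x `|phi (s, x)| <= B.

Let f (z : T * measurableTypeR R) : \bar R :=
  ((\1_(`[0, h]%classic) z.2 : R) * phi (z.2, z.1))%:E.

Let mf : measurable_fun setT f.
Proof.
apply/measurable_EFinP; apply: measurable_funM.
  by apply: measurableT_comp => //; exact: measurable_indic.
by apply: measurableT_comp => //; exact: measurable_swap.
Qed.

Let f_in s x : s \in `[0, h] -> f (x, s) = (phi (s, x))%:E.
Proof. by move=> sh; rewrite /f/= indicE mem_setE sh mul1r. Qed.

Let f_out s x : s \notin `[0, h] -> f (x, s) = 0%E.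
Proof. by move=> sh; rewrite /f/= indicE mem_setE (negbTE sh) mul0r. Qed.

Let int_f : (nu \x leb)%E.-integrable setT f.
Proof.
apply/integrable21ltyP => //.
apply: (@le_lt_trans _ _ (\int[leb]_(s in `[0%R, h]) B%:E)%E); last first.
  rewrite integral_cst//= lebesgue_measure_itv/=; case: ifP => _.
    by rewrite -EFinB -EFinM ltry.
  by rewrite mule0 ltry.
rewrite [leRHS]integral_mkcond; apply: ge0_le_integral => //.
- by move=> s _; apply: integral_ge0.
- apply: (@measurable_fun_fubini_tonelli_G _ _ _ _ _ nu (abse \o f)).
    exact: measurableT_comp.
  by move=> x /=.
- have mB : measurable_fun `[0, h] (cst B%:E : measurableTypeR R -> \bar R) by [].
  exact: (measurable_restrictT _ (measurable_itv _)).1 mB.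
- move=> s _; rewrite patchE mem_setE; case: ifPn => sh.
    under eq_integral do rewrite f_in//.
    move: sh; rewrite in_itv/= => /andP[s0 sh].
    have [i1 i2] := iphi s0 sh.
    by have := EFin_Rint (itg_norm i1); rewrite /= => <-; rewrite lee_fin.
  by rewrite integral0_eq// => x _; rewrite -[LHS]/(`|f (x, s)|%E) f_out// abse0.
Qed.

(** Exchange of the expectation with an integral over a time interval, under a
    bound on the first moments that is uniform in time. *)
Lemma Rint_time_Fubini :
  itg nu (fun x => \int[leb]_(s in `[0, h]) phi (s, x)) /\
  \int[nu]_x \int[leb]_(s in `[0, h]) phi (s, x) =
  \int[leb]_(s in `[0, h]) \int[nu]_x phi (s, x).
Proof.
have fE x : (\int[leb]_s f (x, s) = \int[leb]_(s in `[0%R, h]) (phi (s, x))%:E)%E.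
  rewrite [RHS]integral_mkcond; apply: eq_integral => s _.
  by rewrite patchE mem_setE; case: ifPn => sh; [rewrite f_in|rewrite f_out].
have gE s : (\int[nu]_x f (x, s) =
    ((fun s => \int[nu]_x (phi (s, x))%:E) \_ `[0%R, h]) s)%E.
  rewrite patchE mem_setE; case: ifPn => sh.
    by apply: eq_integral => x _; rewrite f_in.
  by rewrite integral0_eq// => x _; rewrite f_out.
have iF : nu.-integrable setT (fun x => \int[leb]_s f (x, s))%E.
  exact: integrable_fubini_F int_f.
have iF' : nu.-integrable setT
    (fun x => \int[leb]_(s in `[0%R, h]) (phi (s, x))%:E)%E.
  by under eq_fun do rewrite -fE.
have mI : measurable_fun setT (fun x => \int[leb]_(s in `[0, h]) phi (s, x)).
  by apply: measurable_fine_fun; exact: measurable_int iF'.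
have ae : {ae nu, forall x, (\int[leb]_(s in `[0, h]) phi (s, x))%:E =
    (\int[leb]_(s in `[0%R, h]) (phi (s, x))%:E)%E}.
  by have := integrable_ae measurableT iF'; apply: filterS => x /(_ I) /fineK.
have mI' := (measurable_EFinP _ _).2 mI.
split.
  apply/integrableP; split => //.
  have /integrableP[mF lt] := iF'; apply: le_lt_trans lt.
  rewrite (ae_eq_integral (fun x =>
    `|\int[leb]_(s in `[0%R, h]) (phi (s, x))%:E|)%E)//.
  - exact: measurableT_comp.
  - exact: measurableT_comp.
  - by apply: filterS ae => x e _; exact: (congr1 abse e).
rewrite /Rintegral; congr fine.
rewrite (ae_eq_integral
    (fun x => \int[leb]_(s in `[0%R, h]) (phi (s, x))%:E)%E)//.
- under eq_integral do rewrite -fE.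
  rewrite (Fubini int_f) [RHS]integral_mkcond.
  apply: eq_integral => s _; rewrite gE !patchE mem_setE; case: ifPn => //.
  rewrite in_itv/= => /andP[s0 sh]; have [i1 _] := iphi s0 sh.
  by rewrite -(EFin_Rint i1).
- exact: measurable_int iF'.
- by apply: filterS ae => x e _.
Qed.

End Fubini.

Lemma integrable_bounded_itv (f : R -> R) (M a b : R) :
  measurable_fun setT f -> (forall s, `|f s| <= M) ->
  leb.-integrable `[a, b] (EFin \o f).
Proof.
move=> mf fM; apply: measurable_bounded_integrable => //.
- by rewrite /= lebesgue_measure_itv/=; case: ifP => _; rewrite ?ltry// -EFinB ltry.
- exact: measurable_funTS.
- exists M; split; first exact: num_real.
  by move=> x Mx s _; apply: le_trans (fM s) (ltW Mx).
Qed.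

(** Translation invariance of the integral over time. *)
Lemma Rint_shift (f : R -> R) (M t h : R) : measurable_fun setT f ->
  (forall s, `|f s| <= M) ->
  \int[leb]_(s in `[0, h]) f (t + s) = \int[leb]_(s in `[t, t + h]) f s.
Proof.
move=> mf fM; have mt : measurable_fun setT
    ((fun s => t + s) : measurableTypeR R -> measurableTypeR R).
  exact: measurable_funD.
have inv A : measurable A ->
    pushforward leb ((fun s => t + s) : measurableTypeR R -> measurableTypeR R) A
    = leb A.
  move=> mA; apply/esym/lebesgue_measure_unique => //= _ [[a b]] _ <-.
  rewrite /pushforward (_ : _ @^-1` _ = `]a - t, b - t]%classic); last first.
    by apply/seteqP; split => x /=; rewrite !in_itv/= ltrBlDl lerBrDl.
  by rewrite !lebesgue_measure_itv/= !lte_fin ltrD2r -!EFinB opprB addrA subrK.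
have pre : (fun s => t + s) @^-1` `[t, t + h] = `[0, h]%classic.
  by apply/seteqP; split => x /=; rewrite !in_itv/= lerDl lerD2l.
rewrite /Rintegral; congr fine.
have e : (\int[pushforward leb
    ((fun s => t + s)%R : measurableTypeR R -> measurableTypeR R)]_(s in
    `[t, (t + h)%R]) (f s)%:E = \int[leb]_(s in `[t, (t + h)%R]) (f s)%:E)%E.
  by apply: eq_measure_integral => //= A mA _; exact: inv.
rewrite -[RHS]e.
rewrite integral_pushforward ?pre//; first exact/measurable_EFinP.
apply: (@integrable_bounded_itv (fun s => f (t + s)) M) => //.
exact: measurableT_comp.
Qed.

Lemma Rint_itv_split (f : R -> R) (M a b : R) :
  measurable_fun setT f -> (forall s, `|f s| <= M) -> 0 <= a -> a <= b ->
  \int[leb]_(s in `[0, b]) f s =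
  \int[leb]_(s in `[0, a]) f s + \int[leb]_(s in `[a, b]) f s.
Proof.
move=> mf fM a0 ab; have i0 := integrable_bounded_itv 0 b mf fM.
have h := @Rintegral_itvB R f (BLeft 0) (BRight b) a i0.
rewrite !bnd_simp in h; have {}h := h a0 ab.
rewrite Rintegral_itv_obnd_cbnd in h; first by rewrite -h addrC subrK.
have i1 := integrable_bounded_itv a b mf fM.
by apply: integrableS i1 => //; apply: subset_itvr; rewrite bnd_simp.
Qed.

End TimeIntegrals.

Section ProbabilityOf.
Context d (T : measurableType d) (R : realType).
Variable nu : {measure set T -> \bar R}.
Hypothesis nu1 : nu setT = 1%E.

(** A measure of total mass [1], as a bundled probability. *)
Definition probability_of of nu setT = 1%E : set T -> \bar R := nu.

HB.instance Definition _ := Measure.copy (probability_of nu1) (Measure.sort nu).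
HB.instance Definition _ :=
  Measure_isProbability.Build _ _ _ (probability_of nu1) nu1.

Lemma probability_ofE :
  nu = (probability_of nu1 : probability T R) :> {measure set T -> \bar R}.
Proof. exact: eq_measure. Qed.

End ProbabilityOf.

Section BoundedFubini.
Context d (T : measurableType d) (R : realType).
Notation leb := (@lebesgue_measure R).

Lemma bounded_time_Fubini (nu : {measure set T -> \bar R}) (h M : R)
    (phi : measurableTypeR R * T -> R) :
  nu setT = 1%E -> measurable_fun setT phi -> (forall z, `|phi z| <= M) ->
  itg nu (fun x => \int[leb]_(s in `[0, h]) phi (s, x)) /\
  \int[nu]_x \int[leb]_(s in `[0, h]) phi (s, x) =
  \int[leb]_(s in `[0, h]) \int[nu]_x phi (s, x).
Proof.
move=> nu1 mphi phiM; rewrite (probability_ofE nu1).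
have p1 := probability_setT (probability_of nu1 : probability T R).
apply: (@Rint_time_Fubini _ _ _ _ h M) => // s _ _.
have i : itg (probability_of nu1 : probability T R) (fun x => phi (s, x)).
  by apply: itg_le (itg_cst p1 M) => //; exact: measurable_fun_pair2.
split=> //; rewrite -[leRHS](Rint_cst p1 M); apply: le_Rint => //.
- exact: itg_norm.
- exact: itg_cst.
Qed.

Lemma Rint_time_cst (c h : R) : 0 <= h -> \int[leb]_(s in `[0, h]) c = h * c.
Proof.
move=> h0; rewrite Rintegral_cst//= lebesgue_measure_itv/= lte_fin.
case: ltgtP h0 => //= [_|<-] _; first by rewrite subr0 mulrC.
by rewrite mulr0 mul0r.
Qed.

Lemma norm_time_integral_le (f : R -> R) (h M : R) : measurable_fun setT f ->
  (forall s, `|f s| <= M) -> 0 <= h ->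
  `|\int[leb]_(s in `[0, h]) f s| <= h * M.
Proof.
move=> mf fM h0; have i := integrable_bounded_itv 0 h mf fM.
apply: (@le_trans _ _ (\int[leb]_(s in `[0, h]) `|f s|)).
  exact: le_normr_Rintegral.
rewrite -(Rint_time_cst M h0); apply: le_Rintegral => //.
- apply: (@integrable_bounded_itv _ (fun s => `|f s|) M) => [|s].
    exact: measurableT_comp.
  by rewrite normr_id.
- apply: (@integrable_bounded_itv _ (fun=> M) `|M|) => //.
Qed.

End BoundedFubini.

(** * Density of the bounded functions *)

(** Bounded measurable functions. *)
Definition bdd d (T : measurableType d) (R : realType) (f : T -> R) : Prop :=
  measurable_fun setT f /\ exists M, forall x, `|f x| <= M.

Section Bounded.
Context d (T : measurableType d) (R : realType).
Implicit Types f g : T -> R.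

Lemma bdd_meas f : bdd f -> measurable_fun setT f. Proof. by case. Qed.

Lemma bddD f g : bdd f -> bdd g -> bdd (fun x => f x + g x).
Proof.
move=> [mf [A hA]] [mg [B hB]]; split; first exact: measurable_funD.
by exists (A + B) => x; apply: le_trans (ler_normD _ _) _; exact: lerD.
Qed.

Lemma bddZ c f : bdd f -> bdd (fun x => c * f x).
Proof.
move=> [mf [A hA]]; split; first exact: measurable_funM.
by exists (`|c| * A) => x; rewrite normrM ler_wpM2l.
Qed.

Lemma bddB f g : bdd f -> bdd g -> bdd (fun x => f x - g x).
Proof.
move=> hf hg; have := bddD hf (bddZ (-1) hg).
by congr bdd; apply/funext => x; rewrite mulN1r.
Qed.

Lemma bdd_itg (m : {measure set T -> \bar R}) f : m setT = 1%E ->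
  bdd f -> itg m f.
Proof.
by move=> m1 [mf [M fM]]; exact: itg_le mf fM (itg_cst m1 M).
Qed.

Lemma bdd_sqi (m : {measure set T -> \bar R}) f : m setT = 1%E ->
  bdd f -> sqi m f.
Proof.
by move=> m1 [mf [M fM]]; exact: sqi_le mf fM (sqi_cst m1 M).
Qed.

End Bounded.

(** The algebra of the density argument below, with the integrals as
    variables. *)
Lemma dense_arith (R : realType)
    (rho e A e' fg Kfg mf mg gg Kgg KFF FF mF Kff ff : R) :
  0 <= rho -> rho <= 1 -> 0 <= e -> e <= 1 -> 0 <= A -> (4 * A + 2) * e <= e' ->
  `|fg| <= A * e -> `|Kfg| <= A * e -> `|mf| <= A -> `|mg| <= e ->
  gg <= e ^+ 2 -> 0 <= Kgg -> KFF - mF ^+ 2 <= rho * (FF - mF ^+ 2) ->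
  KFF = Kff - 2 * Kfg + Kgg -> FF = ff - 2 * fg + gg -> mF = mf - mg ->
  Kff <= rho * ff + (1 - rho) * mf ^+ 2 + e'.
Proof.
move=> r0 r1 e0 e1 A0 ee; rewrite !ler_norml.
move=> /andP[h1 _] /andP[_ h2] h3 h4 hg hKg h E1 E2 E3.
have mm : mF ^+ 2 <= mf ^+ 2 + 2 * (A * e) + e ^+ 2.
  have h5 : `|mf * mg| <= A * e by rewrite normrM ler_pM// ler_norml.
  have h6 : mg ^+ 2 <= e ^+ 2.
    rewrite -(real_normK (num_real mg)) lerXn2r ?nnegrE// ler_norml//.
  move: h5; rewrite ler_norml => /andP[h5 _].
  have -> : mF ^+ 2 = mf ^+ 2 - 2 * (mf * mg) + mg ^+ 2 by rewrite E3; ring.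
  lra.
have FFle : FF <= ff + 2 * (A * e) + e ^+ 2 by rewrite E2; lra.
have e2 : e ^+ 2 <= e by rewrite expr2 -[leRHS]mulr1; apply: ler_wpM2l.
have r10 : 0 <= 1 - rho by rewrite subr_ge0.
have := ler_wpM2l r0 FFle; have := ler_wpM2l r10 mm.
have -> : Kff = KFF + 2 * Kfg - Kgg by rewrite E1; ring.
have : (4 * A + 2) * e = 4 * (A * e) + 2 * e by ring.
lra.
Qed.

Section Density.
Context d (T : measurableType d) (R : realType).
Variable mu : probability T R.
Implicit Types f : T -> R.

Let mu1 : mu setT = 1%E := probability_setT mu.

(** Bounded functions are dense among the square integrable ones. *)
Lemma bdd_dense f (e : R) : sqi mu f -> 0 < e ->
  exists2 F, bdd F & \int[mu]_x ((f x - F x) ^+ 2) <= e.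
Proof.
move=> hf e0; have mf := hf.1; pose F n := trunc n%:R f.
have mF n : measurable_fun setT (F n) by exact: measurable_trunc.
have bF n : bdd (F n) by split => //; exists n%:R => x; exact: trunc_le.
have mD n : measurable_fun setT (fun x => ((f x - F n x) ^+ 2)%:E).
  by apply/measurable_EFinP; apply: measurable_funX; exact: measurable_funB.
have := @dominated_convergence _ _ _ mu setT measurableT
  (fun n x => ((f x - F n x) ^+ 2)%:E) (cst 0%E) (fun x => (f x ^+ 2)%:E)
  mD (measurable_cst _).
case.
- apply/nearW => x _; apply: cvg_near_cst; exists (Num.bound `|f x|) => // n /= bn.
  have fn : `|f x| <= n%:R.
    by apply/ltW/(lt_le_trans (archi_boundP (normr_ge0 _))); rewrite ler_nat.
  have := sub_trunc f x (ler0n R n); rewrite max_r ?subr_le0// -/(F n x).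
  by move=> /normr0_eq0 ->; rewrite expr0n.
- exact: hf.2.
- apply/nearW => x n _ /=; rewrite lee_fin ger0_norm ?sqr_ge0//.
  rewrite -(real_normK (num_real (f x - _))) -(real_normK (num_real (f x))).
  rewrite lerXn2r ?nnegrE// /F sub_trunc// ge_max normr_ge0 andbT.
  by rewrite gerBl.
move=> _ _; rewrite integral_cst// mul0e => /fine_cvgP[_].
move=> /cvgrPdist_le /(_ _ e0) [N _ /(_ N (leqnn N))]/=.
rewrite sub0r normrN => h; exists (F N) => //.
exact: le_trans (ler_norm _) h.
Qed.

(** It suffices to contract the variance of functions that are bounded and
    dense. *)
Lemma variance_contraction_dense (K : R.-pker T ~> T) (rho : R) :
  (forall A, measurable A -> (\int[mu]_x K x A)%E = mu A) ->
  0 <= rho -> rho <= 1 ->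
  (forall f, sqi mu f -> forall e : R, 0 < e -> exists F, [/\ bdd F,
    \int[mu]_x ((f x - F x) ^+ 2) <= e &
    \int[mu]_x (kop K F x ^+ 2) - (\int[mu]_x F x) ^+ 2 <=
      rho * (\int[mu]_x (F x ^+ 2) - (\int[mu]_x F x) ^+ 2)]) ->
  variance_contraction mu K rho.
Proof.
move=> Kinv r0 r1 H f hf; pose a := \int[mu]_x (f x ^+ 2).
have a0 : 0 <= a by apply: Rintegral_ge0 => x _; exact: sqr_ge0.
pose A := Num.sqrt a; have A0 : 0 <= A by exact: sqrtr_ge0.
have AE : A ^+ 2 = a by rewrite sqr_sqrtr.
have aA : a <= A ^+ 2 by rewrite AE.
apply/ler_addgt0Pr => e' e'0.
pose e := Num.min 1 (e' / (4 * A + 2)).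
have A2 : 0 < 4 * A + 2 by rewrite ltr_wpDl// mulr_ge0.
have e0 : 0 < e by rewrite lt_min ltr01 divr_gt0.
have e1 : e <= 1 by rewrite ge_min lexx.
have ee : (4 * A + 2) * e <= e'.
  rewrite mulrC -ler_pdivlMr//; by rewrite ge_min lexx orbT.
have [F [bF fF KF]] := H f hf (e ^+ 2) (exprn_gt0 _ e0).
have hF := bdd_sqi mu1 bF; pose g x := f x - F x.
have hg : sqi mu g by exact: sqiB.
have hKf := sqi_kop Kinv hf; have hKg := sqi_kop Kinv hg.
have KgE : \int[mu]_x (kop K g x ^+ 2) <= e ^+ 2.
  exact: le_trans (Rint_sqr_kop_le Kinv hg) fF.
have Kfa : \int[mu]_x (kop K f x ^+ 2) <= A ^+ 2.
  by rewrite AE; exact: (Rint_sqr_kop_le Kinv hf).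
have ge : \int[mu]_x (g x ^+ 2) <= e ^+ 2 by [].
have fg := Rint_CS_le hf hg A0 (ltW e0) aA ge.
have Kfg := Rint_CS_le hKf hKg A0 (ltW e0) Kfa KgE.
have EKF : \int[mu]_x (kop K F x ^+ 2) = \int[mu]_x (kop K f x ^+ 2) -
    2 * \int[mu]_x (kop K f x * kop K g x) + \int[mu]_x (kop K g x ^+ 2).
  have i1 := sqi_mul hKf hKg.
  rewrite -(RintZ _ i1) -(RintB hKf.2 (itgZ _ i1)).
  rewrite -(RintD (itgB hKf.2 (itgZ _ i1)) hKg.2).
  apply: ae_eq_Rint.
  - exact: itg_meas (sqi_kop Kinv hF).2.
  - exact: itg_meas (itgD (itgB hKf.2 (itgZ _ i1)) hKg.2).
  have := ae_itg_pker Kinv (sqi_itg mu1 hf).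
  apply: filterS => x fx; have K1 := pker_setT K x.
  by rewrite /g (kopB fx (bdd_itg K1 bF)); ring.
have EF2 : \int[mu]_x (F x ^+ 2) = \int[mu]_x (f x ^+ 2) -
    2 * \int[mu]_x (f x * g x) + \int[mu]_x (g x ^+ 2).
  have i1 := sqi_mul hf hg.
  rewrite -(RintZ _ i1) -(RintB hf.2 (itgZ _ i1)).
  rewrite -(RintD (itgB hf.2 (itgZ _ i1)) hg.2).
  by apply: eq_Rintegral => x _; rewrite /g; ring.
have EF : \int[mu]_x F x = \int[mu]_x f x - \int[mu]_x g x.
  rewrite -(RintB (sqi_itg mu1 hf) (sqi_itg mu1 hg)).
  by apply: eq_Rintegral => x _; rewrite /g; ring.
have mf := Rint_mean_le mu1 hf A0 aA.
have mg := Rint_mean_le mu1 hg (ltW e0) ge.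
apply: (dense_arith r0 r1 (ltW e0) e1 A0 ee fg Kfg mf mg ge _ KF EKF EF2 EF).
by apply: Rintegral_ge0 => x _; exact: sqr_ge0.
Qed.

End Density.

(** * Time averages of a Markov semigroup *)

(** With [b] the integral over [[0, h + s]], the two ways of splitting this
    interval. *)
Lemma boundary_terms (R : fieldType) (s h a b c e g : R) :
  (s == 0) = false -> (h == 0) = false -> b = c + a -> b = e + g ->
  h^-1 * (s^-1 * a - s^-1 * e) = s^-1 * (h^-1 * g - h^-1 * c).
Proof.
move=> s0 h0 -> eq; have -> : a = g + e - c by rewrite -[a](addKr c) eq; ring.
by field; rewrite s0 h0.
Qed.

(** The algebra of the discrete approximation of the semigroup, with the
    integrals as variables. *)
Section StepArithmetic.
Context (R : realType).
Implicit Types a b h e x y z : R.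

Lemma boundary_sqr_le (s a b c e : R) :
  (s^-1 * (a - c) - s^-1 * (b - e)) ^+ 2 <=
  2 / s ^+ 2 * ((c - e) ^+ 2 + (a - b) ^+ 2).
Proof.
have -> : (s^-1 * (a - c) - s^-1 * (b - e)) ^+ 2 =
    s^-1 ^+ 2 * ((a - b) - (c - e)) ^+ 2 by ring.
have -> : 2 / s ^+ 2 * ((c - e) ^+ 2 + (a - b) ^+ 2) =
    s^-1 ^+ 2 * (2 * ((c - e) ^+ 2 + (a - b) ^+ 2)) by rewrite -exprVn; ring.
apply: ler_wpM2l; first exact: sqr_ge0.
have := sqr_ge0 ((a - b) + (c - e)); lra.
Qed.

Lemma step_sqr_le (u g r h : R) :
  (u + h * (g + r)) ^+ 2 <= u ^+ 2 + 2 * h * (u * g) + 2 * h * (u * r) +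
    2 * h ^+ 2 * g ^+ 2 + 2 * h ^+ 2 * r ^+ 2.
Proof. have := mulr_ge0 (sqr_ge0 h) (sqr_ge0 (g - r)); lra. Qed.

Lemma ltr_pdivr_half x : 0 < x -> x / 2 < x.
Proof. by move=> x0; rewrite ltr_pdivrMr// ltr_pMr// ltr1n. Qed.

Lemma sqr_sub_le (a b c : R) :
  (a - c) ^+ 2 <= 2 * ((a - b) ^+ 2 + (c - b) ^+ 2).
Proof. have := sqr_ge0 ((a - b) + (c - b)); lra. Qed.

Lemma ler_of_sqr x y : 0 <= y -> x ^+ 2 <= y ^+ 2 -> x <= y.
Proof.
move=> y0 xy; apply: le_trans (ler_norm x) _.
by rewrite -(@ler_pXn2r _ 2)// real_normK ?num_real.
Qed.

Lemma step_arith (C h A B e v m p ug ur gg rr : R) : 0 < C -> 0 < h ->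
  v - m <= - C * ug -> p <= v + 2 * h * ug + 2 * h * ur +
    2 * h ^+ 2 * gg + 2 * h ^+ 2 * rr ->
  ur <= A * e -> gg <= B -> rr <= e ^+ 2 ->
  p - m <= (1 - 2 * h / C) * (v - m) +
    h * (2 * A * e + h * (2 * B + 2 * e ^+ 2)).
Proof.
move=> C0 h0 hP hp hu hg hr.
have h1 : ug <= - ((v - m) / C).
  by rewrite lerNr ler_pdivrMr// mulrC; lra.
have := ler_wpM2l (ltW h0) h1; have := ler_wpM2l (ltW h0) hu.
have := ler_wpM2l (sqr_ge0 h) hg; have := ler_wpM2l (sqr_ge0 h) hr.
have -> : (1 - 2 * h / C) * (v - m) = (v - m) - 2 * (h * ((v - m) / C)).
  by field; rewrite gt_eqF.
lra.
Qed.

Lemma iter_arith (q h e A B a m p v : R) (n : nat) : 0 <= q -> q <= 1 ->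
  0 <= h -> h <= e -> 0 <= e -> e <= 1 -> 0 <= A -> 0 <= B ->
  v - m <= q ^+ n * a + n%:R * (h * (e * (2 * A + 2 * B + 2))) ->
  p - m <= q * (v - m) + h * (2 * A * e + h * (2 * B + 2 * e ^+ 2)) ->
  p - m <= q ^+ n.+1 * a + n.+1%:R * (h * (e * (2 * A + 2 * B + 2))).
Proof.
move=> q0 q1 h0 he e0 e1 A0 B0 hv hp.
set X := h * (e * (2 * A + 2 * B + 2)) in hv *.
have X0 : 0 <= X by rewrite !mulr_ge0// !addr_ge0// mulr_ge0.
have hX : h * (2 * A * e + h * (2 * B + 2 * e ^+ 2)) <= X.
  apply: ler_wpM2l => //.
  have h1 := ler_wpM2r (_ : 0 <= 2 * B + 2 * e ^+ 2) he.
  have e2 : e ^+ 2 <= 1 by rewrite exprn_ile1.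
  have := ler_wpM2l e0 e2.
  have p0 : 0 <= 2 * B + 2 * e ^+ 2 by rewrite addr_ge0// mulr_ge0 ?sqr_ge0.
  by have := h1 p0; lra.
have h2 := ler_wpM2l q0 hv.
have h3 : q * (n%:R * X) <= n%:R * X.
  by rewrite -[leRHS]mul1r; apply: ler_wpM2r => //; exact: mulr_ge0.
rewrite exprS -[n.+1]addn1 natrD mulrDl mul1r -mulrA.
rewrite mulrDr in h2; lra.
Qed.

End StepArithmetic.

Section Semigroup.
Context d (T : measurableType d) (R : realType).
Variables (P : R -> R.-pker T ~> T) (mu : probability T R).
Notation leb := (@lebesgue_measure R).
Implicit Types (f g : T -> R) (s t h u : R).

Hypothesis P0 : forall (x : T) (A : set T), measurable A -> P 0 x A = \d_x A.
Hypothesis PD : forall s t (x : T) (A : set T), 0 <= s -> 0 <= t ->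
  measurable A -> P (s + t) x A = (\int[P s x]_y P t y A)%E.
Hypothesis Pm : forall A : set T, measurable A ->
  measurable_fun [set z : measurableTypeR R * T | 0 <= z.1]
    (fun z => P z.1 z.2 A).
Hypothesis Pinv : forall t, 0 <= t -> forall A : set T, measurable A ->
  (\int[mu]_x P t x A)%E = mu A.

Let mu1 : mu setT = 1%E := probability_setT mu.

Lemma kop_semigroup s t f x : 0 <= s -> 0 <= t -> itg (P (s + t) x) f ->
  kop (P s) (kop (P t) f) x = kop (P (s + t)) f x.
Proof. by move=> s0 t0; apply: Rint_kop => A mA; rewrite -PD. Qed.

Lemma kop_0 f x : measurable_fun setT f -> kop (P 0) f x = f x.
Proof.
move=> mf; rewrite /kop /Rintegral (@eq_measure_integral _ _ _ _ (dirac x)).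
  by rewrite integral_dirac ?diracT ?mul1e//; exact/measurable_EFinP.
by move=> A mA _; exact: P0.
Qed.

Lemma kop_bdd t f : bdd f -> bdd (kop (P t) f).
Proof.
move=> hf; have [mf [M fM]] := hf; split; first exact: measurable_kop.
exists M => x; have Pt1 := pker_setT (P t) x.
apply: le_trans (le_norm_kop (bdd_itg Pt1 hf)) _.
rewrite -[leRHS](kop_cst (P t) M x); apply: le_kop => //.
- exact: itg_norm (bdd_itg Pt1 hf).
- exact: itg_cst.
Qed.

(** The trajectory of [f] under the semigroup, extended by its initial value to
    negative times so as to be measurable on the whole product space. *)
Definition traj f (z : measurableTypeR R * T) : R :=
  kop (P (Num.max z.1 0)) f z.2.

Lemma trajE f u x : 0 <= u -> traj f (u, x) = kop (P u) f x.
Proof. by move=> u0; rewrite /traj/= max_l. Qed.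

Lemma measurable_traj f : measurable_fun setT f -> measurable_fun setT (traj f).
Proof.
move=> mf; apply: (measurable_Rintegral
  (k := fun z : measurableTypeR R * T => P (Num.max z.1 0) z.2)) => // A mA.
pose g (z : measurableTypeR R * T) : measurableTypeR R * T :=
  (Num.max z.1 0, z.2).
apply: (@measurable_comp _ _ _ _ _ _ [set z : measurableTypeR R * T | 0 <= z.1]
   (fun z => P z.1 z.2 A) setT g) => //.
- rewrite (_ : [set z | _] =
    (fst : measurableTypeR R * T -> R) @^-1` `[0, +oo[); last first.
    by apply/seteqP; split => z /=; rewrite in_itv/= andbT.
  by rewrite -[X in measurable X]setTI; exact: measurable_fst.
- by move=> _ [z _ <-] /=; rewrite le_max lexx orbT.
- exact: Pm.
- apply/measurable_fun_pairP; split; last exact: measurable_snd.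
  by apply: measurable_maxr => //; exact: measurable_fst.
Qed.

Lemma traj_bounded f : bdd f -> exists M, forall z, `|traj f z| <= M.
Proof.
move=> hf; have [mf [M fM]] := hf; exists M => z.
have Pt1 := pker_setT (P (Num.max z.1 0)) z.2.
apply: le_trans (le_norm_kop (bdd_itg Pt1 hf)) _.
rewrite -[leRHS](kop_cst (P (Num.max z.1 0)) M z.2); apply: le_kop => //.
- exact: itg_norm (bdd_itg Pt1 hf).
- exact: itg_cst.
Qed.

Lemma measurable_traj_time f x : measurable_fun setT f ->
  measurable_fun setT (fun u : measurableTypeR R => traj f (u, x)).
Proof.
move=> mf; apply: measurableT_comp (measurable_traj mf) _.
exact: measurable_pair2.
Qed.

(** The average of the trajectory of [f] over the time interval [[0, s]]. *)
Definition average s f (x : T) : R :=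
  s^-1 * \int[leb]_(u in `[0, s]) traj f (u, x).

Lemma average_bdd s f : 0 < s -> bdd f -> bdd (average s f).
Proof.
move=> s0 hf; have [mf _] := hf; have [M fM] := traj_bounded hf.
have [h _] := bounded_time_Fubini s mu1 (measurable_traj mf) fM; split.
  apply: measurable_funM => //; exact: itg_meas h.
exists M => x; rewrite normrM ger0_norm ?invr_ge0 ?(ltW s0)//.
rewrite ler_pdivrMl//; apply: norm_time_integral_le (ltW s0) => //.
exact: measurable_traj_time.
Qed.

(** The semigroup commutes with time averages. *)
Lemma kop_average s t f x : 0 < s -> 0 <= t -> bdd f ->
  kop (P t) (average s f) x =
  s^-1 * \int[leb]_(u in `[t, t + s]) traj f (u, x).
Proof.
move=> s0 t0 hf; have [mf _] := hf; have [M fM] := traj_bounded hf.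
have [h1 h2] := bounded_time_Fubini s (pker_setT (P t) x) (measurable_traj mf) fM.
rewrite (kopZ _ h1); congr (_ * _); rewrite /kop h2.
rewrite -(Rint_shift _ _ (measurable_traj_time x mf) (fun u => fM (u, x))).
apply: eq_Rintegral => u; rewrite inE/= in_itv/= => /andP[u0 _].
rewrite (@trajE f (t + u) x (addr_ge0 t0 u0)) -kop_semigroup//; last first.
  exact: bdd_itg (pker_setT _ _) hf.
by apply: eq_Rintegral => y _; exact: trajE.
Qed.

Lemma average_kop s t f x : 0 < s -> 0 <= t -> bdd f ->
  average s (kop (P t) f) x =
  s^-1 * \int[leb]_(u in `[t, t + s]) traj f (u, x).
Proof.
move=> s0 t0 hf; have [mf _] := hf; have [M fM] := traj_bounded hf.
congr (_ * _).
rewrite -(Rint_shift _ _ (measurable_traj_time x mf) (fun u => fM (u, x))).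
apply: eq_Rintegral => u; rewrite inE/= in_itv/= => /andP[u0 _].
rewrite (@trajE f (t + u) x (addr_ge0 t0 u0)) (trajE _ _ u0) kop_semigroup//.
  by rewrite addrC.
exact: bdd_itg (pker_setT _ _) hf.
Qed.

(** The increments of a time average are boundary terms. *)
Lemma average_increment s h f x : 0 < s -> 0 < h -> bdd f ->
  h^-1 * (kop (P h) (average s f) x - average s f x) =
  s^-1 * (average h (kop (P s) f) x - average h f x).
Proof.
move=> s0 h0 hf; have [mf _] := hf; have [M fM] := traj_bounded hf.
rewrite (kop_average _ s0 (ltW h0) hf) (average_kop _ h0 (ltW s0) hf).
have mt := measurable_traj_time x mf; have tM u := fM (u, x).
have sh : h <= h + s by rewrite lerDl ltW.
have hs : s <= h + s by rewrite lerDr ltW.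
have e1 := Rint_itv_split mt tM (ltW h0) sh.
have e2 := Rint_itv_split mt tM (ltW s0) hs.
rewrite (addrC s h) /average.
exact: (boundary_terms (gt_eqF s0) (gt_eqF h0) e1 e2).
Qed.

(** The extended generator has mean zero: by invariance the left-hand side of
    its defining identity has mean [0], and the right-hand side has the mean of
    [g] times the length of the time interval. *)
Lemma Rint_generator f g : itg mu f -> itg mu g ->
  {ae mu, forall x, kop (P 1) f x - f x =
     \int[leb]_(s in `[0, 1]) kop (P s) g x} ->
  \int[mu]_x g x = 0.
Proof.
move=> hf hg fg; have mg := itg_meas hg.
have g1 : lpi mu 1 g.
  split => //; rewrite (_ : (fun x => _) = (fun x => `|g x|)); first exact: itg_norm.
  by apply/funext => x; rewrite powRr1.
have B s : 0 <= s -> s <= 1 -> itg mu (fun x => traj g (s, x)) /\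
    \int[mu]_x `|traj g (s, x)| <= \int[mu]_x (`|g x| `^ 1).
  move=> s0 _; have E x : traj g (s, x) = kop (P s) g x by exact: trajE.
  rewrite (_ : (fun x => traj g (s, x)) = kop (P s) g); last exact/funext.
  split; first exact: (itg_kop (Pinv s0) hg).
  have [_ ] := lpi_kop (Pinv s0) (lexx 1) g1; apply: le_trans.
  by rewrite le_eqVlt; apply/orP; left; apply/eqP; apply: eq_Rintegral => x _;
    rewrite E powRr1.
have [i1 i2] := Rint_time_Fubini (measurable_traj mg) B.
have E x : \int[leb]_(s in `[0, 1]) kop (P s) g x =
    \int[leb]_(s in `[0, 1]) traj g (s, x).
  by apply: eq_Rintegral => s; rewrite inE/= in_itv/= => /andP[s0 _]; rewrite trajE.
have h01 : (0 : R) <= 1 by [].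
have e : \int[leb]_(s in `[0, 1]) \int[mu]_x traj g (s, x) = \int[mu]_x g x.
  rewrite -[RHS]mul1r -(Rint_time_cst _ h01); apply: eq_Rintegral => s.
  rewrite inE/= in_itv/= => /andP[s0 _].
  rewrite -(Rint_kop (Pinv s0) hg); apply: eq_Rintegral => x _.
  exact: trajE.
rewrite -e -i2; have iK := itg_kop (Pinv h01) hf.
rewrite -(ae_eq_Rint (f := fun x => kop (P 1) f x - f x)).
- by rewrite (RintB iK hf) (Rint_kop (Pinv h01) hf) subrr.
- exact: itg_meas (itgB iK hf).
- exact: itg_meas i1.
- by apply: filterS fg => x ->; exact: E.
Qed.

(** Strong continuity at time [0]. *)
Hypothesis Pc : forall f, bdd f -> forall e : R, 0 < e -> exists2 r : R, 0 < r &
  forall h, 0 < h -> h < r -> \int[mu]_x ((kop (P h) f x - f x) ^+ 2) <= e.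

(** Time averages over short intervals converge to the function: as everything
    is bounded, the quadratic norm is controlled by first moments, which are
    averages over the interval. *)
Lemma average_cvg f (e : R) : bdd f -> 0 < e -> exists2 r : R, 0 < r &
  forall h, 0 < h -> h < r -> \int[mu]_x ((average h f x - f x) ^+ 2) <= e.
Proof.
move=> hf e0; have [mf [A fA]] := hf; have [M0 fM0] := traj_bounded hf.
(* a common bound for [f], its averages and their difference, made positive *)
pose M := M0 + A + 1.
have M1 : 0 < M.
  rewrite /M ltr_wpDl// addr_ge0//; last exact: le_trans (fA point).
  exact: le_trans (fM0 point).
pose phi (z : measurableTypeR R * T) := `|traj f z - f z.2|.
have phiM z : `|phi z| <= M.
  rewrite normr_id; apply: le_trans (ler_normB _ _) _.
  by rewrite /M ler_wpDr// lerD.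
have mphi : measurable_fun setT phi.
  apply: measurableT_comp => //; apply: measurable_funB.
    exact: measurable_traj.
  exact: measurableT_comp mf measurable_snd.
pose e' := (e / M) ^+ 2; have e'0 : 0 < e' by rewrite exprn_gt0// divr_gt0.
have [r r0 Hr] := Pc hf e'0; exists r => // h h0 hr.
have [i1 i2] := bounded_time_Fubini h mu1 mphi phiM.
have ha := average_bdd h0 hf; have hd := bddB ha hf.
have key x : (average h f x - f x) ^+ 2 <=
    M / h * \int[leb]_(s in `[0, h]) phi (s, x).
  have tM := measurable_traj_time x mf; have tB u := fM0 (u, x).
  have it := integrable_bounded_itv 0 h tM tB.
  have ic := @integrable_bounded_itv _ (fun=> f x) A 0 h
    (measurable_cst _) (fun=> fA x).
  have e1 : average h f x - f x =
      h^-1 * \int[leb]_(u in `[0, h]) (traj f (u, x) - f x).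
    rewrite (RintegralB _ it ic)// (Rint_time_cst _ (ltW h0)) mulrBr.
    by rewrite mulKf// gt_eqF.
  have h2 : `|average h f x - f x| <= h^-1 * \int[leb]_(s in `[0, h]) phi (s, x).
    rewrite e1 normrM ger0_norm ?invr_ge0 ?(ltW h0)// ler_pM2l ?invr_gt0//.
    apply: le_normr_Rintegral => //.
    apply: (@integrable_bounded_itv _ (fun u => traj f (u, x) - f x) M).
      exact: measurable_funB.
    by move=> u; rewrite -normr_id; exact: phiM.
  have h3 : `|average h f x - f x| <= M.
    apply: le_trans (ler_normB _ _) _; rewrite /M ler_wpDr// lerD//.
    rewrite normrM ger0_norm ?invr_ge0 ?(ltW h0)//.
    by rewrite ler_pdivrMl//; apply: norm_time_integral_le (ltW h0).
  rewrite -(real_normK (num_real (_ - _))) expr2 -mulrA.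
  exact: ler_pM.
apply: (@le_trans _ _ (M / h * (h * (e / M)))); last first.
  by rewrite le_eqVlt; apply/orP; left; apply/eqP; field; rewrite !gt_eqF.
apply: (@le_trans _ _ (\int[mu]_x (M / h * \int[leb]_(s in `[0, h]) phi (s, x)))).
  by apply: le_Rint => //; [exact: (bdd_sqi mu1 hd).2|exact: itgZ].
rewrite (RintZ _ i1) ler_pM2l ?divr_gt0// i2.
have mE : measurable_fun setT (fun s : measurableTypeR R => \int[mu]_x phi (s, x)).
  apply: measurable_fine_fun.
  apply: (@measurable_fun_fubini_tonelli_F _ _ _ _ _ mu (fun z => (phi z)%:E)).
    exact/measurable_EFinP.
  by move=> z; rewrite lee_fin; exact: normr_ge0.
have ip s : itg mu (fun x => phi (s, x)).
  apply: itg_le (itg_cst mu1 M) => [|x]; last exact: phiM.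
  exact: measurable_fun_pair2.
rewrite -(Rint_time_cst _ (ltW h0)); apply: le_Rintegral => //.
- apply: (@integrable_bounded_itv _ _ M) => // s.
  rewrite ger0_norm; last by apply: Rintegral_ge0 => x _; exact: normr_ge0.
  rewrite -[leRHS](Rint_cst mu1 M); apply: le_Rint => //; first exact: itg_cst.
  by move=> x; apply: le_trans (phiM (s, x)); exact: ler_norm.
- by apply: (@integrable_bounded_itv _ (fun=> e / M) `|e / M|).
move=> s; rewrite /= in_itv/= => /andP[s0 sh].
rewrite -(@ler_pXn2r _ 2)// ?nnegrE; last 2 first.
- by apply: Rintegral_ge0 => x _; exact: normr_ge0.
- by rewrite divr_ge0 ?ltW.
have sp : sqi mu (fun x => phi (s, x)).
  apply: sqi_le (sqi_cst mu1 M) => [|x]; last exact: phiM.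
  exact: measurable_fun_pair2.
apply: le_trans (Rint_sqr_le mu1 sp) _.
move: s0; rewrite le_eqVlt => /predU1P[s0|s0].
  have -> : (fun x => phi (s, x) ^+ 2) = fun=> 0.
    apply/funext => x; rewrite /phi -s0 trajE//= kop_0// subrr normr0 expr0n//.
  by rewrite Rint_cst// sqr_ge0.
apply: le_trans (Hr s s0 (le_lt_trans sh hr)).
rewrite le_eqVlt; apply/orP; left; apply/eqP; apply: eq_Rintegral => x _.
by rewrite /phi (trajE _ _ (ltW s0)) real_normK ?num_real.
Qed.

(** The pair [(F, G)] belongs to the graph of the generator in the quadratic
    norm. *)
Definition gen_pair (F G : T -> R) : Prop := forall e : R, 0 < e ->
  exists2 r : R, 0 < r & forall h, 0 < h -> h < r ->
    \int[mu]_x ((h^-1 * (kop (P h) F x - F x) - G x) ^+ 2) <= e.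

(** Time averages of bounded functions are in the domain of the generator. *)
Lemma gen_pair_average s f : 0 < s -> bdd f ->
  gen_pair (average s f) (fun x => s^-1 * (kop (P s) f x - f x)).
Proof.
move=> s0 hf e e0; have hPf := kop_bdd s hf.
pose e' := s ^+ 2 * e / 4.
have e'0 : 0 < e' by rewrite divr_gt0// mulr_gt0// exprn_gt0.
have [r1 r10 H1] := average_cvg hf e'0; have [r2 r20 H2] := average_cvg hPf e'0.
exists (Num.min r1 r2); first by rewrite lt_min r10.
move=> h h0; rewrite lt_min => /andP[h1 h2].
have d1 := bdd_sqi mu1 (bddB (average_bdd h0 hf) hf).
have d2 := bdd_sqi mu1 (bddB (average_bdd h0 hPf) hPf).
have -> : e = 2 / s ^+ 2 * (e' + e').
  by rewrite /e'; field; rewrite gt_eqF.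
apply: le_trans (ler_wpM2l _ (lerD (H1 _ h0 h1) (H2 _ h0 h2))); last first.
  by rewrite divr_ge0// sqr_ge0.
have i12 := itgD d1.2 d2.2.
rewrite -(RintD d1.2 d2.2) -(RintZ _ i12); apply: le_Rint.
- apply: (sqi_sqr (bdd_sqi mu1 _)); apply: bddB; last first.
    by apply: bddZ; exact: bddB.
  apply: bddZ; apply: bddB; last exact: average_bdd.
  by apply: kop_bdd; exact: average_bdd.
- exact: itgZ.
move=> x; rewrite average_increment//; exact: boundary_sqr_le.
Qed.

(** The remainder in the definition of the generator does not increase along
    the semigroup. *)
Lemma remainder_kop t h F G : 0 <= t -> 0 < h -> bdd F -> bdd G ->
  \int[mu]_x ((h^-1 * (kop (P h) (kop (P t) F) x - kop (P t) F x)
     - kop (P t) G x) ^+ 2) <=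
  \int[mu]_x ((h^-1 * (kop (P h) F x - F x) - G x) ^+ 2).
Proof.
move=> t0 h0 hF hG; have hPF := kop_bdd h hF.
have hd := bddZ h^-1 (bddB hPF hF).
have := Rint_sqr_kop_le (Pinv t0) (bdd_sqi mu1 (bddB hd hG)).
apply: le_trans; rewrite le_eqVlt; apply/orP; left; apply/eqP.
apply: eq_Rintegral => x _; have Pt1 := pker_setT (P t) x.
rewrite (kopB (bdd_itg Pt1 hd) (bdd_itg Pt1 hG)).
rewrite (kopZ _ (bdd_itg Pt1 (bddB hPF hF))).
rewrite (kopB (bdd_itg Pt1 hPF) (bdd_itg Pt1 hF)).
have i u y : itg (P u y) F := bdd_itg (pker_setT _ _) hF.
rewrite (kop_semigroup (ltW h0) t0 (i _ _)).
by rewrite (kop_semigroup t0 (ltW h0) (i _ _)) (addrC t h).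
Qed.

Lemma kop_iter F h n x : bdd F -> 0 <= h ->
  kop (P h) (kop (P (n%:R * h)) F) x = kop (P (n.+1%:R * h)) F x.
Proof.
move=> hF h0; rewrite kop_semigroup//.
- by rewrite -[n.+1]add1n natrD mulrDl mul1r.
- by rewrite mulr_ge0.
- exact: bdd_itg (pker_setT _ _) hF.
Qed.

Variable C : R.
Hypothesis C0 : 0 < C.
(** The Poincaré inequality on the graph of the generator. *)
Hypothesis Cpoincare : forall F G, bdd F -> bdd G -> gen_pair F G ->
  \int[mu]_x (F x ^+ 2) - (\int[mu]_x F x) ^+ 2 <=
  - C * \int[mu]_x (F x * G x).

Lemma gen_pair_kop t F G : 0 <= t -> bdd F -> bdd G -> gen_pair F G ->
  gen_pair (kop (P t) F) (kop (P t) G).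
Proof.
move=> t0 hF hG FG e e0; have [r r0 H] := FG e e0; exists r => // h h0 hr.
exact: le_trans (remainder_kop t0 h0 hF hG) (H h h0 hr).
Qed.

(** One step of size [h]: up to an error of order [e * h] the variance is
    multiplied by [1 - 2 * h / C]. *)
Lemma variance_step h (e A B : R) (u g : T -> R) : 0 < h -> 0 <= e -> 0 <= A ->
  bdd u -> bdd g -> gen_pair u g ->
  \int[mu]_x ((h^-1 * (kop (P h) u x - u x) - g x) ^+ 2) <= e ^+ 2 ->
  \int[mu]_x (u x ^+ 2) <= A ^+ 2 -> \int[mu]_x (g x ^+ 2) <= B ->
  \int[mu]_x (kop (P h) u x ^+ 2) - (\int[mu]_x u x) ^+ 2 <=
  (1 - 2 * h / C) * (\int[mu]_x (u x ^+ 2) - (\int[mu]_x u x) ^+ 2) +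
  h * (2 * A * e + h * (2 * B + 2 * e ^+ 2)).
Proof.
move=> h0 e0 A0 hu hg ug; pose r x := h^-1 * (kop (P h) u x - u x) - g x.
have hr : bdd r.
  by apply: bddB => //; apply: bddZ; apply: bddB => //; exact: kop_bdd.
rewrite -/(r _) => re uA gB.
have su := bdd_sqi mu1 hu; have sg := bdd_sqi mu1 hg; have sr := bdd_sqi mu1 hr.
have hP := Cpoincare hu hg ug.
have iug := sqi_mul su sg; have iur := sqi_mul su sr; have igr := sqi_mul sg sr.
have expand : \int[mu]_x (kop (P h) u x ^+ 2) <=
    \int[mu]_x (u x ^+ 2) + 2 * h * \int[mu]_x (u x * g x) +
    2 * h * \int[mu]_x (u x * r x) + 2 * h ^+ 2 * \int[mu]_x (g x ^+ 2) +
    2 * h ^+ 2 * \int[mu]_x (r x ^+ 2).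
  have i1 := itgZ (2 * h) iug; have i2 := itgZ (2 * h) iur.
  have i3 := itgZ (2 * h ^+ 2) sg.2; have i4 := itgZ (2 * h ^+ 2) sr.2.
  rewrite -!RintZ//; [|exact: sr.2|exact: sg.2].
  rewrite -(RintD su.2 i1) -(RintD (itgD su.2 i1) i2).
  rewrite -(RintD (itgD (itgD su.2 i1) i2) i3).
  rewrite -(RintD (itgD (itgD (itgD su.2 i1) i2) i3) i4).
  apply: le_Rint.
  - exact: sqi_sqr (bdd_sqi mu1 (kop_bdd h hu)).
  - by apply: itgD => //; apply: itgD => //; apply: itgD => //; apply: itgD => //;
      exact: su.2.
  move=> x; have -> : kop (P h) u x = u x + h * (g x + r x).
    by rewrite /r addrCA subrr addr0 mulVKf ?gt_eqF// addrC subrK.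
  exact: step_sqr_le.
have urA : \int[mu]_x (u x * r x) <= A * e.
  have := Rint_CS su sr => h1; apply: ler_of_sqr; first exact: mulr_ge0.
  apply: le_trans h1 _; rewrite exprMn; apply: ler_pM => //.
  - by apply: Rintegral_ge0 => x _; exact: sqr_ge0.
  - by apply: Rintegral_ge0 => x _; exact: sqr_ge0.
exact: step_arith C0 h0 hP expand urA gB re.
Qed.

(** Decay of the variance on the domain of the generator: [n] steps of size
    [t / n], with accumulated error at most [D * e]. *)
Lemma variance_contraction_gen_pair t F G : 0 <= t -> bdd F -> bdd G ->
  gen_pair F G ->
  \int[mu]_x (kop (P t) F x ^+ 2) - (\int[mu]_x F x) ^+ 2 <=
  expR (- 2 * t / C) * (\int[mu]_x (F x ^+ 2) - (\int[mu]_x F x) ^+ 2).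
Proof.
move=> t0 hF hG FG; set m := \int[mu]_x F x.
have sF := bdd_sqi mu1 hF; have sG := bdd_sqi mu1 hG.
set a := \int[mu]_x (F x ^+ 2); set B := \int[mu]_x (G x ^+ 2).
have a0 : 0 <= a by apply: Rintegral_ge0 => x _; exact: sqr_ge0.
have B0 : 0 <= B by apply: Rintegral_ge0 => x _; exact: sqr_ge0.
pose A := Num.sqrt a; have A0 : 0 <= A by exact: sqrtr_ge0.
have AE : A ^+ 2 = a by rewrite sqr_sqrtr.
pose D := t * (2 * A + 2 * B + 2).
have D0 : 0 <= D by rewrite mulr_ge0// !addr_ge0// mulr_ge0.
suff H e : 0 < e -> e <= 1 -> \int[mu]_x (kop (P t) F x ^+ 2) - m ^+ 2 <=
    expR (- 2 * t / C) * (a - m ^+ 2) + D * e.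
  apply/ler_addgt0Pr => e e0; pose e1 := Num.min 1 (e / (D + 1)).
  have D1 : 0 < D + 1 by rewrite ltr_wpDl.
  have e10 : 0 < e1 by rewrite lt_min ltr01 divr_gt0.
  apply: le_trans (H e1 e10 _) _; first by rewrite ge_min lexx.
  rewrite lerD2l; apply: (@le_trans _ _ (D * (e / (D + 1)))).
    by apply: ler_wpM2l => //; rewrite ge_min lexx orbT.
  rewrite mulrCA -[leRHS]mulr1; apply: ler_wpM2l; first exact: ltW.
  by rewrite ler_pdivrMr// mul1r lerDl.
move=> e0 e1; have [r r0 Hr] := FG (e ^+ 2) (exprn_gt0 _ e0).
have [t00|tN0] := eqVneq t 0.
  rewrite /D t00 !mulr0 !mul0r expR0 mul1r addr0.
  rewrite (_ : \int[mu]_x (_ ^+ 2) = a)//; apply: eq_Rintegral => x _.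
  by rewrite kop_0//; exact: bdd_meas.
have tp : 0 < t by rewrite lt_neqAle eq_sym tN0.
(* steps shorter than [C / 2] keep the factor [1 - 2 h / C] nonnegative *)
pose r' := Num.min (Num.min r e) (C / 2).
have r'0 : 0 < r' by rewrite !lt_min r0 e0 divr_gt0.
have [n] : exists n : nat, t / r' < n.+1%:R.
  exists (Num.bound (t / r')); apply: lt_trans (archi_boundP _) _.
    by rewrite divr_ge0// ltW.
  by rewrite ltr_nat.
rewrite ltr_pdivrMr// mulrC => nr'.
pose h := t / n.+1%:R; have h0 : 0 < h by rewrite divr_gt0.
have : h < r' by rewrite ltr_pdivrMr// mulrC mulrC.
rewrite !lt_min => /andP[/andP[hr he] hC].
pose q := 1 - 2 * h / C.
have q0 : 0 <= q.
  by rewrite subr_ge0 ler_pdivrMr// mul1r mulrC -ler_pdivlMr// ltW.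
have q1 : q <= 1 by rewrite gerBl divr_ge0 ?mulr_ge0 ?ltW.
have step k : \int[mu]_x (kop (P (k%:R * h)) F x ^+ 2) - m ^+ 2 <=
    q ^+ k * (a - m ^+ 2) + k%:R * (h * (e * (2 * A + 2 * B + 2))).
  elim: k => [|k IH].
    rewrite !mul0r addr0 expr0 mul1r.
    rewrite (_ : \int[mu]_x (_ ^+ 2) = a)//; apply: eq_Rintegral => x _.
    by rewrite kop_0//; exact: bdd_meas.
  have k0 : 0 <= k%:R * h by rewrite mulr_ge0 ?(ltW h0).
  have hu := kop_bdd (k%:R * h) hF; have hg := kop_bdd (k%:R * h) hG.
  have uA : \int[mu]_x (kop (P (k%:R * h)) F x ^+ 2) <= A ^+ 2.
    by rewrite AE; exact: (Rint_sqr_kop_le (Pinv k0) sF).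
  have gB : \int[mu]_x (kop (P (k%:R * h)) G x ^+ 2) <= B.
    exact: (Rint_sqr_kop_le (Pinv k0) sG).
  have re := le_trans (remainder_kop k0 h0 hF hG) (Hr h h0 hr).
  have := variance_step h0 (ltW e0) A0 hu hg (gen_pair_kop k0 hF hG FG) re uA gB.
  rewrite (Rint_kop (Pinv k0) (sqi_itg mu1 sF)) -/m.
  under eq_Rintegral do rewrite kop_iter ?(ltW h0)//.
  exact: (iter_arith q0 q1 (ltW h0) (ltW he) (ltW e0) e1 A0 B0 IH).
have nh : n.+1%:R * h = t by rewrite /h mulrC divfK// pnatr_eq0.
have := step n.+1; rewrite nh => /le_trans; apply; apply: lerD.
  apply: ler_wpM2r; first by rewrite subr_ge0; exact: (Rint_sqr_le mu1 sF).
  have -> : - 2 * t / C = (- (2 * h / C)) * n.+1%:R.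
    by rewrite -nh; field; rewrite gt_eqF.
  rewrite expRM_natr; apply: lerXn2r; rewrite ?nnegrE ?expR_ge0//.
  by apply: le_trans (expR_ge1Dx _); rewrite /q.
by rewrite mulrA nh /D; rewrite le_eqVlt; apply/orP; left; apply/eqP; ring.
Qed.

(** The variance of every square integrable function decays exponentially: the
    previous bound applies to the time averages of bounded functions, which are
    dense. *)
Theorem variance_decay t : 0 <= t ->
  variance_contraction mu (P t) (expR (- 2 * t / C)).
Proof.
move=> t0; apply: (variance_contraction_dense (Pinv t0)).
- exact: expR_ge0.
- apply: (@le_trans _ _ (expR 0)); last by rewrite expR0.
  by rewrite ler_expR !mulNr oppr_le0 divr_ge0 ?mulr_ge0// ltW.
move=> f hf e e0; have e20 : 0 < e / 4 by rewrite divr_gt0.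
have [F hF fF] := bdd_dense hf e20.
have [r r0 Hr] := average_cvg hF e20.
have r20 : 0 < r / 2 by rewrite divr_gt0.
have ha := average_bdd r20 hF.
have hG := bddZ (r / 2)^-1 (bddB (kop_bdd (r / 2) hF) hF).
exists (average (r / 2) F); split; first exact: ha.
- have d1 := sqiB hf (bdd_sqi mu1 hF).
  have d2 := bdd_sqi mu1 (bddB ha hF).
  have := Hr _ r20 (ltr_pdivr_half r0); move: fF => h1 h2.
  have -> : e = 2 * (e / 4 + e / 4) by field.
  apply: le_trans (ler_wpM2l _ (lerD h1 h2)) => //.
  rewrite -(RintD d1.2 d2.2) -(RintZ _ (itgD d1.2 d2.2)); apply: le_Rint.
  + exact: (sqiB hf (bdd_sqi mu1 ha)).2.
  + by apply: itgZ; apply: itgD; [exact: d1.2|exact: d2.2].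
  + by move=> x; exact: sqr_sub_le.
- exact: variance_contraction_gen_pair t0 ha hG (gen_pair_average r20 hF).
Qed.

End Semigroup.

(** * From norms to moments *)

Section Norms.
Context (R : realType) (E : completePseudoMetricType R).
Variable mu : probability (borel E) R.
Implicit Types (f : borel E -> R) (p e : R).

Let mu1 : mu setT = 1%E := probability_setT mu.

Lemma Lfun_lpi p f : 1 <= p -> f \in Lfun mu p%:E -> lpi mu p f.
Proof.
move=> p1 hf; split; last exact: Lfun_integrable.
by move: hf; rewrite inE => /andP[/[!inE]].
Qed.

Lemma LpnormE p f : 1 <= p -> lpi mu p f ->
  Lpnorm mu p f = ((\int[mu]_x (`|f x| `^ p)) `^ p^-1)%:E.
Proof.
move=> p1 [mf hf]; rewrite /Lpnorm unlock /=.
by rewrite -poweR_EFin (EFin_Rint hf).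
Qed.

Lemma lpi_Lfun p f : 1 <= p -> lpi mu p f -> f \in Lfun mu p%:E.
Proof.
move=> p1 hf; rewrite inE; apply/andP; split; rewrite inE/=; first exact: hf.1.
by rewrite /finite_norm -/(Lpnorm mu p f) LpnormE// ltry.
Qed.

Lemma Lfun2_sqi f : f \in Lfun mu 2%:E -> sqi mu f.
Proof. by move=> /Lfun_lpi h; apply/lpi2; apply: h; rewrite ler1n. Qed.

Lemma Lpnorm2E f : sqi mu f ->
  Lpnorm mu 2 f = (Num.sqrt (\int[mu]_x (f x ^+ 2)))%:E.
Proof.
move=> hf; rewrite LpnormE ?ler1n//; last exact/lpi2.
rewrite powR12_sqrt; last by apply: Rintegral_ge0 => x _; exact: powR_ge0.
congr (Num.sqrt _)%:E; apply: eq_Rintegral => x _.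
by rewrite powR_mulrn// real_normK ?num_real.
Qed.

Lemma Lpnorm2_lt f e : sqi mu f -> 0 < e ->
  (Lpnorm mu 2 f < e%:E)%E = (\int[mu]_x (f x ^+ 2) < e ^+ 2).
Proof.
move=> hf e0; rewrite Lpnorm2E// lte_fin.
rewrite -{1}(ger0_norm (ltW e0)) -sqrtr_sqr ltr_sqrt// exprn_gt0//.
Qed.

(** Convergence to [0] of a nonnegative function of time. *)
Lemma cvg_at_right0P (F : R -> \bar R) : (forall h, (0 <= F h)%E) ->
  F h @[h --> 0^'+] --> 0%E <->
  forall e : R, 0 < e -> exists2 r : R, 0 < r &
    forall h, 0 < h -> h < r -> (F h < e%:E)%E.
Proof.
move=> F0; split.
  move=> /fine_cvgP[fF /cvgrPdist_lt cF] e e0.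
  have [r /= r0 H] := filterI fF (cF e e0); exists r => // h h0 hr.
  have [/=|fh] := H h _ h0; first by rewrite sub0r normrN gtr0_norm.
  rewrite sub0r normrN => /(le_lt_trans (ler_norm _)).
  by rewrite -lte_fin fineK.
move=> H; apply/fine_cvgP.
have N (e : R) : 0 < e -> \forall h \near 0^'+, (F h < e%:E)%E.
  move=> e0; have [r r0 Hr] := H e e0.
  near=> h; apply: Hr; near: h; first exact: nbhs_right_gt.
  exact: nbhs_right_lt.
split.
  apply: filterS (N 1 ltr01) => h h1.
  by rewrite ge0_fin_numE// (lt_trans h1)// ltry.
apply/cvgrPdist_lt => e e0; apply: filterS (N e e0) => h he.
rewrite sub0r normrN ger0_norm ?fine_ge0//.
by rewrite -lte_fin fineK// ge0_fin_numE// (lt_trans he)// ltry.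
Unshelve. all: by end_near. Qed.

End Norms.

(** * The Poincaré inequality on the domain of the generator *)

(** The algebra of the passage from the core to the domain of the generator,
    with the integrals as variables. *)
Lemma poincare_arith (R : realType) (C A B e e' FG Fv uG uv Fu u F f a ff fL uu : R) :
  0 < C -> 0 <= e -> e <= 1 -> (C * (A + B + 1) + 4 * A + 1) * e <= e' ->
  `|Fv| <= A * e -> `|uG| <= e * B -> `|uv| <= e * e -> `|Fu| <= A * e ->
  `|F| <= A -> `|u| <= e -> 0 <= uu -> ff - f ^+ 2 <= - C * fL ->
  fL = FG + Fv + uG + uv -> ff = a + 2 * Fu + uu -> f = F + u ->
  a - F ^+ 2 <= - C * FG + e'.
Proof.
move=> C0 e0 e1 ee h1 h2 h3 h4 h5 h6 uu0 H E1 E2 E3.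
have e2 : e * e <= e by rewrite -[leRHS]mulr1; apply: ler_wpM2l.
have h7 : F * u <= A * e.
  by apply: le_trans (ler_norm _) _; rewrite normrM; exact: ler_pM.
have h8 : u ^+ 2 <= e * e.
  by rewrite -(real_normK (num_real u)) expr2; exact: ler_pM.
move: h1 h2 h3 h4; rewrite !ler_norml => /andP[h1 _] /andP[h2 _] /andP[h3 _].
move=> /andP[h4 _].
have k1 : FG - (A * e + B * e + e) <= fL by rewrite E1; lra.
have := ler_wpM2l (ltW C0) k1.
have k2 : f ^+ 2 <= F ^+ 2 + 2 * (A * e) + e by rewrite E3; lra.
have k3 : a - 2 * (A * e) <= ff by rewrite E2; lra.
have -> : C * (FG - (A * e + B * e + e)) = C * FG - C * (A + B + 1) * e by ring.
have : (C * (A + B + 1) + 4 * A + 1) * e =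
  C * (A + B + 1) * e + 4 * (A * e) + e by ring.
lra.
Qed.

Section Core.
Context (R : realType) (E : completePseudoMetricType R).
Variables (P : R -> R.-pker borel E ~> borel E) (mu : probability (borel E) R).
Variables (L : (borel E -> R) -> (borel E -> R)) (D : set (borel E -> R)).
Variable C : R.
Hypothesis hX : diffusion P mu L D.
Hypothesis hmu : invariant P mu.
Hypothesis C0 : 0 < C.
Hypothesis hP : poincare mu L D C.
Implicit Types (f g F G : borel E -> R) (t s h : R).

Let mu1 : mu setT = 1%E := probability_setT mu.

Let P0 (x : borel E) (A : set (borel E)) : measurable A -> P 0 x A = \d_x A.
Proof. exact: (markov0 (diffusion_markov hX)). Qed.

Let PD s t (x : borel E) (A : set (borel E)) : 0 <= s -> 0 <= t ->
  measurable A -> P (s + t) x A = (\int[P s x]_y P t y A)%E.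
Proof. exact: (markovD (diffusion_markov hX)). Qed.

Let Pm (A : set (borel E)) : measurable A ->
  measurable_fun [set z : measurableTypeR R * borel E | 0 <= z.1]
    (fun z => P z.1 z.2 A).
Proof. exact: (markov_measurable (diffusion_markov hX)). Qed.

Let Pinv t : 0 <= t -> forall A : set (borel E), measurable A ->
  (\int[mu]_x P t x A)%E = mu A.
Proof. by move=> t0 A mA; exact: hmu. Qed.

Lemma strong_continuity f : bdd f -> forall e : R, 0 < e ->
  exists2 r : R, 0 < r & forall h, 0 < h -> h < r ->
    \int[mu]_x ((kop (P h) f x - f x) ^+ 2) <= e.
Proof.
move=> hf e e0; have sf := bdd_sqi mu1 hf.
have := diffusion_continuous hX (lpi_Lfun _ ((lpi2 mu f).2 sf)).
rewrite ler1n => /(_ isT)/cvg_at_right0P H.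
have s0 : 0 < Num.sqrt e by rewrite sqrtr_gt0.
have [|r r0 Hr] := H _ _ s0; first by move=> h; exact: Lnorm_ge0.
exists r => // h h0 hr; have := Hr h h0 hr.
rewrite Lpnorm2_lt//; first by rewrite sqr_sqrtr ?(ltW e0)// => /ltW.
exact: (bdd_sqi mu1 (bddB (kop_bdd P h hf) hf)).
Qed.

(** On the core, the quadratic form of the generator is the energy, because the
    generator of the square of a function has mean zero. *)
Lemma poincare_core f : D f ->
  \int[mu]_x (f x ^+ 2) - (\int[mu]_x f x) ^+ 2 <=
  - C * \int[mu]_x (f x * L f x).
Proof.
move=> Df; have [/Lfun2_sqi sf /Lfun2_sqi sLf] := (diffusion_core hX).1 _ Df.
have Dff := diffusion_mul hX Df Df.
have [/Lfun1_integrable i1 /Lfun1_integrable i2 gen] :=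
  diffusion_generator hX (diffusion_domain hX Dff).
have z := Rint_generator Pm Pinv i1 i2 (gen 1 ler01).
have ifL := sqi_mul sf sLf.
have := hP Df; rewrite /variance; congr (_ <= _).
rewrite mulNr -mulrN; congr (_ * _).
rewrite (_ : carre_du_champ L f f =
  (fun x => 2^-1 * L (f \* f) x - f x * L f x)).
  by rewrite (RintB (itgZ _ i2) ifL) (RintZ _ i2) z mulr0 sub0r.
by apply/funext => x; rewrite /carre_du_champ; field.
Qed.

(** The inequality extends to the domain of the generator by density of the
    core in the graph norm. *)
Lemma poincare_generator F G : bdd F -> bdd G -> gen_pair P mu F G ->
  \int[mu]_x (F x ^+ 2) - (\int[mu]_x F x) ^+ 2 <=
  - C * \int[mu]_x (F x * G x).
Proof.
move=> hF hG FG; have sF := bdd_sqi mu1 hF; have sG := bdd_sqi mu1 hG.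
have sP h : sqi mu (fun x => h^-1 * (kop (P h) F x - F x) - G x).
  exact: (bdd_sqi mu1 (bddB (bddZ h^-1 (bddB (kop_bdd P h hF) hF)) hG)).
have gFG : L2_generator P mu F G.
  split; [by apply: lpi_Lfun; [rewrite ler1n|exact/lpi2]..|].
  apply/cvg_at_right0P => [h|e e0]; first exact: Lnorm_ge0.
  have [|r r0 Hr] := FG (e ^+ 2 / 2); first by rewrite divr_gt0// exprn_gt0.
  exists r => // h h0 hr; rewrite Lpnorm2_lt//; last exact: sP.
  apply: le_lt_trans (Hr h h0 hr) _.
  by rewrite ltr_pdivrMr// ltr_pMr ?exprn_gt0// ltr1n.
set a := \int[mu]_x (F x ^+ 2); set b := \int[mu]_x (G x ^+ 2).
have a0 : 0 <= a by apply: Rintegral_ge0 => x _; exact: sqr_ge0.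
have b0 : 0 <= b by apply: Rintegral_ge0 => x _; exact: sqr_ge0.
pose A := Num.sqrt a; have A0 : 0 <= A by exact: sqrtr_ge0.
pose B := Num.sqrt b; have B0 : 0 <= B by exact: sqrtr_ge0.
have aA : a <= A ^+ 2 by rewrite sqr_sqrtr.
have bB : b <= B ^+ 2 by rewrite sqr_sqrtr.
pose K := C * (A + B + 1) + 4 * A + 1.
have K0 : 0 < K by rewrite ltr_wpDl// !addr_ge0// mulr_ge0 ?(ltW C0) ?addr_ge0.
apply/ler_addgt0Pr => e' e'0; pose e := Num.min 1 (e' / K).
have e0 : 0 < e by rewrite lt_min ltr01 divr_gt0.
have e1 : e <= 1 by rewrite ge_min lexx.
have ee : K * e <= e' by rewrite mulrC -ler_pdivlMr// ge_min lexx orbT.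
have [f Df [fF LfG]] := (diffusion_core hX).2 _ _ gFG e e0.
have [/Lfun2_sqi sf /Lfun2_sqi sLf] := (diffusion_core hX).1 _ Df.
have su := sqiB sf sF; have sv := sqiB sLf sG.
rewrite Lpnorm2_lt// in fF; rewrite Lpnorm2_lt// in LfG.
have h1 := Rint_CS_le sF sv A0 (ltW e0) aA (ltW LfG).
have h2 := Rint_CS_le su sG (ltW e0) B0 (ltW fF) bB.
have h3 := Rint_CS_le su sv (ltW e0) (ltW e0) (ltW fF) (ltW LfG).
have h4 := Rint_CS_le sF su A0 (ltW e0) aA (ltW fF).
have h5 := Rint_mean_le mu1 sF A0 aA.
have h6 := Rint_mean_le mu1 su (ltW e0) (ltW fF).
have E1 : \int[mu]_x (f x * L f x) = \int[mu]_x (F x * G x) +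
    \int[mu]_x (F x * (L f x - G x)) + \int[mu]_x ((f x - F x) * G x) +
    \int[mu]_x ((f x - F x) * (L f x - G x)).
  have i1 := sqi_mul sF sG; have i2 := sqi_mul sF sv.
  have i3 := sqi_mul su sG; have i4 := sqi_mul su sv.
  rewrite -(RintD i1 i2) -(RintD (itgD i1 i2) i3).
  rewrite -(RintD (itgD (itgD i1 i2) i3) i4).
  by apply: eq_Rintegral => x _; ring.
have E2 : \int[mu]_x (f x ^+ 2) = a + 2 * \int[mu]_x (F x * (f x - F x)) +
    \int[mu]_x ((f x - F x) ^+ 2).
  have i1 := sqi_mul sF su.
  rewrite -(RintZ _ i1) -(RintD sF.2 (itgZ _ i1)).
  rewrite -(RintD (itgD sF.2 (itgZ _ i1)) su.2).
  by apply: eq_Rintegral => x _; ring.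
have E3 : \int[mu]_x f x = \int[mu]_x F x + \int[mu]_x (f x - F x).
  rewrite -(RintD (sqi_itg mu1 sF) (sqi_itg mu1 su)).
  by apply: eq_Rintegral => x _; rewrite addrC subrK.
have uu : 0 <= \int[mu]_x ((f x - F x) ^+ 2).
  by apply: Rintegral_ge0 => x _; exact: sqr_ge0.
exact: (poincare_arith C0 (ltW e0) e1 ee h1 h2 h3 h4 h5 h6 uu
  (poincare_core Df) E1 E2 E3).
Qed.

(** Exponential decay of the variance along the semigroup. *)
Theorem diffusion_variance_decay t : 0 <= t ->
  variance_contraction mu (P t) (expR (- 2 * t / C)).
Proof.
exact: (variance_decay P0 PD Pm Pinv strong_continuity C0 poincare_generator).
Qed.

End Core.

(** * Decay of the moments along the semigroup *)

Lemma half_le_1subexp (R : realType) (u : R) : 0 <= u -> u <= 1 ->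
  u / 2 <= 1 - expR (- u).
Proof.
move=> u0 u1; have h := expR_ge1Dx u.
have e0 : 0 < expR (- u) by exact: expR_gt0.
have e1 : expR (- u) * (1 + u) <= 1.
  apply: (@le_trans _ _ (expR (- u) * expR u)).
    by apply: ler_wpM2l; [exact: ltW|exact: h].
  by rewrite -expRD addNr expR0.
nra.
Qed.

Section Decay.
Context (R : realType) (E : completePseudoMetricType R).
Variables (P : R -> R.-pker borel E ~> borel E) (mu : probability (borel E) R).
Hypothesis PD : forall s t (x : borel E) (A : set (borel E)), 0 <= s -> 0 <= t ->
  measurable A -> P (s + t) x A = (\int[P s x]_y P t y A)%E.
Hypothesis P0 : forall (x : borel E) (A : set (borel E)), measurable A ->
  P 0 x A = \d_x A.
Hypothesis Pinv : forall t, 0 <= t -> forall A : set (borel E), measurable A ->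
  (\int[mu]_x P t x A)%E = mu A.
Variable C : R.
Hypothesis C0 : 0 < C.
Hypothesis Pvar : forall t, 0 <= t ->
  variance_contraction mu (P t) (expR (- 2 * t / C)).
Implicit Types (f : borel E -> R) (p t lambda K : R).

Let mu1 : mu setT = 1%E := probability_setT mu.

(** Exponential decay only needs to be checked on the moments of centered
    functions. *)
Lemma decay_of_moments p lambda K : 1 <= p -> 0 <= K ->
  (forall t f, 0 <= t -> lpi mu p f -> \int[mu]_x f x = 0 ->
    \int[mu]_x (`|kop (P t) f x| `^ p) <=
    (K * expR (- lambda * t)) `^ p * \int[mu]_x (`|f x| `^ p)) ->
  exponential_decay P mu p lambda K.
Proof.
move=> p1 K0 H f /(Lfun_lpi p1) hf t t0.
have p0 : 0 < p by exact: lt_le_trans p1.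
have fi := lpi_itg mu1 p1 hf; pose m := \int[mu]_x f x.
pose g x := f x - m.
have hg : lpi mu p g by exact: (lpiB p1 hf (lpi_cst mu1 p m)).
have g0 : \int[mu]_x g x = 0.
  by rewrite (RintB fi (itg_cst mu1 m)) Rint_cst// subrr.
have hK : lpi mu p (fun x => kop (P t) f x - m).
  exact: (lpiB p1 (lpi_kop (Pinv t0) p1 hf).1 (lpi_cst mu1 p m)).
have mE : \int[mu]_x semigroup P t f x = m by exact: (Rint_kop (Pinv t0) fi).
rewrite /centered_norm mE -/m (LpnormE p1 hK) (LpnormE p1 hg).
have -> : \int[mu]_x (`|kop (P t) f x - m| `^ p) =
    \int[mu]_x (`|kop (P t) g x| `^ p).
  apply: ae_eq_Rint.
  - exact: itg_meas hK.2.
  - exact: itg_meas (lpi_kop (Pinv t0) p1 hg).1.2.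
  have := ae_itg_pker (Pinv t0) fi; apply: filterS => x fx.
  rewrite /g (kopB fx (itg_cst (pker_setT _ _) m)) kop_cst//.
rewrite -EFinM lee_fin.
have h := H t g t0 hg g0.
have M0 h' : 0 <= \int[mu]_x (`|h' x| `^ p).
  by apply: Rintegral_ge0 => x _; exact: powR_ge0.
have Ke : 0 <= K * expR (- lambda * t) by rewrite mulr_ge0 ?expR_ge0.
have h2 : (\int[mu]_x (`|kop (P t) g x| `^ p)) `^ p^-1 <=
    ((K * expR (- lambda * t)) `^ p * \int[mu]_x (`|g x| `^ p)) `^ p^-1.
  by apply: ge0_ler_powR; rewrite ?nnegrE ?invr_ge0 ?mulr_ge0 ?powR_ge0 ?M0// ltW.
apply: le_trans h2 _; rewrite powRM ?powR_ge0 ?M0//.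
by rewrite -powRrM mulfV ?gt_eqF// powRr1.
Qed.

Lemma expR_powR p lambda K t : 0 <= K ->
  (K * expR (- lambda * t)) `^ p = K `^ p * expR (- (p * lambda) * t).
Proof.
by move=> K0; rewrite powRM ?expR_ge0// -expRM; congr (_ * expR _); ring.
Qed.

Lemma Rint_centered_contraction t p f : 0 <= t -> 1 <= p -> lpi mu p f ->
  \int[mu]_x (`|kop (P t) f x| `^ p) <= \int[mu]_x (`|f x| `^ p).
Proof. by move=> t0 p1 hf; exact: (lpi_kop (Pinv t0) p1 hf).2. Qed.

Lemma centered_interpolation t p f : 0 <= t -> 2 <= p -> lpi mu p f ->
  \int[mu]_x f x = 0 -> \int[mu]_x (`|kop (P t) f x| `^ p) <=
    2 `^ (p - 2) * expR (- 2 * t / C) * \int[mu]_x (`|f x| `^ p).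
Proof.
move=> t0; rewrite le_eqVlt => /predU1P[<-|p2] hf f0; last first.
  exact: (powR_kop_interpolation (Pinv t0) (Pvar t0) (expR_ge0 _) p2 hf f0).
rewrite subrr powRr0 mul1r.
have e2 (g : borel E -> R) :
    (fun x => `|g x| `^ 2) = (fun x => g x ^+ 2).
  by apply/funext => x; rewrite powR_mulrn// real_normK ?num_real.
have := Pvar t0 ((lpi2 mu f).1 hf).
by rewrite f0 expr0n mulr0 addr0 !e2.
Qed.

(** Strict contraction over short times, iterated. *)
Lemma exponential_decay_contraction p : 1 < p -> exists kappa : R,
  [/\ 0 < kappa, 2 <= p -> kappa = 2 `^ (1 - 2 * p) &
    exponential_decay P mu p (kappa / (p * C)) 1].
Proof.
move=> p1; have [k [k0 k1 kE H]] := strict_contraction mu p1.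
have p0 : 0 < p by exact: lt_trans p1.
exists k; split => //; apply: decay_of_moments => //; first exact: ltW.
move=> t f t0 hf f0; rewrite expR_powR// powR1 mul1r.
have -> : - (p * (k / (p * C))) * t = - (k * (t / C)).
  by field; rewrite !gt_eqF.
have [n] : exists n : nat, 2 * t / C < n.+1%:R.
  exists (Num.bound (2 * t / C)); apply: lt_trans (archi_boundP _) _.
    by rewrite divr_ge0 ?mulr_ge0// ltW.
  by rewrite ltr_nat.
move=> nt; pose h := t / n.+1%:R; have h0 : 0 <= h by rewrite divr_ge0.
pose u := 2 * h / C; have u0 : 0 <= u by rewrite divr_ge0 ?mulr_ge0// ltW.
have u1 : u <= 1.
  have -> : u = 2 * t / C / n.+1%:R.
    by rewrite /u /h mulrA mulrAC.
  by rewrite ler_pdivrMr// mul1r ltW.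
(* [1 - k (1 - exp (- u)) <= exp (- k u / 2)] for [0 <= u <= 1] *)
pose q := expR (- (k * u / 2)).
have q0 : 0 <= q by exact: expR_ge0.
have step g : lpi mu p g -> \int[mu]_x g x = 0 ->
    \int[mu]_x (`|kop (P h) g x| `^ p) <= q * \int[mu]_x (`|g x| `^ p).
  move=> hg g0; have e1 : expR (- 2 * h / C) <= 1.
    apply: (@le_trans _ _ (expR 0)); last by rewrite expR0.
    by rewrite ler_expR !mulNr oppr_le0.
  apply: le_trans (H _ _ _ (Pinv h0) (Pvar h0) e1 hg g0) _.
  apply: ler_wpM2r; first by apply: Rintegral_ge0 => x _; exact: powR_ge0.
  apply: le_trans (expR_ge1Dx _); rewrite lerD2l lerN2.
  rewrite -mulrA; apply: ler_wpM2l; first exact: ltW.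
  by rewrite !mulNr; exact: half_le_1subexp.
have iter j : [/\ lpi mu p (kop (P (j%:R * h)) f),
    \int[mu]_x kop (P (j%:R * h)) f x = 0 &
    \int[mu]_x (`|kop (P (j%:R * h)) f x| `^ p) <=
    q ^+ j * \int[mu]_x (`|f x| `^ p)].
  have jh i : 0 <= i%:R * h by rewrite mulr_ge0.
  have fi := lpi_itg mu1 (ltW p1) hf.
  elim: j => [|j [l z b]].
    have E0 : kop (P (0%:R * h)) f = f.
      apply/funext => x; rewrite mul0r; apply: kop_0 => //; exact: hf.1.
    by rewrite E0 expr0 mul1r.
  have [l1 _] := lpi_kop (Pinv (jh j.+1)) (ltW p1) hf; split => //.
    by rewrite (Rint_kop (Pinv (jh j.+1)) fi).
  have -> : \int[mu]_x (`|kop (P (j.+1%:R * h)) f x| `^ p) =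
      \int[mu]_x (`|kop (P h) (kop (P (j%:R * h)) f) x| `^ p).
    apply: ae_eq_Rint.
    - exact: itg_meas l1.2.
    - exact: itg_meas (lpi_kop (Pinv h0) (ltW p1) l).1.2.
    have := ae_itg_pker (Pinv (jh j.+1)) fi; apply: filterS => x fx.
    have jE : h + j%:R * h = j.+1%:R * h by rewrite -[j.+1]add1n natrD mulrDl mul1r.
    by rewrite (kop_semigroup PD h0 (jh j)) jE.
  apply: le_trans (step _ l z) _; rewrite exprS -mulrA.
  by apply: ler_wpM2l.
have nh : n.+1%:R * h = t by rewrite /h mulrC divfK// pnatr_eq0.
have [_ _] := iter n.+1; rewrite nh => /le_trans; apply.
rewrite /q -expRM_natr le_eqVlt; apply/orP; left; apply/eqP.
by congr (expR _ * _); rewrite /u -nh; field; rewrite gt_eqF.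
Qed.

Lemma exponential_decay_interpolation p lambda K : 2 <= p -> 0 <= K ->
  (forall t, 0 <= t -> 2 `^ (p - 2) * expR (- 2 * t / C) <=
    K `^ p * expR (- (p * lambda) * t)) ->
  exponential_decay P mu p lambda K.
Proof.
move=> p2 K0 H; apply: decay_of_moments => //.
  by apply: le_trans p2; rewrite ler1n.
move=> t f t0 hf f0; apply: le_trans (centered_interpolation t0 p2 hf f0) _.
rewrite expR_powR//; apply: ler_wpM2r (H t t0).
by apply: Rintegral_ge0 => x _; exact: powR_ge0.
Qed.

(** The geometric mean of the interpolation bound and of the contraction
    property. *)
Lemma exponential_decay_geometric p lambda K theta : 2 <= p -> 0 <= K ->
  0 <= theta -> theta <= 1 -> p * lambda = 2 * theta / C ->
  2 `^ ((p - 2) * theta) <= K `^ p ->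
  exponential_decay P mu p lambda K.
Proof.
move=> p2 K0 th0 th1 pl HK.
have p1 : 1 <= p by apply: le_trans p2; rewrite ler1n.
apply: decay_of_moments => // t f t0 hf f0.
rewrite expR_powR// pl; set M := \int[mu]_x (`|f x| `^ p).
have M0 : 0 <= M by apply: Rintegral_ge0 => x _; exact: powR_ge0.
pose X := 2 `^ (p - 2) * expR (- 2 * t / C).
have X0 : 0 < X by rewrite mulr_gt0 ?powR_gt0 ?expR_gt0.
have XE : X `^ theta = 2 `^ ((p - 2) * theta) * expR (- (2 * theta / C) * t).
  rewrite powRM ?powR_ge0 ?expR_ge0// -powRrM -expRM.
  by congr (_ * expR _); field; rewrite gt_eqF.
have h1 := Rint_centered_contraction t0 p1 hf.
have h2 := centered_interpolation t0 p2 hf f0.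
have h3 : \int[mu]_x (`|kop (P t) f x| `^ p) <= X `^ theta * M.
  have [X1|X1] := leP X 1.
    apply: le_trans h2 _; rewrite -/X -/M; apply: ler_wpM2r => //.
    by rewrite -[leLHS]powRr1 ?(ltW X0)//; apply: ger_powR => //; rewrite X0.
  apply: le_trans h1 _; rewrite -/M -[leLHS]mul1r; apply: ler_wpM2r => //.
  by rewrite -(powRr0 X); apply: ler_powR => //; exact: ltW.
apply: le_trans h3 _; rewrite XE; apply: ler_wpM2r => //.
by apply: ler_wpM2r => //; exact: expR_ge0.
Qed.

End Decay.

(** * The explicit constants *)

Section Constants.
Context (R : realType).
Implicit Types p C m : R.

(** The rate [kappa / (p C)] with [kappa = 2 ^ (1 - 2 p)] is larger than
    required: with [Q = 2 ^ k.+1 >= p] it is at least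
    [2 ^ (1 - 2 Q) / (Q C)], to be compared with [2 ^ (k + 6 - 7 Q) / C]. *)
Lemma rate_lower_bound p C (k : nat) : 0 < C -> 2 <= p ->
  (1 < k)%N -> p <= 2 ^+ k.+1 ->
  2 ^+ (k + 6) / (2 ^+ (7 * 2 ^ k.+1) * C) <= 2 `^ (1 - 2 * p) / (p * C).
Proof.
move=> C0 p2 k1 pk; have p0 : 0 < p by exact: lt_le_trans p2.
set Q := (2 ^ k.+1)%N.
have QE : Q%:R = 2 ^+ k.+1 :> R by rewrite natrX.
have kQ : (k + 6 + k.+1 + 2 * Q <= (7 * Q).+1)%N.
  have : (k.+1 < Q)%N by exact: ltn_expl.
  by move: Q {QE} => Q; lia.
rewrite ler_pdivrMr; last by rewrite mulr_gt0 ?exprn_gt0.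
have -> : 2 `^ (1 - 2 * p) / (p * C) * (2 ^+ (7 * Q) * C) =
    2 `^ (1 - 2 * p) * 2 ^+ (7 * Q) / p.
  by field; rewrite !gt_eqF.
rewrite ler_pdivlMr//.
apply: (@le_trans _ _ (2 ^+ (k + 6) * 2 ^+ k.+1)).
  by rewrite ler_pM2l// exprn_gt0.
apply: (@le_trans _ _ (2 `^ (1 - 2 * Q%:R) * 2 ^+ (7 * Q))); last first.
  rewrite ler_pM2r ?exprn_gt0//; apply: ler_powR; first by rewrite ler1n.
  by rewrite lerD2l lerN2 ler_pM2l// QE.
rewrite powRB; last by rewrite pnatr_eq0 implybT.
rewrite powRr1// -natrM powR_mulrn// mulrAC -exprS.
rewrite ler_pdivlMr ?exprn_gt0// -!exprD.
by rewrite ler_weXn2l// ler1n.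
Qed.

Lemma powR4 p : 4 `^ p = 2 `^ (2 * p) :> R.
Proof.
by rewrite powRrM powR_mulrn//; congr (_ `^ _); ring.
Qed.

Lemma le_2_powR p : 2 <= p -> 2 <= 2 `^ (p - 1) :> R.
Proof.
move=> p2; rewrite -[leLHS]powRr1//; apply: ler_powR; first by rewrite ler1n.
lra.
Qed.

(** The [p]-th power of the prefactor in the last bound is at least [2]. *)
Lemma prefactor_ge2 p m : 2 <= p -> 1 <= m ->
  2 <= 1 + 9 * p ^+ 2 / 4 * (p - 1) * 2 `^ ((3 * p - 2) / 2) * m /
                      (9 * p ^+ 2 / 4 * m * 2 `^ (p - 1) - p + 1).
Proof.
move=> p2 m1; set c := 9 * p ^+ 2 / 4; set T := 2 `^ (p - 1).
have cp : p <= c.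
  rewrite /c ler_pdivlMr//; have : 2 * p <= p ^+ 2 by rewrite expr2 ler_pM2r; lra.
  lra.
have T2 : 2 <= T by exact: le_2_powR.
have TS : T <= 2 `^ ((3 * p - 2) / 2).
  by apply: ler_powR; [rewrite ler1n|lra].
have c0 : 0 < c by lra.
have cm : c <= c * m by rewrite ler_peMr// ltW.
have cm0 : 0 < c * m by exact: lt_le_trans cm.
have cmT : 2 * (c * m) <= c * m * T by rewrite mulrC ler_pM2l.
have D0 : 0 < c * m * T - p + 1 by lra.
suff : 1 <= c * (p - 1) * 2 `^ ((3 * p - 2) / 2) * m / (c * m * T - p + 1).
  by lra.
rewrite ler_pdivlMr// mul1r; apply: (@le_trans _ _ (c * m * T)); first lra.
have -> : c * (p - 1) * 2 `^ ((3 * p - 2) / 2) * m =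
  c * m * ((p - 1) * 2 `^ ((3 * p - 2) / 2)) by ring.
rewrite ler_pM2l//; apply: (le_trans TS).
by rewrite ler_peMl ?powR_ge0//; lra.
Qed.

(** The weight for which [exponential_decay_geometric] gives the rate of the last
    bound; it is so small that the prefactor needed is at most [2]. *)
Lemma rate_exponent p m : 2 <= p -> 1 <= m ->
  let theta := 2 * (p - 1) / (9 * p * m * 2 `^ p) in
  [/\ 0 <= theta, theta <= 1 & (p - 2) * theta <= 1].
Proof.
move=> p2 m1 theta; have p0 : 0 < p by lra.
have T2 : p <= 2 `^ p.
  have h := @powR_tangent R p 2 1; rewrite !powR1 in h.
  have : 1 + p * 1 * (2 - 1) <= 2 `^ p by apply: h; lra.
  by rewrite mulr1 (_ : 2 - 1 = 1) ?mulr1; [lra|ring].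
have D0 : 0 < 9 * p * m * 2 `^ p by rewrite !mulr_gt0 ?powR_gt0//; lra.
have Dp : 9 * p * p <= 9 * p * m * 2 `^ p.
  apply: ler_pM => //; [by rewrite mulr_ge0 ?ltW|exact: ltW|].
  by rewrite ler_peMr// mulr_ge0 ?ltW.
split.
- by rewrite divr_ge0 ?(ltW D0)// mulr_ge0//; lra.
- by rewrite ler_pdivrMr// mul1r; apply: le_trans Dp; nra.
- rewrite mulrA ler_pdivrMr// mul1r; apply: le_trans Dp; nra.
Qed.

End Constants.
Theorem mainTheorem4 (R : realType) (E : completePseudoMetricType R)
    (P : R -> R.-pker borel E ~> borel E) (mu : probability (borel E) R)
    (L : (borel E -> R) -> (borel E -> R)) (D : set (borel E -> R)) (CP : R)
    (hE : polish E) (hX : diffusion P mu L D) (hmu : invariant P mu)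
    (hCP : 0 < CP) (hP : poincare mu L D CP) :
  [/\
      forall p : R, 1 < p ->
        exists lambda K : R, 0 < lambda /\ exponential_decay P mu p lambda K,
      forall p : R, 2 <= p ->
        exists lambda : R, 0 < lambda /\ exponential_decay P mu p lambda 1,
      forall p : R, 2 < p ->
        exists lambda : R,
          [/\ 0 < lambda,
              forall k : nat, (1 < k)%N -> 2 ^+ k < p -> p <= 2 ^+ k.+1 ->
                2 ^+ (k + 6) / (2 ^+ (7 * 2 ^ k.+1) * CP) <= lambda &
              exponential_decay P mu p lambda 1],
      (forall p : R, 2 < p ->
        exponential_decay P mu p (1 / (p * CP)) (4 `^ (1 - 1 / p))) /\
      (forall k : nat, (1 <= k)%N ->
        exponential_decay P mu (2 ^+ k) (2 / (2 ^+ k * CP))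
          (4 `^ (1 - 2 / 2 ^+ k))) &
      forall p : R, 2 <= p ->
        let m := Num.max 1 (2 `^ (p - 3)) in
        let c := 9 * p ^+ 2 / 4 in
        let lambda := 4 * (p - 1) / (9 * p ^+ 2 * m * 2 `^ p * CP) in
        let Kpp := 1 + c * (p - 1) * 2 `^ ((3 * p - 2) / 2) * m /
                      (c * m * 2 `^ (p - 1) - p + 1) in
        exponential_decay P mu p lambda (Kpp `^ (1 / p))].
Proof.
have P0 := markov0 (diffusion_markov hX).
have PD := markovD (diffusion_markov hX).
have Pinv t : 0 <= t -> forall A : set (borel E), measurable A ->
    (\int[mu]_x P t x A)%E = mu A.
  by move=> t0 A mA; exact: hmu.
have Pvar := diffusion_variance_decay hX hmu hCP hP.
have contr := exponential_decay_contraction PD P0 Pinv hCP Pvar.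
have interp := exponential_decay_interpolation Pinv Pvar.
have geom := exponential_decay_geometric Pinv hCP Pvar.
have gt0 (p kappa : R) : 1 < p -> 0 < kappa -> 0 < kappa / (p * CP).
  by move=> p1 k0; rewrite divr_gt0// mulr_gt0//; exact: lt_trans p1.
have two1 (p : R) : 2 <= p -> 1 < p by apply: lt_le_trans; rewrite ltr1n.
split.
- move=> p p1; have [k [k0 _ H]] := contr p p1.
  by exists (k / (p * CP)), 1; split => //; exact: gt0.
- move=> p /two1 p1; have [k [k0 _ H]] := contr p p1.
  by exists (k / (p * CP)); split => //; exact: gt0.
- move=> p /ltW p2; have [k [k0 kE H]] := contr p (two1 p p2).
  exists (k / (p * CP)); split => //; first exact: gt0 (two1 p p2) k0.
  by move=> n n1 _ pn; rewrite kE//; exact: rate_lower_bound.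
- split.
    move=> p p2; have p0 : 0 < p by apply: lt_trans p2.
    apply: interp => [||t t0]; [exact: ltW|exact: powR_ge0|].
    rewrite -powRrM powR4.
    (* 2 ^ (p - 2) <= 4 ^ (p - 1), and the rate claimed is half of the rate obtained *)
    have -> : 2 * ((1 - 1 / p) * p) = 2 * p - 2 by field; rewrite gt_eqF.
    have -> : - (p * (1 / (p * CP))) * t = - (t / CP).
      by field; rewrite !gt_eqF.
    apply: ler_pM; rewrite ?powR_ge0 ?expR_ge0//.
      by apply: ler_powR; [rewrite ler1n|lra].
    have : 0 <= t / CP by rewrite divr_ge0// ltW.
    by rewrite ler_expR -mulrA; lra.
  move=> k k1; have p2 : 2 <= 2 ^+ k :> R.
    by rewrite -[leLHS]expr1; apply: ler_weXn2l => //; rewrite ler1n.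
  move: (2 ^+ k : R) p2 => p p2; have p0 : 0 < p by apply: lt_le_trans p2.
  apply: interp => [||t t0]; [by []|exact: powR_ge0|].
  rewrite -powRrM powR4.
  (* here the rates agree, and 2 ^ (p - 2) <= 4 ^ (p - 2) *)
  have -> : 2 * ((1 - 2 / p) * p) = 2 * p - 4 by field; rewrite gt_eqF.
  have -> : - (p * (2 / (p * CP))) * t = - 2 * t / CP.
    by field; rewrite !gt_eqF.
  apply: ler_wpM2r; first exact: expR_ge0.
  by apply: ler_powR; [rewrite ler1n|lra].
- move=> p p2 m c lambda Kpp; have p0 : 0 < p by apply: lt_le_trans p2.
  have m1 : 1 <= m by rewrite le_max lexx.
  have [th0 th1 th2] := rate_exponent p2 m1.
  have K2 : 2 <= Kpp by exact: prefactor_ge2.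
  have K0 : 0 <= Kpp by apply: le_trans K2.
  apply: (geom _ _ _ _ p2 (powR_ge0 _ _) th0 th1).
    rewrite /lambda; field.
    by rewrite !gt_eqF ?powR_gt0//; apply: lt_le_trans m1.
  rewrite -powRrM divfK ?gt_eqF// powRr1//; apply: le_trans K2.
  by rewrite -[leRHS]powRr1//; apply: ler_powR => //; rewrite ler1n.
Qed.
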